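(* Let $N\ge1$ and $\lambda=(\lambda_1,\dots,\lambda_N)$. For any $a\in\mathbb{C}\setminus\{N-1,\dots,0\}$ and $b\in\{N-1,\dots,0\}$, with $\mu_{a,b}:=(a,N-1,\dots,\widehat{b},\dots,0)$, we have $$\frac{\mathcal{B}(\mu_{a,b},\lambda)}{\mathcal{B}(\rho,\lambda)}=(-1)^{N-b+1}\,\frac{\Gamma(N-b)\Gamma(b+1)\Gamma(a-N+1)(a-b)}{\Gamma(a+1)}\oint_{\{e^{\lambda_i}\}}\frac{dz}{2\pi\mathbf{i}}\oint_{\{0,z\}}\frac{dw}{2\pi\mathbf{i}}\cdot\frac{z^aw^{-b-1}}{z-w}\cdot\prod_{i=1}^N\frac{w-e^{\lambda_i}}{z-e^{\lambda_i}},$$ where the $z$-contour encloses the poles at $e^{\lambda_i}$ and avoids the negative real axis, and the $w$-contour encloses both $0$ and the $z$-contour.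
   Context: $\rho:=(N-1,\dots,1,0)$, and $(a,N-1,\dots,\widehat{b},\dots,0)$ denotes the $N$-tuple whose first coordinate is $a$ and whose remaining coordinates are $N-1,\dots,0$ with $b$ omitted. $\lambda$ is an $N$-tuple of real numbers. $\Delta(a):=\prod_{1\le i<j\le N}(a_i-a_j)$ is the Vandermonde determinant. The multivariate Bessel function is $\mathcal{B}(a,b):=\Delta(\rho)\frac{\det(e^{a_ib_j})_{i,j=1}^N}{\Delta(a)\Delta(b)}$ for $N$-tuples $a,b$ with distinct coordinates, extended analytically to all values of $a$ and $b$. The quotient $\Gamma(a-N+1)/\Gamma(a+1)$ is understood as a meromorphic function of $a$.
   Formalization: The printed sign (-1)^{N-b+1} is replaced by (-1)^{N-b}: for N=1, b=0 the left side is e^{aλ}, the printed prefactor equals 1 and the double contour integral equals -e^{aλ}, so the printed formula is off by a sign. *)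

(* Defs.v *)
From HB Require Import structures.
From mathcomp Require Import all_boot all_order all_algebra.
From mathcomp Require Import all_classical all_reals all_analysis.
From mathcomp Require Import complex.

Set Implicit Arguments.
Unset Strict Implicit.
Unset Printing Implicit Defensive.

Import Order.TTheory GRing.Theory Num.Theory.
Import numFieldNormedType.Exports.

Local Open Scope classical_set_scope.
Local Open Scope ring_scope.
Local Open Scope complex_scope.

Section ComplexFunctions.
Variable R : realType.
Implicit Types (z a s : R[i]) (n : nat).

Definition expC z : R[i] :=
  (expR (complex.Re z))%:C * (cos (complex.Im z) +i* sin (complex.Im z)).

(* Principal argument, with values in ]-pi, pi[, by the half-angle formula;
   the value on the branch cut ]-oo, 0] is junk. *)
Definition Arg z : R :=
  2 * atan (complex.Im z / (complex.Re `|z| + complex.Re z)).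

Definition LogC z : R[i] := ln (complex.Re `|z|) +i* Arg z.

Definition powC z a : R[i] := expC (a * LogC z).

(* Gauss's product formula for the Gamma function, valid off the poles
   0, -1, -2, ... *)
Definition GammaC z : R[i] :=
  lim ((fun n => (n`!)%:R * powC n%:R z / \prod_(k < n.+1) (z + k%:R)
         : R[i]^o) @ \oo).

(* The value at a of the meromorphic function Gamma(s - N + 1) / Gamma(s + 1).
   The punctured limit is needed at the negative integers, where numerator and
   denominator both have a pole but the quotient does not. *)
Definition Gamma_quot (N : nat) a : R[i] :=
  lim ((fun s : R[i]^o => GammaC (s - N%:R + 1) / GammaC (s + 1) : R[i]^o)
         @ (a : R[i]^o)^').

End ComplexFunctions.

Section Contours.
Variable R : realType.
Implicit Types (g : R -> R[i]) (G : seq (R -> R[i])) (f : R[i] -> R[i]).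

Definition C1 (h : R -> R) : Prop :=
  (forall t, derivable h t 1) /\ continuous (derive1 h).

(* Arcs are parametrized by [0, 1]. Being C^1 on the whole line is no
   restriction: a C^1 function on [0, 1] extends affinely to a C^1 function. *)
Definition C1_arc g : Prop :=
  C1 (fun t => complex.Re (g t)) /\ C1 (fun t => complex.Im (g t)).

Definition velocity g (t : R) : R[i] :=
  derive1 (fun t => complex.Re (g t)) t
    +i* derive1 (fun t => complex.Im (g t)) t.

(* A closed piecewise C^1 path, given as the cyclic list of its C^1 arcs. *)
Definition closed_contour G : Prop :=
  (forall g, g \in G -> C1_arc g) /\ cycle (fun g h => g 1 == h 0) G.

Definition trace G : set R[i] :=
  [set z | exists2 g, g \in G & exists2 t, t \in `[0, 1] & g t = z].

Definition arc_integral f g : R[i] :=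
  let F t := f (g t) * velocity g t in
  (\int[lebesgue_measure]_(t in `[0%R, 1%R]) complex.Re (F t))
    +i* (\int[lebesgue_measure]_(t in `[0%R, 1%R]) complex.Im (F t)).

(* The integral of f(z) dz / (2 pi i) along G. *)
Definition oint G f : R[i] :=
  ((2 * pi)*i)^-1 * \sum_(g <- G) arc_integral f g.

Definition winding_number G (p : R[i]) : R[i] := oint G (fun z => (z - p)^-1).

(* Once, and counterclockwise. *)
Definition encloses G (p : R[i]) : Prop :=
  ~ trace G p /\ winding_number G p = 1.

End Contours.

Section Bessel.
Variables (R : realType) (N : nat).
Implicit Types (a b : 'rV[R[i]]_N).

Definition Vandermonde_prod a : R[i] :=
  \prod_(i < N) \prod_(j < N | (i < j)%N) (a 0 i - a 0 j).

Definition rho : 'rV[R[i]]_N := \row_(i < N) (N - i.+1)%:R.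

Definition mu (a : R[i]) (b : 'I_N) : 'rV[R[i]]_N :=
  \row_(i < N) nth 0 (a :: [seq c%:R | c : nat <- rev (iota 0 N) & c != b :> nat]) i.

Definition Bessel_formula a b : R[i] :=
  Vandermonde_prod rho * \det (\matrix_(i, j) expC (a 0 i * b 0 j))
    / (Vandermonde_prod a * Vandermonde_prod b).

(* Differentiability is over R[i], i.e. B is an entire function of its 2N
   complex variables; such a B is unique by density of the N-tuples with
   distinct coordinates. *)
Definition is_Bessel (B : 'rV[R[i]]_N * 'rV[R[i]]_N -> R[i]^o) : Prop :=
  (forall x, differentiable B x) /\
  (forall a b, injective (a 0) -> injective (b 0) ->
     B (a, b) = Bessel_formula a b).

Definition Bessel a b : R[i] := xget (fun=> 0) [set B | is_Bessel B] (a, b).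

End Bessel.

(* Main.v *)
Require Import Defs.
From HB Require Import structures.
From mathcomp Require Import all_boot all_order all_algebra.
From mathcomp Require Import all_classical all_reals all_analysis.
From mathcomp Require Import complex.
From mathcomp Require Import perm ring lra zify.

Set Implicit Arguments.
Unset Strict Implicit.
Unset Printing Implicit Defensive.

Import Order.TTheory GRing.Theory Num.Theory.
Import numFieldNormedType.Exports.

Local Open Scope classical_set_scope.
Local Open Scope ring_scope.
Local Open Scope complex_scope.

(** Put [x_j = e^(lambda_j)], assumed distinct at first, [P = \prod_i (X - x_i)]
    and [L_j = P / (X - x_j)].  Up to a cyclic permutation of its rows, the matrix
    [x_j^(mu_i)] is the Vandermonde matrix of the [x_j] with the row of exponent
    [b] replaced by [x_j^a]; by Lagrange interpolation the quotient of the two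
    determinants is [S = \sum_j x_j^a [X^b]L_j / L_j(x_j)], up to sign.  The same
    argument for the points [rho] evaluates [Delta(mu) / Delta(rho)], which
    accounts for the Gamma factors.
    On the other side, partial fractions in [w] turn the inner integral into
    [- z^a Q(z) / P(z)], where [Q] is the polynomial part of [P / X^(b+1)].  Since
    [Q(x_j) = [X^b]L_j], the Cauchy formula for [z^a] in the slit plane turns the
    outer integral into [- S].
    Coinciding [lambda_j] follow by continuity of both sides.  The Bessel function
    is continuous, and exists, because [e^(a_i b_j)] is [\sum_(k, l) u_ik F_kl v_jl]
    with [u], [v] the triangular matrices of Newton polynomials at [a] and [b], of
    determinants [+- Delta(a)] and [+- Delta(b)], and [F] entire in [(a, b)]: thus
    [B = Delta(rho) \det F], without any division. *)

(** * Convergence of complex-valued functions *)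

(** Two quantitative points shape the proof. The theorem divides by the Bessel function at [rho], so
    continuity in [lambda] does not suffice: nonvanishing at coinciding entries comes from a lower
    bound uniform in the perturbation, each factor [(e^x - e^y) / (x - y)] being at least the
    exponential of a common lower bound of the entries. And entireness of the kernel series asks for
    termwise differentiation in [2N] variables: each term carries a second-order expansion with one
    explicit constant, and these constants are summed against [1 / n!]. Contour integration rests on
    real calculus over [[0, 1]] alone: holomorphy is the chain rule along real curves, a primitive
    makes integrals telescope around a closed contour, and Cauchy's formula uses only that the slit
    plane is star-shaped about each positive real. Local constancy of the winding number keeps the
    perturbed nodes inside the fixed contour. Gauss's product is shown to be nonzero, and not only
    convergent, so that Gamma values can be cancelled in the quotient. *)

Section ComplexLimits.
Variable R : realType.
Local Notation C := R[i].
Local Notation Re := (@complex.Re R).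
Local Notation Im := (@complex.Im R).

(** The norm of [R[i]] takes values in [R[i]] with its partial order; a real-valued modulus moves
    the estimates into [R], where linear arithmetic applies. *)
Definition cmod (z : C) : R := Re `|z|.

Lemma normE (z : C) : `|z| = (cmod z)%:C.
Proof. by rewrite /cmod normc_def. Qed.

Lemma cmodE (z : C) : cmod z = Num.sqrt (Re z ^+ 2 + Im z ^+ 2).
Proof. by rewrite /cmod normc_def. Qed.

Lemma cmod_ge0 z : 0 <= cmod z. Proof. by rewrite cmodE sqrtr_ge0. Qed.

Lemma cmodM z w : cmod (z * w) = cmod z * cmod w.
Proof. by apply: complexI; rewrite rmorphM -!normE normrM. Qed.

Lemma cmodD z w : cmod (z + w) <= cmod z + cmod w.
Proof. by rewrite -lecR rmorphD -!normE ler_normD. Qed.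

Lemma cmodN z : cmod (- z) = cmod z.
Proof. by apply: complexI; rewrite -!normE normrN. Qed.

Lemma cmodV z : cmod z^-1 = (cmod z)^-1.
Proof. by apply: complexI; rewrite fmorphV -!normE normfV. Qed.

Lemma cmod_eq0 z : (cmod z == 0) = (z == 0).
Proof. by rewrite -(inj_eq (@complexI R)) -normE normr_eq0. Qed.

Lemma cmod0 : cmod 0 = 0. Proof. by apply/eqP; rewrite cmod_eq0. Qed.

Lemma cmod1 : cmod 1 = 1.
Proof. by apply: complexI; rewrite -normE normr1. Qed.

Lemma cmod_gt0 z : (0 < cmod z) = (z != 0).
Proof. by rewrite lt0r cmod_ge0 andbT cmod_eq0. Qed.

Lemma cmodR (x : R) : cmod x%:C = `|x|.
Proof. by rewrite cmodE /= expr0n addr0 sqrtr_sqr. Qed.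

Lemma cmodX z n : cmod (z ^+ n) = cmod z ^+ n.
Proof. by elim: n => [|n IH]; rewrite ?cmod1// !exprS cmodM IH. Qed.

Lemma Re_le_cmod z : `|Re z| <= cmod z.
Proof. by rewrite -lecR -normE normc_ge_Re. Qed.

Lemma Im_le_cmod z : `|Im z| <= cmod z.
Proof.
rewrite cmodE -sqrtr_sqr ler_sqrt ?lerDr ?sqr_ge0//.
by rewrite addr_ge0 ?sqr_ge0.
Qed.

Lemma cmod_le_ReIm z : cmod z <= `|Re z| + `|Im z|.
Proof.
rewrite {1}[z]complexE; apply: (le_trans (cmodD _ _)).
by rewrite cmodM !cmodR lerD2l cmodE /= expr0n add0r expr1n sqrtr1 mul1r.
Qed.

Definition tends (T : Type) (F : set_system T) (f : T -> C) (l : C) : Prop :=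
  (fun x => f x : C^o) @ F --> (l : C^o).

Lemma tendsP (T : Type) (F : set_system T) {FF : Filter F} (f : T -> C) l :
  tends F f l <-> forall e : R, 0 < e -> \forall x \near F, cmod (l - f x) < e.
Proof.
split=> [/cvgrPdist_lt h e e0|h].
  have /h : 0 < e%:C by rewrite ltcR.
  by apply: filterS => x; rewrite normE ltcR.
(* Positivity in [R[i]] forces the imaginary part of [e] to vanish, so this [e] is a real one. *)
apply/cvgrPdist_lt => e; rewrite ltcE /= => /andP[/eqP Ie e0].
have := h _ e0; apply: filterS => x H.
by rewrite normE ltcE /= Ie eqxx.
Qed.

Lemma tends_ReIm (T : Type) (F : set_system T) {FF : Filter F} (f : T -> C) l :
  tends F f l <->
  ((fun x => Re (f x)) @ F --> Re l) /\ ((fun x => Im (f x)) @ F --> Im l).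
Proof.
split=> [/tendsP h|[/cvgrPdist_lt h1 /cvgrPdist_lt h2]].
  split; apply/cvgrPdist_lt => e /h; apply: filterS => x; apply: le_lt_trans.
    by rewrite -raddfB Re_le_cmod.
  by rewrite -raddfB Im_le_cmod.
apply/tendsP => e e0; have e20 : 0 < e / 2 by rewrite divr_gt0.
apply: filterS2 (h1 _ e20) (h2 _ e20) => x H1 H2.
apply: (le_lt_trans (cmod_le_ReIm _)); rewrite !raddfB.
by rewrite [e]splitr ltrD.
Qed.

Section Algebra.
Variables (T : Type) (F : set_system T).
Context {FF : Filter F}.
Implicit Types f g : T -> C.

Lemma tends_cst l : tends F (fun=> l) l. Proof. exact: cvg_cst. Qed.

Lemma tendsD f g a b : tends F f a -> tends F g b ->
  tends F (fun x => f x + g x) (a + b).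
Proof. exact: cvgD. Qed.

Lemma tendsB f g a b : tends F f a -> tends F g b ->
  tends F (fun x => f x - g x) (a - b).
Proof. exact: cvgB. Qed.

Lemma tendsM f g a b : tends F f a -> tends F g b ->
  tends F (fun x => f x * g x) (a * b).
Proof. exact: (@cvgM R[i]). Qed.

Lemma tendsV f a : a != 0 -> tends F f a -> tends F (fun x => (f x)^-1) (a^-1).
Proof. exact: (@cvgV R[i]). Qed.

Lemma tendsX f a n : tends F f a -> tends F (fun x => f x ^+ n) (a ^+ n).
Proof.
move=> h; elim: n => [|n IH]; first exact: tends_cst.
by under [X in tends _ X]eq_fun do rewrite exprS; rewrite exprS; apply: tendsM.
Qed.

Lemma tends_sum (I : Type) (r : seq I) (P : pred I) (f : I -> T -> C) a :
  (forall i, P i -> tends F (f i) (a i)) ->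
  tends F (fun x => \sum_(i <- r | P i) f i x) (\sum_(i <- r | P i) a i).
Proof.
move=> h; elim: r => [|i r IH].
  by under [X in tends _ X]eq_fun do rewrite big_nil; rewrite big_nil; apply: tends_cst.
under [X in tends _ X]eq_fun do rewrite big_cons; rewrite big_cons.
case: ifP => Pi; last exact: IH.
by apply: tendsD; [exact: h|exact: IH].
Qed.

Lemma tends_sum_seq (I : eqType) (r : seq I) (f : I -> T -> C) a :
  (forall i, i \in r -> tends F (f i) (a i)) ->
  tends F (fun x => \sum_(i <- r) f i x) (\sum_(i <- r) a i).
Proof.
elim: r => [|i r IH] h.
  by under [X in tends _ X]eq_fun do rewrite big_nil; rewrite big_nil; apply: tends_cst.
under [X in tends _ X]eq_fun do rewrite big_cons; rewrite big_cons.
apply: tendsD; first by apply: h; rewrite mem_head.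
by apply: IH => j jr; apply: h; rewrite in_cons jr orbT.
Qed.

Lemma tends_prod (I : Type) (r : seq I) (P : pred I) (f : I -> T -> C) a :
  (forall i, P i -> tends F (f i) (a i)) ->
  tends F (fun x => \prod_(i <- r | P i) f i x) (\prod_(i <- r | P i) a i).
Proof.
move=> h; elim: r => [|i r IH].
  by under [X in tends _ X]eq_fun do rewrite big_nil; rewrite big_nil; apply: tends_cst.
under [X in tends _ X]eq_fun do rewrite big_cons; rewrite big_cons.
case: ifP => Pi; last exact: IH.
by apply: tendsM; [exact: h|exact: IH].
Qed.

Lemma tends_eq f g a : (\forall x \near F, f x = g x) -> tends F f a -> tends F g a.
Proof.
move=> fg /tendsP h; apply/tendsP => e /h H.
by apply: filterS2 fg H => x ->.
Qed.

Lemma tends_real (f : T -> R) (l : R) : f @ F --> l -> tends F (fun x => (f x)%:C) l%:C.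
Proof. by move=> h; apply/tends_ReIm; split => //=; apply: cvg_cst. Qed.

Lemma tends_cmod f a : tends F f a -> cmod (f x) @[x --> F] --> cmod a.
Proof.
move=> /tendsP h; apply/cvgrPdist_lt => e /h; apply: filterS => x.
apply: le_lt_trans; rewrite ler_norml; apply/andP; split.
  rewrite lerNl opprB lerBlDr -[cmod (a - _)]cmodN opprB.
  by apply: le_trans (cmodD _ _); rewrite subrK.
by rewrite lerBlDr; apply: le_trans (cmodD _ _); rewrite subrK.
Qed.

End Algebra.

Lemma tends_unique (T : Type) (F : set_system T) {FF : ProperFilter F}
  (f : T -> C) a b : tends F f a -> tends F f b -> a = b.
Proof. by move=> h1 h2; apply: (@cvg_unique C^o) h1 h2; exact: norm_hausdorff. Qed.

Lemma tends_lim (T : Type) (F : set_system T) {FF : ProperFilter F}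
  (f : T -> C^o) (a : C) : tends F f a -> lim (f @ F) = a.
Proof. by move=> h; apply: cvg_lim h; exact: norm_hausdorff. Qed.

Lemma tends_comp (T : topologicalType) (S : Type) (F : set_system S) {FF : Filter F}
  (f : T -> C) x (g : S -> T) : tends (nbhs x) f (f x) -> g @ F --> x ->
  tends F (fun s => f (g s)) (f x).
Proof. by move=> h hg; apply: cvg_comp hg h. Qed.

End ComplexLimits.

(** * The exponential and the principal logarithm *)

Section ComplexCalculus.
Variable R : realType.
Local Notation C := R[i].
Local Notation Re := (@complex.Re R).
Local Notation Im := (@complex.Im R).

Lemma Re_mul (z w : C) : Re (z * w) = Re z * Re w - Im z * Im w.
Proof. by case: z w => [a b] [c d]. Qed.

Lemma Im_mul (z w : C) : Im (z * w) = Re z * Im w + Im z * Re w.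
Proof. by case: z w => [a b] [c d]. Qed.

Lemma Re_add (z w : C) : Re (z + w) = Re z + Re w.
Proof. by case: z w => [a b] [c d]. Qed.

Lemma Im_add (z w : C) : Im (z + w) = Im z + Im w.
Proof. by case: z w => [a b] [c d]. Qed.

Lemma Re_opp (z : C) : Re (- z) = - Re z. Proof. by case: z. Qed.

Lemma Im_opp (z : C) : Im (- z) = - Im z. Proof. by case: z. Qed.

Lemma Re_inv (z : C) : Re z^-1 = Re z / (Re z ^+ 2 + Im z ^+ 2).
Proof. by case: z => [a b]. Qed.

Lemma Im_inv (z : C) : Im z^-1 = - (Im z / (Re z ^+ 2 + Im z ^+ 2)).
Proof. by case: z => [a b]. Qed.

Lemma eqC (z w : C) : Re z = Re w -> Im z = Im w -> z = w.
Proof. by case: z w => [a b] [c d] /= -> ->. Qed.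

Lemma sqr_cmod (z : C) : cmod z ^+ 2 = Re z ^+ 2 + Im z ^+ 2.
Proof. by rewrite cmodE sqr_sqrtr // addr_ge0 ?sqr_ge0. Qed.

Lemma Re_expC (z : C) : Re (expC z) = expR (Re z) * cos (Im z).
Proof. by rewrite Re_mul /= mul0r subr0. Qed.

Lemma Im_expC (z : C) : Im (expC z) = expR (Re z) * sin (Im z).
Proof. by rewrite Im_mul /= mul0r addr0. Qed.

Lemma expCD (z w : C) : expC (z + w) = expC z * expC w.
Proof.
apply: eqC.
  by rewrite Re_expC Re_mul !Re_expC !Im_expC !raddfD expRD cosD; ring.
by rewrite Im_expC Im_mul !Re_expC !Im_expC !raddfD expRD sinD; ring.
Qed.

Lemma expC0 : expC 0 = 1 :> C.
Proof. by apply: eqC; rewrite ?(Re_expC, Im_expC) /= expR0 ?cos0 ?sin0 mul1r. Qed.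

Lemma expC_neq0 (z : C) : expC z != 0.
Proof.
apply/eqP => h; have := expCD z (- z); rewrite subrr expC0 h mul0r => /eqP.
by rewrite oner_eq0.
Qed.

Lemma expCN (z : C) : expC (- z) = (expC z)^-1.
Proof.
apply: (mulfI (expC_neq0 z)).
by rewrite -expCD subrr expC0 divff ?expC_neq0.
Qed.

Lemma expCR (x : R) : expC x%:C = (expR x)%:C.
Proof. by apply: eqC; rewrite ?(Re_expC, Im_expC) /= ?cos0 ?sin0 ?mulr1 ?mulr0. Qed.

Lemma expCMn (z : C) n : expC (n%:R * z) = expC z ^+ n.
Proof.
elim: n => [|n IH]; first by rewrite mul0r expC0.
by rewrite -natr1 mulrDl mul1r expCD IH exprSr.
Qed.

Lemma cmod_expC (z : C) : cmod (expC z) = expR (Re z).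
Proof.
rewrite cmodE Re_expC Im_expC !exprMn -mulrDr cos2Dsin2 mulr1 sqrtr_sqr.
by rewrite ger0_norm // expR_ge0.
Qed.

Lemma tends_expC (T : Type) (F : set_system T) {FF : Filter F} (f : T -> C) l :
  tends F f l -> tends F (fun x => expC (f x)) (expC l).
Proof.
move=> /tends_ReIm[h1 h2]; apply/tends_ReIm; split.
  under eq_fun do rewrite Re_expC; rewrite Re_expC.
  by apply: cvgM; [apply: continuous_cvg h1; exact: continuous_expR|
                   apply: continuous_cvg h2; exact: continuous_cos].
under eq_fun do rewrite Im_expC; rewrite Im_expC.
by apply: cvgM; [apply: continuous_cvg h1; exact: continuous_expR|
                 apply: continuous_cvg h2; exact: continuous_sin].
Qed.

Definition slit (z : C) : Prop := ~ (Re z <= 0 /\ Im z = 0).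

Lemma slit_neq0 z : slit z -> z != 0.
Proof. by move=> h; apply/eqP => z0; apply: h; rewrite z0. Qed.

(** This is the denominator of the half-angle formula in [Arg]. It vanishes only if [Re z] is minus
    the modulus, which forces [Im z = 0] and puts [z] on the cut. *)
Lemma slit_gt0 z : slit z -> 0 < cmod z + Re z.
Proof.
move=> h; rewrite ltNge; apply/negP => le0; apply: h.
have r0 := cmod_ge0 z; have rr := sqr_cmod z.
have r1 := Re_le_cmod z; move: r1; rewrite ler_norml => /andP[r1 r2].
have e : Re z = - cmod z by lra.
split; first by lra.
move: rr; rewrite e sqrrN => /eqP; rewrite eq_sym -subr_eq0 addrC addKr.
by rewrite sqrf_eq0 => /eqP.
Qed.

Lemma cmod_gt0_slit z : slit z -> 0 < cmod z.
Proof. by move=> /slit_neq0; rewrite cmod_gt0. Qed.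

Lemma Im_LogC (z : C) : Im (LogC z) = 2 * atan (Im z / (cmod z + Re z)).
Proof. by []. Qed.

Lemma tends_LogC (T : Type) (F : set_system T) {FF : Filter F} (f : T -> C) l :
  slit l -> tends F f l -> tends F (fun x => LogC (f x)) (LogC l).
Proof.
move=> sl fl; have /tends_ReIm[h1 h2] := fl; apply/tends_ReIm; split => /=.
  apply: continuous_cvg (tends_cmod fl).
  exact/continuous_ln/cmod_gt0_slit.
rewrite /Arg; apply: cvgM; first exact: cvg_cst.
apply: continuous_cvg; first exact: continuous_atan.
apply: cvgM => //; apply: cvgV; first by rewrite gt_eqF ?slit_gt0.
by apply: cvgD h1; apply: tends_cmod.
Qed.

Lemma LogC_real (x : R) : 0 < x -> LogC x%:C = (ln x)%:C.
Proof.
move=> x0; apply: eqC => /=; first by rewrite expr0n addr0 sqrtr_sqr gtr0_norm.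
by rewrite /Arg /= mul0r atan0 mulr0.
Qed.

End ComplexCalculus.

(** * Complex derivatives along curves *)

Section ComplexDerivative.
Variable R : realType.
Local Notation C := R[i].
Local Notation Re := (@complex.Re R).
Local Notation Im := (@complex.Im R).
Implicit Types (u w : R -> C) (t : R) (v : C) (F G : C -> C).

(* A plain proposition, so that instance resolution leaves the derivative open. *)
Definition rderiv (f : R -> R) (t a : R) : Prop := is_derive t 1 f a.

Section PointwiseRules.
Variables (f g : R -> R) (t a b : R).

Lemma rderiv_val : rderiv f t a -> a = b -> rderiv f t b.
Proof. by move=> h <-. Qed.

Lemma rderiv_add : rderiv f t a -> rderiv g t b ->
  rderiv (fun s => f s + g s) t (a + b).
Proof. exact: is_deriveD. Qed.

Lemma rderiv_sub : rderiv f t a -> rderiv g t b ->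
  rderiv (fun s => f s - g s) t (a - b).
Proof. exact: is_deriveB. Qed.

Lemma rderiv_opp : rderiv f t a -> rderiv (fun s => - f s) t (- a).
Proof. exact: is_deriveN. Qed.

Lemma rderiv_mul : rderiv f t a -> rderiv g t b ->
  rderiv (fun s => f s * g s) t (a * g t + f t * b).
Proof.
move=> hf hg.
have h : is_derive t 1 (fun s => f s * g s) (f t *: b + g t *: a) by exact: is_deriveM.
by apply: (is_derive_eq h); rewrite /GRing.scale /= addrC [g t * a]mulrC.
Qed.

Lemma rderiv_sqr : rderiv f t a ->
  rderiv (fun s => f s ^+ 2) t (2 * f t * a).
Proof.
move=> hf.
have h : is_derive t 1 (fun s => f s * f s) (f t *: a + f t *: a) by exact: is_deriveM.
by under eq_fun do rewrite expr2; apply: (is_derive_eq h); rewrite /GRing.scale /=; ring.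
Qed.

Lemma rderiv_inv : f t != 0 -> rderiv f t a ->
  rderiv (fun s => (f s)^-1) t (- (a / f t ^+ 2)).
Proof.
move=> f0 hf.
have h : is_derive t 1 (fun s => (f s)^-1) (- f t ^- 2 *: a) by exact: is_deriveV.
by apply: (is_derive_eq h); rewrite /GRing.scale /=; ring.
Qed.

Lemma rderiv_comp (h : R -> R) c : rderiv h (f t) c -> rderiv f t a ->
  rderiv (fun s => h (f s)) t (c * a).
Proof. exact: is_derive1_comp. Qed.

End PointwiseRules.

Definition cderiv u t v : Prop :=
  rderiv (fun s => Re (u s)) t (Re v) /\
  rderiv (fun s => Im (u s)) t (Im v).

Lemma cderiv_eq u t v v' : cderiv u t v -> v = v' -> cderiv u t v'.
Proof. by move=> h <-. Qed.

Lemma cderiv_cst (c : C) t : cderiv (fun=> c) t 0.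
Proof. by split; exact: is_derive_cst. Qed.

Lemma cderiv_real t : cderiv (fun s => s%:C) t 1.
Proof. by split; [exact: is_derive_id|exact: is_derive_cst]. Qed.

Lemma cderivD u w t v v' : cderiv u t v -> cderiv w t v' ->
  cderiv (fun s => u s + w s) t (v + v').
Proof.
move=> [u1 u2] [w1 w2]; split; rewrite raddfD.
  by under eq_fun do rewrite raddfD; apply: rderiv_add.
by under eq_fun do rewrite raddfD; apply: rderiv_add.
Qed.

Lemma cderivN u t v : cderiv u t v -> cderiv (fun s => - u s) t (- v).
Proof.
move=> [u1 u2]; split; rewrite raddfN.
  by under eq_fun do rewrite raddfN; apply: rderiv_opp.
by under eq_fun do rewrite raddfN; apply: rderiv_opp.
Qed.

Lemma cderivB u w t v v' : cderiv u t v -> cderiv w t v' ->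
  cderiv (fun s => u s - w s) t (v - v').
Proof. by move=> hu hw; apply: cderivD => //; apply: cderivN. Qed.

Lemma cderivM u w t v v' : cderiv u t v -> cderiv w t v' ->
  cderiv (fun s => u s * w s) t (v * w t + u t * v').
Proof.
move=> [u1 u2] [w1 w2]; split.
  under eq_fun do rewrite Re_mul.
  apply: rderiv_val; first by apply: rderiv_sub; apply: rderiv_mul; eassumption.
  by rewrite Re_add !Re_mul /GRing.scale /=; ring.
under eq_fun do rewrite Im_mul.
apply: rderiv_val; first by apply: rderiv_add; apply: rderiv_mul; eassumption.
by rewrite Im_add !Im_mul /GRing.scale /=; ring.
Qed.

Lemma ReIm_neq0 (z : C) : z != 0 -> Re z ^+ 2 + Im z ^+ 2 != 0.
Proof. by rewrite -sqr_cmod sqrf_eq0 cmod_eq0. Qed.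

Lemma cderivV u t v : u t != 0 -> cderiv u t v ->
  cderiv (fun s => (u s)^-1) t (- (u t) ^- 2 * v).
Proof.
move=> u0 [u1 u2]; have h := ReIm_neq0 u0.
have h2 : Re (u t ^+ 2) ^+ 2 + Im (u t ^+ 2) ^+ 2 != 0.
  by rewrite ReIm_neq0 // expf_neq0.
have dn : rderiv (fun s => (Re (u s) ^+ 2 + Im (u s) ^+ 2)^-1) t
   (- ((2 * Re (u t) * Re v + 2 * Im (u t) * Im v) /
     (Re (u t) ^+ 2 + Im (u t) ^+ 2) ^+ 2)).
  by apply: rderiv_inv => //; apply: rderiv_add; apply: rderiv_sqr; eassumption.
split.
  under eq_fun do rewrite Re_inv.
  apply: rderiv_val; first by apply: rderiv_mul; eassumption.
  rewrite Re_mul Re_opp Im_opp Re_inv Im_inv; move: h h2; rewrite expr2 Re_mul Im_mul.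
  set a := Re (u t); set b := Im (u t); move=> h h2; field.
  by rewrite ?h ?h2.
under eq_fun do rewrite Im_inv.
apply: rderiv_val; first by apply: rderiv_opp; apply: rderiv_mul; eassumption.
rewrite Im_mul Re_opp Im_opp Re_inv Im_inv; move: h h2; rewrite expr2 Re_mul Im_mul.
set a := Re (u t); set b := Im (u t); move=> h h2; field.
by rewrite ?h ?h2.
Qed.

Lemma cderiv_expC u t v : cderiv u t v ->
  cderiv (fun s => expC (u s)) t (expC (u t) * v).
Proof.
move=> [u1 u2]; split.
  under eq_fun do rewrite Re_expC.
  apply: rderiv_val.
    apply: rderiv_mul; last by apply: (rderiv_comp (h := cos)); [exact: is_derive_cos|eassumption].
    apply: (rderiv_comp (h := expR)); [exact: is_derive_expR|eassumption].
  by rewrite Re_mul Re_expC Im_expC /GRing.scale /=; ring.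
under eq_fun do rewrite Im_expC.
apply: rderiv_val.
  apply: rderiv_mul; last by apply: (rderiv_comp (h := sin)); [exact: is_derive_sin|eassumption].
  apply: (rderiv_comp (h := expR)); [exact: is_derive_expR|eassumption].
by rewrite Im_mul Re_expC Im_expC /GRing.scale /=; ring.
Qed.

(** Write [x], [y], [r] for the real part, imaginary part and modulus of [u t]. The real part is the
    derivative of [ln r]; the imaginary part simplifies through
    [1 + (y / (r + x))^2 = 2 r / (r + x)]. *)
Lemma cderiv_LogC u t v : slit (u t) -> cderiv u t v ->
  cderiv (fun s => LogC (u s)) t (v / u t).
Proof.
move=> st [u1 u2].
have r0 := cmod_gt0_slit st; have rx := slit_gt0 st; have e := sqr_cmod (u t).
have dr : rderiv (fun s => cmod (u s)) t
    ((Re (u t) * Re v + Im (u t) * Im v) / cmod (u t)).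
  under eq_fun do rewrite cmodE.
  apply: rderiv_val.
    apply: (rderiv_comp (h := Num.sqrt)); last first.
      by apply: rderiv_add; apply: rderiv_sqr; eassumption.
    by apply: is_derive1_sqrt; rewrite -sqr_cmod exprn_gt0.
  rewrite -cmodE /GRing.scale /=.
  by field; rewrite gt_eqF.
have ez : Re (u t) ^+ 2 + Im (u t) ^+ 2 = cmod (u t) ^+ 2 by [].
split.
  apply: rderiv_val.
    by apply: (rderiv_comp (h := @ln R)); [exact: is_derive1_ln|eassumption].
  rewrite Re_mul Re_inv Im_inv ez; field.
  by rewrite gt_eqF.
under eq_fun do rewrite Im_LogC.
apply: rderiv_val.
  apply: rderiv_mul; first exact: is_derive_cst.
  apply: (rderiv_comp (h := @atan R)); first exact: is_derive1_atan.
  apply: rderiv_mul; first eassumption.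
  apply: rderiv_inv; first by rewrite gt_eqF.
  by apply: rderiv_add; eassumption.
rewrite Im_mul Re_inv Im_inv ez /GRing.scale /=.
have iy : Im (u t) ^+ 2 = cmod (u t) ^+ 2 - Re (u t) ^+ 2 by rewrite e; ring.
have -> : 1 + (Im (u t) / (cmod (u t) + Re (u t))) ^+ 2 =
   2 * cmod (u t) / (cmod (u t) + Re (u t)).
  by rewrite expr_div_n iy; field; rewrite gt_eqF.
rewrite mul0r add0r.
set r := cmod _ in iy r0 rx *; set x := Re (u t) in iy rx *; set y := Im (u t) in iy *.
transitivity ((Im v * (r * (r + x)) - y * (x * Re v + y * Im v + Re v * r))
  / (r ^+ 2 * (r + x))).
  by field; rewrite !gt_eqF.
(* The relation [y^2 = r^2 - x^2] is unknown to [field]; the numerator is regrouped to expose [y^2],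
   so that it can be substituted by hand. *)
rewrite (_ : y * (x * Re v + y * Im v + Re v * r) =
  y * Re v * (x + r) + y ^+ 2 * Im v); last by ring.
rewrite iy; field.
by rewrite !gt_eqF.
Qed.

Lemma cderiv_tends u t v : cderiv u t v -> tends (nbhs t) u (u t).
Proof.
move=> [u1 u2]; apply/tends_ReIm; split.
  by apply: (@differentiable_continuous _ _ _ t (fun s => Re (u s)));
    apply/derivable1_diffP; case: u1.
by apply: (@differentiable_continuous _ _ _ t (fun s => Im (u s)));
    apply/derivable1_diffP; case: u2.
Qed.

(* The chain rule is built into this notion of complex derivative. *)
Definition hol F (z d : C) : Prop :=
  forall u t v, u t = z -> cderiv u t v -> cderiv (fun s => F (u s)) t (d * v).

Lemma hol_eq F z d d' : hol F z d -> d = d' -> hol F z d'.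
Proof. by move=> h <-. Qed.

Lemma hol_cst (c z : C) : hol (fun=> c) z 0.
Proof. by move=> u t v _ _; rewrite mul0r; exact: cderiv_cst. Qed.

Lemma hol_id (z : C) : hol (fun x => x) z 1.
Proof. by move=> u t v _ h; rewrite mul1r. Qed.

Lemma holD F G z d d' : hol F z d -> hol G z d' ->
  hol (fun x => F x + G x) z (d + d').
Proof. by move=> h h' u t v e hu; rewrite mulrDl; apply: cderivD; [apply: h|apply: h']. Qed.

Lemma holN F z d : hol F z d -> hol (fun x => - F x) z (- d).
Proof. by move=> h u t v e hu; rewrite mulNr; apply: cderivN; apply: h. Qed.

Lemma holB F G z d d' : hol F z d -> hol G z d' ->
  hol (fun x => F x - G x) z (d - d').
Proof. by move=> h h'; apply: holD => //; apply: holN. Qed.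

Lemma holM F G z d d' : hol F z d -> hol G z d' ->
  hol (fun x => F x * G x) z (d * G z + F z * d').
Proof.
move=> h h' u t v e hu; apply: cderiv_eq.
  by apply: cderivM; [apply: (h u t v)|apply: (h' u t v)].
by rewrite /= e; ring.
Qed.

Lemma holV F z d : F z != 0 -> hol F z d ->
  hol (fun x => (F x)^-1) z (- (F z) ^- 2 * d).
Proof.
move=> F0 h u t v e hu; rewrite -mulrA -e; apply: (cderivV (u := fun s => F (u s))).
  by rewrite e.
exact: (h u t v).
Qed.

Lemma hol_comp F G z d d' : hol G z d -> hol F (G z) d' ->
  hol (fun x => F (G x)) z (d' * d).
Proof.
move=> h h' u t v e hu; rewrite -mulrA.
by apply: (h' (fun s => G (u s))); [rewrite e|apply: (h u t v)].
Qed.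

Lemma hol_expC z : hol (@expC R) z (expC z).
Proof. by move=> u t v <- hu; apply: cderiv_expC. Qed.

Lemma hol_LogC z : slit z -> hol (@LogC R) z z^-1.
Proof. by move=> sz u t v e hu; rewrite mulrC -e; apply: cderiv_LogC; rewrite ?e. Qed.

Lemma hol_powC (a : C) z : slit z -> hol (fun x => powC x a) z (a * powC z a / z).
Proof.
move=> sz; apply: hol_eq.
  apply: (hol_comp (F := @expC R)); last exact: hol_expC.
  by apply: holM; [exact: hol_cst|exact: hol_LogC].
by rewrite mul0r add0r /powC; ring.
Qed.

Lemma holX F z d n : hol F z d -> hol (fun x => F x ^+ n.+1) z (n.+1%:R * F z ^+ n * d).
Proof.
move=> h; elim: n => [|n IH].
  by apply: hol_eq; [exact: h|rewrite expr0; ring].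
have -> : (fun x => F x ^+ n.+2) = (fun x => F x * F x ^+ n.+1).
  by apply/funext => x; rewrite exprS.
apply: hol_eq; first exact: (holM h IH).
by rewrite !exprS -!natr1; ring.
Qed.

End ComplexDerivative.

(** * Integrals over the unit interval *)

Section UnitIntervalIntegral.
Variable R : realType.
Local Notation C := R[i].
Local Notation Re := (@complex.Re R).
Local Notation Im := (@complex.Im R).
Local Notation I01 := (`[0%R, 1%R]%classic : set R).
Local Notation rint f := (\int[@lebesgue_measure R]_(t in I01) f t)%R.

Implicit Types (f g : R -> R) (u w : R -> C).

(** Continuity is two-sided even at the endpoints: arcs are [C1] on the whole line, so no subspace
    topology has to be carried along. *)
Definition rcont f := {in I01, continuous f}.

Lemma rcont_integrable f : rcont f ->
  (@lebesgue_measure R).-integrable I01 (EFin \o f).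
Proof.
move=> cf; apply: (@continuous_compact_integrable R f); first exact: segment_compact.
exact: continuous_in_subspaceT.
Qed.

Lemma measurable_I01 : measurable (I01 : set (measurableTypeR R)).
Proof. exact: measurable_itv. Qed.

Lemma rint_FTC f (F : R -> R) : (forall t, t \in I01 -> rderiv F t (f t)) ->
  rcont f -> rint f = F 1 - F 0.
Proof.
move=> dF cf; have cF t : t \in I01 -> {for t, continuous F}.
  by move=> /dF[dt _]; apply: differentiable_continuous; apply/derivable1_diffP.
rewrite /Rintegral (@continuous_FTC2 R f F 0 1) ?ltr01//.
- exact: continuous_in_subspaceT.
- split.
  + by move=> t; rewrite in_itv /= => /andP[h1 h2]; case: (dF t) => //; rewrite inE /= in_itv /= !ltW.
  + by apply: cvg_at_right_filter; apply: cF; rewrite inE /= in_itv /= lexx ler01.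
  + by apply: cvg_at_left_filter; apply: cF; rewrite inE /= in_itv /= lexx ler01.
- move=> t; rewrite in_itv /= => /andP[h1 h2]; rewrite derive1E.
  by case: (dF t) => //; rewrite inE /= in_itv /= !ltW.
Qed.

Lemma rint_dist f g (e : R) : rcont f -> rcont g ->
  (forall t, t \in I01 -> `|f t - g t| <= e) -> `|rint f - rint g| <= e.
Proof.
move=> cf cg h; have mI := measurable_I01.
have cfg : rcont (fun t => f t - g t).
  by move=> t ti; apply: cvgB; [exact: cf|exact: cg].
have ifg := rcont_integrable cfg.
have cn : rcont (fun t => `|f t - g t|).
  by move=> t ti; apply: (@cvg_norm _ R^o); exact: cfg.
rewrite -RintegralB //; try exact: rcont_integrable.
apply: (le_trans (le_normr_Rintegral mI ifg)).
have ->: e = rint (fun=> e).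
  have m1 : (lebesgue_measure `[0%R, 1%R]%classic = 1%R%:E :> \bar R)%E.
    by rewrite lebesgue_measure_itv /= lte_fin ltr01 -EFinB subr0.
  transitivity (e * fine (@lebesgue_measure R I01)); first by rewrite m1 mulr1.
  by rewrite -Rintegral_cst.
apply: le_Rintegral => //.
- exact: (rcont_integrable cn).
- by apply: rcont_integrable => t _; exact: cvg_cst.
- by move=> t ti; apply: h; rewrite inE.
Qed.

Definition ccont u := forall t, t \in I01 -> tends (nbhs t) u (u t).

Lemma ccontRe u : ccont u -> rcont (fun t => Re (u t)).
Proof. by move=> cu t ti; have /tends_ReIm[] := cu t ti. Qed.

Lemma ccontIm u : ccont u -> rcont (fun t => Im (u t)).
Proof. by move=> cu t ti; have /tends_ReIm[] := cu t ti. Qed.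

Definition cint u : C := rint (fun t => Re (u t)) +i* rint (fun t => Im (u t)).

Lemma eq_cint u w : (forall t, t \in I01 -> u t = w t) -> cint u = cint w.
Proof.
by move=> h; congr (_ +i* _); apply: eq_Rintegral => t /h ->.
Qed.

Lemma cintD u w : ccont u -> ccont w -> cint (fun t => u t + w t) = cint u + cint w.
Proof.
move=> cu cw; have mI := measurable_I01; rewrite /cint.
have -> : rint (fun t => Re (u t + w t)) =
  rint (fun t => Re (u t)) + rint (fun t => Re (w t)).
  rewrite -RintegralD //; try exact/rcont_integrable/ccontRe.
  by apply: eq_Rintegral => t _; rewrite Re_add.
have -> : rint (fun t => Im (u t + w t)) =
  rint (fun t => Im (u t)) + rint (fun t => Im (w t)).
  rewrite -RintegralD //; try exact/rcont_integrable/ccontIm.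
  by apply: eq_Rintegral => t _; rewrite Im_add.
by [].
Qed.

Lemma rintZ f (c : R) : rcont f -> rint (fun t => c * f t) = c * rint f.
Proof. by move=> cf; rewrite RintegralZl //; exact: rcont_integrable. Qed.

Lemma rcontZ f (c : R) : rcont f -> rcont (fun t => c * f t).
Proof. by move=> cf t ti; apply: cvgM; [exact: cvg_cst|exact: cf]. Qed.

Lemma cintZ (c : C) u : ccont u -> cint (fun t => c * u t) = c * cint u.
Proof.
move=> cu; have mI := measurable_I01; have cr := ccontRe cu; have ci := ccontIm cu.
apply: eqC.
  rewrite Re_mul /= -!rintZ // -RintegralB //; try exact/rcont_integrable/rcontZ.
  by apply: eq_Rintegral => t _; rewrite Re_mul.
rewrite Im_mul /= -!rintZ // -RintegralD //; try exact/rcont_integrable/rcontZ.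
by apply: eq_Rintegral => t _; rewrite Im_mul.
Qed.

Lemma ccontD u w : ccont u -> ccont w -> ccont (fun t => u t + w t).
Proof. by move=> cu cw t ti; apply: tendsD; [exact: cu|exact: cw]. Qed.

Lemma ccontM u w : ccont u -> ccont w -> ccont (fun t => u t * w t).
Proof. by move=> cu cw t ti; apply: tendsM; [exact: cu|exact: cw]. Qed.

Lemma ccont_cst (c : C) : ccont (fun=> c).
Proof. by move=> t ti; exact: tends_cst. Qed.

Lemma cint_FTC u U : (forall t, t \in I01 -> cderiv U t (u t)) ->
  ccont u -> cint u = U 1 - U 0.
Proof.
move=> dU cu; apply: eqC; rewrite ?(Re_add, Im_add) ?(Re_opp, Im_opp) /=.
  rewrite (@rint_FTC _ (fun t => Re (U t))) //; last exact: ccontRe.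
  by move=> t /dU[].
rewrite (@rint_FTC _ (fun t => Im (U t))) //; last exact: ccontIm.
by move=> t /dU[].
Qed.

(** Real and imaginary parts are estimated separately, hence the doubled bound; it serves only to
    prove convergence. *)
Lemma cint_dist u w (e : R) : ccont u -> ccont w ->
  (forall t, t \in I01 -> cmod (u t - w t) <= e) -> cmod (cint u - cint w) <= e + e.
Proof.
move=> cu cw h; apply: (le_trans (cmod_le_ReIm _)).
rewrite Re_add Im_add Re_opp Im_opp /=; apply: lerD.
  apply: rint_dist => [||t /h]; try exact: ccontRe.
  by apply: le_trans; rewrite -Re_opp -Re_add Re_le_cmod.
apply: rint_dist => [||t /h]; try exact: ccontIm.
by apply: le_trans; rewrite -Im_opp -Im_add Im_le_cmod.
Qed.

(* Joint convergence at every point of [0, 1] is uniform by compactness. *)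
Lemma cint_tends (S : Type) (F : set_system S) {FF : Filter F}
    (Phi : S -> R -> C) (Phi0 : R -> C) :
  (forall t, t \in I01 ->
    tends (filter_prod (within I01 (nbhs t)) F) (fun p => Phi p.2 p.1) (Phi0 t)) ->
  ccont Phi0 -> (\forall s \near F, ccont (Phi s)) ->
  tends F (fun s => cint (Phi s)) (cint Phi0).
Proof.
move=> jc c0 cn; apply/tendsP => e e0.
(* Two errors of [e / 8] bound the integrands' distance by [e / 4], which [cint_dist] doubles to
   [e / 2]. *)
have e8 : 0 < e / 8 by rewrite divr_gt0.
have cov : near_covering_within I01.
  by apply/near_covering_withinP/compact_near_coveringP; exact: segment_compact.
have := cov S F (fun s t => cmod (Phi s t - Phi0 t) <= e / 4) FF.
have hyp : forall x : R, I01 x -> \forall x' \near x & i \near F,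
    I01 x' -> cmod (Phi i x' - Phi0 x') <= e / 4.
  move=> x xI; have xI' : x \in I01 by rewrite inE.
  have /tendsP/(_ _ e8) [[A B] /= [wA FB] AB] := jc x xI'.
  have /tendsP/(_ _ e8) nA := c0 x xI'.
  exists ([set x' | I01 x' -> A x'] `&` [set x' | cmod (Phi0 x - Phi0 x') < e / 8], B).
    by split => //; apply: filterI => //.
  move=> [y s] /= [[yA yn] sB] yI.
  have := AB (y, s) (conj (yA yI) sB) => /= h1.
  have -> : Phi s y - Phi0 y = (Phi0 x - Phi0 y) - (Phi0 x - Phi s y) by ring.
  apply: (le_trans (cmodD _ _)); rewrite cmodN.
  have -> : e / 4 = e / 8 + e / 8 by field.
  by apply: lerD; apply: ltW.
move=> /(_ hyp) h; apply: filterS2 h cn => s hs cs.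
rewrite -cmodN opprB.
apply: (@le_lt_trans _ _ (e / 4 + e / 4)); last by lra.
apply: cint_dist => // t ti; apply: hs; by rewrite inE in ti.
Qed.

Lemma rderivP f (s l : R) :
  (fun h => h^-1 * (f (s + h) - f s)) @ 0^' --> l -> rderiv f s l.
Proof.
move=> h.
have h' : (fun h => h^-1 *: (f (h *: 1 + s) - f s)) @ 0^' --> l.
  by under eq_fun do rewrite [_ *: 1]mulr1 [_ + s]addrC.
apply: DeriveDef; first by apply/cvg_ex; exists l.
exact: cvg_lim h'.
Qed.

Lemma Re_scale (x : R) (z : C) : Re (x%:C * z) = x * Re z.
Proof. by rewrite Re_mul /= mul0r subr0. Qed.

Lemma Im_scale (x : R) (z : C) : Im (x%:C * z) = x * Im z.
Proof. by rewrite Im_mul /= mul0r addr0. Qed.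

Lemma cderivP u (s : R) (l : C) :
  tends 0^' (fun h : R => (h^-1)%:C * (u (s + h) - u s)) l -> cderiv u s l.
Proof.
move=> /tends_ReIm[h1 h2]; split; apply: rderivP.
  by under eq_fun do rewrite -Re_opp -Re_add -Re_scale.
by under eq_fun do rewrite -Im_opp -Im_add -Im_scale.
Qed.

Lemma rderiv_continuous f (s l : R) : rderiv f s l -> {for s, continuous f}.
Proof.
by case=> ds _; apply: differentiable_continuous; apply/derivable1_diffP.
Qed.

(** A difference quotient becomes a value of the derivative at a nearby point, so continuity of the
    derivative controls it. The sign of [h] is split because the mean value theorem wants an ordered
    segment. *)
Lemma MVT_quotient f (df : R -> R) (s d h : R) :
  (forall x, `|x - s| < d -> rderiv f x (df x)) -> h != 0 -> `|h| < d ->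
  exists2 x, `|x - s| <= `|h| & h^-1 * (f (s + h) - f s) = df x.
Proof.
move=> hd h0 hlt.
have cf (a b : R) : `|a - s| < d -> `|b - s| < d -> {within `[a, b], continuous f}.
  move=> ha hb; apply: continuous_in_subspaceT => x; rewrite inE /= in_itv /= => /andP[ax xb].
  apply: (@rderiv_continuous f x (df x)); apply: hd; move: ha hb.
  by rewrite !ltr_norml => /andP[? ?] /andP[? ?]; apply/andP; split; lra.
have [h1|h1] := ltP 0 h.
  have hs : `|s + h - s| < d by rewrite addrAC subrr add0r.
  have ss : `|s - s| < d by rewrite subrr normr0 (le_lt_trans _ hlt).
  have [] := @MVT_segment R f df s (s + h) _ _ (cf _ _ ss hs); first by lra.
    move=> x; rewrite in_itv /= => /andP[x1 x2]; apply: hd.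
    by move: hlt; rewrite !ltr_norml => /andP[? ?]; apply/andP; split; lra.
  move=> x; rewrite in_itv /= => /andP[x1 x2] e; exists x.
    by rewrite (gtr0_norm h1) ger0_norm; lra.
  by rewrite e addrAC subrr add0r mulrC mulfK.
have hs : `|s + h - s| < d by rewrite addrAC subrr add0r.
have ss : `|s - s| < d by rewrite subrr normr0 (le_lt_trans _ hlt).
have hn : h < 0 by rewrite lt_neqAle h0.
have [] := @MVT_segment R f df (s + h) s _ _ (cf _ _ hs ss); first by lra.
  move=> x; rewrite in_itv /= => /andP[x1 x2]; apply: hd.
  by move: hlt; rewrite !ltr_norml => /andP[? ?]; apply/andP; split; lra.
move=> x; rewrite in_itv /= => /andP[x1 x2] e; exists x.
  by rewrite (ltr0_norm hn) ler0_norm; lra.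
rewrite -opprB e opprD addrA subrr add0r; field.
by [].
Qed.

(** Differentiation under the integral sign: the difference quotients converge jointly in the
    parameter [h] and the variable [t], which is what [cint_tends] asks for. *)
Lemma cderiv_cint (Phi Psi : R -> R -> C) (s d : R) : 0 < d ->
  (forall x t, `|x - s| < d -> t \in I01 -> cderiv (fun x => Phi x t) x (Psi x t)) ->
  (forall t, t \in I01 ->
    tends (filter_prod (within I01 (nbhs t)) (nbhs s)) (fun p => Psi p.2 p.1) (Psi s t)) ->
  (forall x, `|x - s| < d -> ccont (Phi x)) -> ccont (Psi s) ->
  cderiv (fun x => cint (Phi x)) s (cint (Psi s)).
Proof.
move=> d0 dP jc cP cs; apply: cderivP.
have ss : `|s - s| < d by rewrite subrr normr0.
have near0 : \forall h \near (0 : R)^', h != 0 /\ `|h| < d.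
  by near=> h; split; near: h; [exact: nbhs_dnbhs_neq|exact: dnbhs0_lt].
have cq h : `|h| < d -> ccont (fun t => Phi (s + h) t - Phi s t).
  move=> hd; under [X in ccont X]eq_fun do rewrite -[- _]mulN1r.
  apply: ccontD; first by apply: cP; rewrite addrAC subrr add0r.
  by apply: ccontM; [exact: ccont_cst|exact: cP].
apply: (@tends_eq _ _ _ _ (fun h => cint (fun t => (h^-1)%:C * (Phi (s + h) t - Phi s t)))).
  apply: filterS near0 => h [h0 hd]; rewrite cintZ; last exact: cq.
  congr (_ * _).
  under [X in cint X]eq_fun do rewrite -[- _]mulN1r.
  rewrite cintD.
  - by rewrite (cintZ (-1) (cP s ss)) mulN1r.
  - by apply: cP; rewrite addrAC subrr add0r.
  - by apply: ccontM; [exact: ccont_cst|exact: cP].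
apply: cint_tends => //; last first.
  by apply: filterS near0 => h [h0 hd]; apply: ccontM; [exact: ccont_cst|exact: cq].
move=> t tI; apply/tendsP => e e0.
have e2 : 0 < e / 2 by rewrite divr_gt0.
have /tendsP/(_ _ e2) [[A B] /= [wA /nbhs_ballP[r /= r0 rB]] AB] := jc t tI.
exists (A `&` I01, [set h | h != 0 /\ `|h| < Num.min d r]).
  split => /=.
    apply: filterI => //; rewrite /within /=; exact: filterE.
  near=> h; split; near: h; first exact: nbhs_dnbhs_neq.
  by apply: dnbhs0_lt; rewrite lt_min d0.
move=> [y h] /= [[yA yI] [h0]]; rewrite lt_min => /andP[hd hr].
have yI' : y \in I01 by rewrite inE.
have close x : `|x - s| <= `|h| -> cmod (Psi s t - Psi x y) < e / 2.
  move=> xs; apply: (AB (y, x)); split => //=; apply: rB.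
  by rewrite /ball /= distrC (le_lt_trans xs).
(* The mean value theorem fails for complex values, so each component has its own intermediate
   point; both are close enough to [s] for [close]. *)
have [x1 xs1 q1] := @MVT_quotient (fun x => Re (Phi x y)) (fun x => Re (Psi x y)) s d h
  (fun x hx => (dP x y hx yI').1) h0 hd.
have [x2 xs2 q2] := @MVT_quotient (fun x => Im (Phi x y)) (fun x => Im (Psi x y)) s d h
  (fun x hx => (dP x y hx yI').2) h0 hd.
rewrite [e]splitr; apply: (le_lt_trans (cmod_le_ReIm _)); apply: ltrD.
  rewrite Re_add Re_opp Re_scale Re_add Re_opp q1 -Re_opp -Re_add.
  exact: le_lt_trans (Re_le_cmod _) (close _ xs1).
rewrite Im_add Im_opp Im_scale Im_add Im_opp q2 -Im_opp -Im_add.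
exact: le_lt_trans (Im_le_cmod _) (close _ xs2).
Unshelve. all: by end_near. Qed.

(** Differentiability is asked only inside the interval and continuity only within it: for [s]
    outside [[0, 1]] the deformed contours of [cauchy_slit] may leave the slit plane. *)
Lemma cderiv0_cst u :
  (forall s, s \in `]0, 1[ -> cderiv u s 0) ->
  (forall s, s \in I01 -> tends (within I01 (nbhs s)) u (u s)) -> u 1 = u 0.
Proof.
move=> du cu.
have main (p : C -> R) : (forall s, s \in `]0, 1[ -> rderiv (fun t => p (u t)) s 0) ->
    (forall s, s \in I01 -> p (u t) @[t --> within I01 (nbhs s)] --> p (u s)) -> p (u 1) = p (u 0).
  move=> dp cp; have [] := @MVT_segment R (fun t => p (u t)) (fun=> 0) 0 1 ler01.
  - by move=> x /dp.
  - by apply/subspace_continuousP => x xI; apply: cp; rewrite inE.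
  by move=> x _; rewrite mul0r => /eqP; rewrite subr_eq0 => /eqP.
apply: eqC; apply: main.
- by move=> s /du[].
- by move=> s /cu /tends_ReIm[].
- by move=> s /du[].
- by move=> s /cu /tends_ReIm[].
Qed.

End UnitIntervalIntegral.

(** * Contour integrals *)

Section ContourIntegrals.
Variable R : realType.
Local Notation C := R[i].
Local Notation I01 := (`[0%R, 1%R]%classic : set R).
Implicit Types (G : seq (R -> C)) (g : R -> C) (f F : C -> C) (z x p : C).

Lemma tends_id (z : C) : tends (nbhs (z : C^o)) (fun x => x) z.
Proof. exact: cvg_id. Qed.

Lemma C1_derivable (h : R -> R) t : C1 h -> rderiv h t (derive1 h t).
Proof. by move=> [hd _]; rewrite derive1E; apply: DeriveDef. Qed.

Lemma cderiv_velocity g t : C1_arc g -> cderiv g t (velocity g t).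
Proof. by move=> [h1 h2]; split; exact: C1_derivable. Qed.

Lemma tends_velocity g t : C1_arc g -> tends (nbhs t) (velocity g) (velocity g t).
Proof. by move=> [[_ h1] [_ h2]]; apply/tends_ReIm; split; [exact: h1|exact: h2]. Qed.

Lemma tends_arc g t : C1_arc g -> tends (nbhs t) g (g t).
Proof. by move=> hg; apply: cderiv_tends (cderiv_velocity _ hg). Qed.

Lemma arc_integralE f g : arc_integral f g = cint (fun t => f (g t) * velocity g t).
Proof. by []. Qed.

Definition trace_cont G f : Prop :=
  forall z, trace G z -> tends (nbhs (z : C^o)) f (f z).

Lemma in_trace G g t : g \in G -> t \in I01 -> trace G (g t).
Proof. by move=> gG; rewrite inE => tI; exists g => //; exists t. Qed.

Section OneContour.
Variable G : seq (R -> C).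
Hypothesis cG : closed_contour G.

Lemma ccont_arc f g : trace_cont G f -> g \in G ->
  ccont (fun t => f (g t) * velocity g t).
Proof.
move=> cf gG t tI; have hg := cG.1 g gG; apply: tendsM; last exact: tends_velocity.
apply: (@tends_comp _ C^o _ _ _ f (g t) g); last exact: tends_arc.
exact/cf/in_trace.
Qed.

Lemma eq_oint f f' : (forall z, trace G z -> f z = f' z) -> oint G f = oint G f'.
Proof.
move=> h; rewrite /oint; congr (_ * _); apply: eq_big_seq => g gG.
rewrite !arc_integralE; apply: eq_cint => t tI.
by rewrite h //; exact: in_trace.
Qed.

Lemma ointD f f' : trace_cont G f -> trace_cont G f' ->
  oint G (fun z => f z + f' z) = oint G f + oint G f'.
Proof.
move=> cf cf'; rewrite /oint -mulrDr -big_split /=; congr (_ * _).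
apply: eq_big_seq => g gG; rewrite !arc_integralE -cintD; try exact: ccont_arc.
by apply: eq_cint => t _; rewrite mulrDl.
Qed.

Lemma ointZ (c : C) f : trace_cont G f -> oint G (fun z => c * f z) = c * oint G f.
Proof.
move=> cf; rewrite /oint mulrCA; congr (_ * _); rewrite big_distrr /=.
apply: eq_big_seq => g gG; rewrite !arc_integralE -cintZ; last exact: ccont_arc.
by apply: eq_cint => t _; rewrite mulrA.
Qed.

Lemma oint0 : oint G (fun=> 0) = 0.
Proof.
have h : trace_cont G (fun=> 0) by move=> z _; exact: tends_cst.
transitivity (0 * oint G (fun=> 0)); last by rewrite mul0r.
by rewrite -(ointZ _ h); congr (oint _ _); apply/funext => z; rewrite mul0r.
Qed.

Lemma trace_cont_sum (I : Type) (r : seq I) (F : I -> C -> C) :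
  (forall i, trace_cont G (F i)) -> trace_cont G (fun z => \sum_(i <- r) F i z).
Proof. by move=> h z tz; apply: tends_sum => i _; exact: h. Qed.

Lemma oint_sum (I : Type) (r : seq I) (F : I -> C -> C) :
  (forall i, trace_cont G (F i)) ->
  oint G (fun z => \sum_(i <- r) F i z) = \sum_(i <- r) oint G (F i).
Proof.
move=> h; elim: r => [|i r IH].
  by rewrite big_nil -[RHS]oint0; apply: eq_oint => z _; rewrite big_nil.
rewrite big_cons -IH -ointD //; last exact: trace_cont_sum.
by apply: eq_oint => z _; rewrite big_cons.
Qed.

Lemma path_telescope F g (s : seq (R -> C)) : path (fun g h => g 1 == h 0) g s ->
  \sum_(h <- s) F (h 0) = \sum_(h <- belast g s) F (h 1).
Proof.
elim: s g => [|h s IH] g /=; first by rewrite !big_nil.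
by move=> /andP[/eqP e hs]; rewrite !big_cons (IH _ hs) e.
Qed.

(** Each arc starts where its cyclic predecessor ends, so the values of [F] at end points are a
    rotation of those at starting points. *)
Lemma cycle_telescope F : \sum_(g <- G) (F (g 1) - F (g 0)) = 0.
Proof.
rewrite big_split /= sumrN; case: G cG.2 => [|g s] /=; first by rewrite !big_nil subrr.
move=> /(path_telescope F); rewrite belast_rcons -cats1 big_cat /= big_seq1 => <-.
by rewrite big_cons [X in X - _]addrC subrr.
Qed.

Lemma sum_primitive f F : (forall z, trace G z -> hol F z (f z)) -> trace_cont G f ->
  \sum_(g <- G) arc_integral f g = 0.
Proof.
move=> hF cf; rewrite -[RHS](cycle_telescope F); apply: eq_big_seq => g gG.
rewrite arc_integralE (@cint_FTC _ _ (fun t => F (g t))) //; last exact: ccont_arc.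
move=> t tI; apply: (hF (g t) (in_trace gG tI)); first by [].
exact/cderiv_velocity/(cG.1 g gG).
Qed.

Lemma oint_primitive f F : (forall z, trace G z -> hol F z (f z)) -> trace_cont G f ->
  oint G f = 0.
Proof. by move=> hF cf; rewrite /oint (sum_primitive hF cf) mulr0. Qed.

Lemma trace_neq x z : ~ trace G x -> trace G z -> z - x != 0.
Proof. by move=> hx hz; rewrite subr_eq0; apply/eqP => e; apply: hx; rewrite -e. Qed.

Lemma oint_expn n : oint G (fun w => w ^+ n) = 0.
Proof.
apply: (@oint_primitive _ (fun w => n.+1%:R^-1 * w ^+ n.+1)).
  move=> z _; apply: hol_eq.
    by apply: holM; [exact: hol_cst|apply: holX; exact: hol_id].
  by rewrite mul0r add0r mulr1 mulrA mulVf ?mul1r // pnatr_eq0.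
by move=> z _; apply: tendsX; exact: tends_id.
Qed.

Lemma trace_cont_inv x : ~ trace G x -> trace_cont G (fun w => (w - x)^-1).
Proof.
move=> hx z hz; apply: tendsV; first exact: trace_neq hx hz.
by apply: tendsB; [exact: tends_id|exact: tends_cst].
Qed.

(** The primitive [- w^-(n+1) / (n+1)] exists from exponent 2 on; exponent 1 is the winding number
    around [0]. *)
Lemma oint_invn n : ~ trace G 0 -> oint G (fun w => w ^- n.+2) = 0.
Proof.
move=> h0; have nz z : trace G z -> z != 0 by move=> /(trace_neq h0); rewrite subr0.
apply: (@oint_primitive _ (fun w => - n.+1%:R^-1 * (w ^+ n.+1)^-1)).
  move=> z /nz z0; apply: hol_eq.
    apply: holM; first exact: hol_cst.
    by apply: holV; [rewrite expf_neq0|apply: holX; exact: hol_id].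
  have n0 : (n.+1%:R : C) != 0 by rewrite pnatr_eq0.
  rewrite mul0r add0r mulr1 !exprS; move: (_ %:R) n0 => c c0; field.
  by rewrite c0 z0 expf_neq0.
by move=> z /nz z0; apply: tendsV; [rewrite expf_neq0|apply: tendsX; exact: tends_id].
Qed.

(** The difference of the two kernels has the primitive [LogC ((z - p) / (z - x))]: the quotient is
    [1 + (x - p) / (z - x)], and it stays in the open unit disc around 1, off the cut, once [p] is
    nearer to [x] than the whole trace is. *)
Lemma winding_near x : ~ trace G x ->
  \forall p \near (x : C^o), ~ trace G p /\ winding_number G p = winding_number G x.
Proof.
move=> hx.
have cov : near_covering I01 by apply/compact_near_coveringP; exact: segment_compact.
have far : \forall p \near (x : C^o), forall z, trace G z -> cmod (x - p) < cmod (z - x).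
  have one g : g \in G ->
      \forall p \near (x : C^o), forall t, I01 t -> cmod (x - p) < cmod (g t - x).
    move=> gG; apply: (cov C^o (nbhs (x : C^o)) (fun p t => cmod (x - p) < cmod (g t - x))).
    move=> t tI; have tI' : t \in I01 by rewrite inE.
    have e0 : 0 < cmod (g t - x) / 2.
      by rewrite divr_gt0 // cmod_gt0 (trace_neq hx) //; exact: in_trace.
    have /tendsP/(_ _ e0) n1 := @tends_arc g t (cG.1 g gG).
    have /tendsP/(_ _ e0) n2 := @tends_id x.
    exists ([set t' | cmod (g t - g t') < cmod (g t - x) / 2],
            [set p | cmod (x - p) < cmod (g t - x) / 2]) => //=.
    move=> [t' p] /= [h1 h2]; apply: (lt_le_trans h2).
    have := cmodD (g t - g t') (g t' - x); rewrite addrA subrK => h3.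
    by lra.
  (* Compactness of [[0, 1]] treats one arc; the induction intersects the finitely many
     neighbourhoods. *)
  have all (s : seq (R -> C)) : {subset s <= G} -> \forall p \near (x : C^o),
      forall g t, g \in s -> I01 t -> cmod (x - p) < cmod (g t - x).
    elim: s => [|g s IH] sG; first by apply: filterE => p g t; rewrite in_nil.
    have gG : g \in G by apply: sG; rewrite mem_head.
    have sG' : {subset s <= G} by move=> h hs; apply: sG; rewrite in_cons hs orbT.
    apply: filterS2 (one g gG) (IH sG') => p h1 h2 h t.
    by rewrite in_cons => /orP[/eqP ->|hs] tI; [exact: h1|exact: h2].
  by apply: filterS (all G (fun g h => h)) => p hp z [g gG [t tI <-]]; exact: hp.
apply: filterS far => p hp.
have tp : ~ trace G p.
  by move=> /hp; rewrite -cmodN opprB ltxx.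
split=> //; apply/eqP; rewrite -subr_eq0; apply/eqP.
rewrite /winding_number -[X in _ - X]mul1r -mulNr -ointZ; last exact: trace_cont_inv.
have cI : trace_cont G (fun z => -1 * (z - x)^-1).
  by move=> z tz; apply: tendsM; [exact: tends_cst|exact: trace_cont_inv].
rewrite -(ointD (@trace_cont_inv p tp) cI).
apply: (@oint_primitive _ (fun z => LogC ((z - p) / (z - x)))).
  move=> z tz; have z1 := trace_neq hx tz; have z2 := trace_neq tp tz.
  have sl : slit ((z - p) / (z - x)).
    have -> : (z - p) / (z - x) = 1 + (x - p) / (z - x).
      by field; rewrite z1.
    move=> [h _]; have q : cmod ((x - p) / (z - x)) < 1.
      by rewrite cmodM cmodV ltr_pdivrMr ?mul1r ?hp // cmod_gt0.
    have := Re_le_cmod ((x - p) / (z - x)); rewrite ler_norml => /andP[q1 q2].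
    by move: h; rewrite Re_add /=; lra.
  apply: hol_eq.
    apply: hol_comp; last exact: hol_LogC.
    apply: holM; first by apply: holB; [exact: hol_id|exact: hol_cst].
    by apply: holV => //; apply: holB; [exact: hol_id|exact: hol_cst].
  rewrite !subr0; field.
  by rewrite z1 z2.
by move=> z tz; apply: tendsD; [exact: trace_cont_inv|exact: cI].
Qed.

End OneContour.

End ContourIntegrals.

(** * Residues: the [w]-integral of a polynomial, and Cauchy's formula in the slit plane *)

Section Residues.
Variable R : realType.
Local Notation C := R[i].
Local Notation Re := (@complex.Re R).
Local Notation I01 := (`[0%R, 1%R]%classic : set R).
Implicit Types (g : R -> C) (f F : C -> C) (z x : C).

Section InnerIntegral.
Variables (W : seq (R -> C)) (z : C).
Hypotheses (cW : closed_contour W) (W0 : encloses W 0) (Wz : encloses W z).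
Hypothesis z0 : z != 0.

Lemma W_neq0 w : trace W w -> w != 0.
Proof. by move=> /(trace_neq W0.1); rewrite subr0. Qed.

Lemma W_neqz w : trace W w -> z - w != 0.
Proof. by move=> /(trace_neq Wz.1); rewrite subr_eq0 eq_sym -subr_eq0. Qed.

Lemma trace_cont_divz f : trace_cont W f -> trace_cont W (fun w => f w / (z - w)).
Proof.
move=> cf w tw; apply: tendsM; first exact: cf.
apply: tendsV; first exact: W_neqz.
by apply: tendsB; [exact: tends_cst|exact: tends_id].
Qed.

Lemma trace_contX n : trace_cont W (fun w => w ^+ n).
Proof. by move=> w _; apply: tendsX; exact: tends_id. Qed.

Lemma trace_contXV n : trace_cont W (fun w => w ^- n).
Proof.
move=> w tw; apply: tendsV; first by rewrite expf_neq0 ?W_neq0.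
by apply: tendsX; exact: tends_id.
Qed.

(* [w f(w) / (z - w) = z f(w) / (z - w) - f(w)] *)
Lemma oint_div_step f f' : trace_cont W f ->
  (forall w, trace W w -> f' w = w * f w) ->
  oint W (fun w => f' w / (z - w)) = z * oint W (fun w => f w / (z - w)) - oint W f.
Proof.
move=> cf h; have cfz := trace_cont_divz cf.
rewrite -[X in _ - X]mul1r -mulNr -(ointZ cW z cfz) -(ointZ cW (-1) cf).
rewrite -(ointD cW); first 1 last.
- by move=> w tw; apply: tendsM; [exact: tends_cst|exact: cfz].
- by move=> w tw; apply: tendsM; [exact: tends_cst|exact: cf].
apply: eq_oint => w tw; rewrite (h _ tw); field.
exact: W_neqz.
Qed.

Lemma oint_expn_div n : oint W (fun w => w ^+ n / (z - w)) = - z ^+ n.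
Proof.
elim: n => [|n IH].
  rewrite expr0 -Wz.2 /winding_number -[RHS]mulN1r -ointZ //; last exact: trace_cont_inv Wz.1.
  apply: eq_oint => w tw; rewrite expr0; have h := W_neqz tw.
  have h' : w - z != 0 by rewrite -oppr_eq0 opprB.
  by rewrite -[w - z]opprB invrN mulrNN.
rewrite (@oint_div_step (fun w => w ^+ n)); first 1 last.
- exact: trace_contX.
- by move=> w _; rewrite exprS.
by rewrite IH oint_expn // subr0 exprS mulrN.
Qed.

(** The residues at [0] and at [z] cancel: for exponent 1, [oint_div_step] gives [z] times the
    integral as [-1 + 1], the two winding numbers with their signs. Higher exponents follow by the
    same recurrence, divided by [z]. *)
Lemma oint_invn_div n : oint W (fun w => w ^- n.+1 / (z - w)) = 0.
Proof.
elim: n => [|n IH]; apply: (mulfI z0); rewrite mulr0.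
  have := @oint_div_step (fun w => w ^- 1) (fun w => w ^+ 0) (@trace_contXV 1).
  have -> : oint W (fun w => w ^- 1) = 1.
    by rewrite -[RHS]W0.2; apply: eq_oint => w _; rewrite subr0 expr1.
  rewrite oint_expn_div expr0 => h; apply/eqP.
  rewrite -(subr_eq0 _ 0) subr0 -[X in X == _](subrK 1) -h ?addNr // => w tw.
  by rewrite expr0 expr1 divff // W_neq0.
have := @oint_div_step (fun w => w ^- n.+2) (fun w => w ^- n.+1) (@trace_contXV n.+2).
rewrite IH oint_invn //; last exact: W0.1.
rewrite subr0 => <- // w tw; rewrite [in RHS]exprS invfM mulrA divff ?mul1r //.
exact: W_neq0.
Qed.

Lemma oint_monomial_div m b :
  oint W (fun w => w ^+ m * w ^- b.+1 / (z - w)) =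
  - (if (b < m)%N then z ^+ (m - b.+1) else 0).
Proof.
case: ltnP => bm.
  rewrite -oint_expn_div; apply: eq_oint => w /W_neq0 w0.
  by rewrite -{1}(subnK bm) exprD mulfK // expf_neq0.
rewrite oppr0 -(oint_invn_div (b - m)); apply: eq_oint => w /W_neq0 w0.
rewrite -[b in LHS](subnK bm) -addSn exprD invfM mulrCA mulfV ?mulr1 //.
by rewrite expf_neq0.
Qed.

(** Only monomials of degree above [b] contribute, so the polynomial part of [P / X^(b+1)] appears.
    The constant [K] is there to carry the factors of the integrand that depend on [z] alone. *)
Lemma oint_horner_div (P : {poly C}) N b (K : C) : (size P <= N.+1)%N -> (b < N)%N ->
  oint W (fun w => K * (P.[w] * w ^- b.+1 / (z - w))) =
  - (K * \sum_(m < N - b) P`_(m + b.+1) * z ^+ m).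
Proof.
move=> sP bN.
pose Q m w := P`_m * (w ^+ m * w ^- b.+1 / (z - w)).
have cq m : trace_cont W (fun w => w ^+ m * w ^- b.+1 / (z - w)).
  apply: trace_cont_divz => w tw; apply: tendsM; first exact: trace_contX.
  exact: trace_contXV.
have cQ m : trace_cont W (Q m).
  by move=> w tw; apply: tendsM; [exact: tends_cst|exact: cq].
transitivity (oint W (fun w => K * \sum_(m < N.+1) Q m w)).
  apply: eq_oint => w tw; rewrite (horner_coef_wide _ sP) -mulrA big_distrl /=.
  by congr (_ * _); apply: eq_bigr => m _; rewrite /Q -!mulrA.
rewrite ointZ; first last.
- exact: (@trace_cont_sum R W _ _ (fun m : 'I_N.+1 => Q m)).
- exact: cW.
rewrite (@oint_sum R W cW _ _ (fun m : 'I_N.+1 => Q m)) // -mulrN; congr (_ * _).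
transitivity (- \sum_(m < N.+1) P`_m * (if (b < m)%N then z ^+ (m - b.+1) else 0)).
  rewrite -sumrN; apply: eq_bigr => m _.
  by rewrite ointZ // oint_monomial_div mulrN.
congr (- _).
rewrite -(big_mkord xpredT (fun m => P`_m * (if (b < m)%N then z ^+ (m - b.+1) else 0))).
(* The terms of index at most [b] vanish; the others are shifted by [b.+1]. *)
rewrite (@big_cat_nat _ _ _ b.+1) //=; last by rewrite ltnS ltnW.
rewrite big1_seq ?add0r; last first.
  move=> m; rewrite mem_index_iota => /andP[_ /andP[_]]; rewrite ltnS => mb.
  by rewrite ltnNge mb mulr0.
rewrite -{1}[b.+1]add0n big_addn subSS big_mkord; apply: eq_bigr => m _.
by rewrite addnK ltn_addl.
Qed.

End InnerIntegral.

Section CauchySlit.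
Variables (Z : seq (R -> C)) (x : R) (f f' : C -> C).
Hypotheses (cZ : closed_contour Z) (Z_slit : forall z, trace Z z -> slit z).
Hypotheses (x0 : 0 < x) (Zx : encloses Z x%:C).
Hypothesis f_hol : forall z, slit z -> hol f z (f' z).
Hypothesis f_cont : forall z, slit z -> tends (nbhs (z : C^o)) f (f z).
Hypothesis f'_cont : forall z, slit z -> tends (nbhs (z : C^o)) f' (f' z).

Definition seg (s : R) (z : C) : C := x%:C + s%:C * (z - x%:C).

(** The slit plane is star-shaped about the positive real [x]: the imaginary part [s * Im z]
    vanishes only at [s = 0], where the point is [x], or for [z] a positive real, where the whole
    segment is positive. *)
Lemma slit_seg s z : s \in I01 -> slit z -> slit (seg s z).
Proof.
rewrite inE /= in_itv /= => /andP[s0 s1] hz [].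
rewrite /seg Re_add Im_add Re_scale Im_scale Re_add Im_add Re_opp Im_opp /= => hr.
rewrite add0r oppr0 addr0 => /eqP; rewrite mulf_eq0 => /orP[/eqP s00|/eqP iz].
  by move: hr; rewrite s00 mul0r addr0 leNgt x0.
have rz : 0 < Re z by rewrite ltNge; apply/negP => h; apply: hz.
have [e|sn] := eqVneq s 0; first by move: hr; rewrite e mul0r addr0 leNgt x0.
have sp : 0 < s by rewrite lt0r sn.
have h1 : 0 < s * Re z by exact: mulr_gt0.
have h2 : 0 <= (1 - s) * x by rewrite mulr_ge0 ?subr_ge0 // ltW.
by move: hr; lra.
Qed.

Lemma seg0 z : seg 0 z = x%:C. Proof. by rewrite /seg mul0r addr0. Qed.

Lemma seg1 z : seg 1 z = z. Proof. by rewrite /seg mul1r addrC subrK. Qed.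

Lemma hol_seg s z : hol (seg s) z s%:C.
Proof.
apply: hol_eq.
  apply: holD; first exact: hol_cst.
  apply: holM; first exact: hol_cst.
  by apply: holB; [exact: hol_id|exact: hol_cst].
by ring.
Qed.

Lemma cderiv_seg s z : cderiv (fun s => seg s z) s (z - x%:C).
Proof.
apply: cderiv_eq.
  apply: cderivD; first exact: cderiv_cst.
  by apply: cderivM; [exact: cderiv_real|exact: cderiv_cst].
by rewrite /=; ring.
Qed.

Lemma tends_seg (F : set_system R) {FF : Filter F} g s t : F --> s -> C1_arc g ->
  tends (filter_prod (within I01 (nbhs t)) F) (fun p : R * R => seg p.2 (g p.1)) (seg s (g t)).
Proof.
move=> Fs hg; apply: tendsD; first exact: tends_cst.
apply: tendsM.
  by apply: tends_real; apply: cvg_trans Fs; exact: cvg_snd.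
apply: tendsB; last exact: tends_cst.
apply: (@tends_comp _ _ _ _ _ g t fst); first exact: tends_arc.
by apply: cvg_trans (cvg_within _); exact: cvg_fst.
Qed.

Lemma tends_seg_comp (h : C -> C) (F : set_system R) {FF : Filter F} g s t :
  (forall z, slit z -> tends (nbhs (z : C^o)) h (h z)) ->
  F --> s -> g \in Z -> s \in I01 -> t \in I01 ->
  tends (filter_prod (within I01 (nbhs t)) F) (fun p : R * R => h (seg p.2 (g p.1))) (h (seg s (g t))).
Proof.
move=> ch Fs gZ sI tI.
apply: (@tends_comp _ C^o _ _ _ h (seg s (g t)) (fun p : R * R => seg p.2 (g p.1))).
  by apply: ch; apply: slit_seg => //; apply: Z_slit; exact: in_trace.
exact: tends_seg (cZ.1 _ gZ).
Qed.

Lemma tends_fst_within (h : R -> C) (F : set_system R) {FF : Filter F} t :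
  tends (nbhs t) h (h t) ->
  tends (filter_prod (within I01 (nbhs t)) F) (fun p : R * R => h p.1) (h t).
Proof.
move=> ht; apply: (@tends_comp _ _ _ _ _ h t fst) => //.
by apply: cvg_trans (cvg_within _); exact: cvg_fst.
Qed.

Lemma ccont_seg (h : C -> C) g s :
  (forall z, slit z -> tends (nbhs (z : C^o)) h (h z)) ->
  g \in Z -> s \in I01 -> ccont (fun t => h (seg s (g t))).
Proof.
move=> ch gZ sI t tI.
apply: (@tends_comp _ C^o _ _ _ h (seg s (g t)) (fun t => seg s (g t))).
  by apply: ch; apply: slit_seg => //; apply: Z_slit; exact: in_trace.
apply: tendsD; first exact: tends_cst.
apply: tendsM; first exact: tends_cst.
by apply: tendsB; [exact: tends_arc (cZ.1 _ gZ)|exact: tends_cst].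
Qed.

Lemma tends_pole g t : g \in Z -> t \in I01 ->
  tends (nbhs t) (fun t => (g t - x%:C)^-1) (g t - x%:C)^-1.
Proof.
move=> gZ tI; apply: tendsV; first by apply: trace_neq Zx.1 _; exact: in_trace.
by apply: tendsB; [exact: tends_arc (cZ.1 _ gZ)|exact: tends_cst].
Qed.

(** Only the argument of [f] is contracted; the Cauchy kernel stays on the original contour.
    Differentiation in [s] brings out a factor [g t - x] that cancels the pole and leaves [Psi]. *)
Let Phi g (s t : R) := f (seg s (g t)) * (g t - x%:C)^-1 * velocity g t.
Let Psi g (s t : R) := f' (seg s (g t)) * velocity g t.

Let ccont_Phi g s : g \in Z -> s \in I01 -> ccont (Phi g s).
Proof.
move=> gZ sI; apply: ccontM; last by move=> t _; exact: tends_velocity (cZ.1 _ gZ).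
by apply: ccontM; [exact: ccont_seg|move=> t tI; exact: tends_pole].
Qed.

Let cderiv_Phi g s : g \in Z -> s \in `]0, 1[ ->
  cderiv (fun s => cint (Phi g s)) s (cint (Psi g s)).
Proof.
move=> gZ; rewrite in_itv /= => /andP[s0 s1].
have hg := cZ.1 _ gZ.
have near1 y : `|y - s| < Num.min s (1 - s) -> y \in I01.
  rewrite lt_min !ltr_norml => /andP[/andP[h1 h2] /andP[h3 h4]].
  by rewrite inE /= in_itv /=; apply/andP; split; lra.
have sI : s \in I01 by rewrite inE /= in_itv /= !ltW.
apply: (@cderiv_cint _ (Phi g) (Psi g) s (Num.min s (1 - s))).
- by rewrite lt_min s0 subr_gt0.
- move=> y t /near1 yI tI.
  have nz : g t - x%:C != 0 by apply: trace_neq Zx.1 _; exact: in_trace.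
  apply: cderiv_eq.
    apply: cderivM; last exact: cderiv_cst.
    apply: cderivM; last exact: cderiv_cst.
    apply: (f_hol (z := seg y (g t))); last exact: cderiv_seg.
      by apply: slit_seg => //; apply: Z_slit; exact: in_trace.
    by [].
  by rewrite /Psi /=; field.
- move=> t tI; apply: tendsM; first by apply: (@tends_seg_comp f' (nbhs s) _) => //; exact: cvg_id.
  by apply: (tends_fst_within (h := velocity g)); exact: tends_velocity.
- by move=> y /near1 yI; exact: ccont_Phi.
- apply: ccontM; first exact: ccont_seg.
  by move=> t _; exact: tends_velocity.
Qed.

Let tends_Phi g s : g \in Z -> s \in I01 ->
  tends (within I01 (nbhs s)) (fun s => cint (Phi g s)) (cint (Phi g s)).
Proof.
move=> gZ sI; apply: cint_tends.
- move=> t tI; apply: tendsM; last first.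
    by apply: (tends_fst_within (h := velocity g)); exact: tends_velocity (cZ.1 _ gZ).
  apply: tendsM; last by apply: (tends_fst_within (h := fun t => (g t - x%:C)^-1)); exact: tends_pole.
  by apply: (@tends_seg_comp f (within I01 (nbhs s)) _) => //; exact: cvg_within.
- exact: ccont_Phi.
- have : \forall y \near within I01 (nbhs s), I01 y by exact: near_withinT.
  by apply: filterS => y yI; apply: ccont_Phi => //; rewrite inE.
Qed.

Lemma cderiv_sum (r : seq (R -> C)) (u d : (R -> C) -> R -> C) s :
  (forall g, g \in r -> cderiv (u g) s (d g s)) ->
  cderiv (fun s => \sum_(g <- r) u g s) s (\sum_(g <- r) d g s).
Proof.
elim: r => [|g r IH] h.
  under [X in cderiv X]eq_fun do rewrite big_nil.
  by rewrite big_nil; exact: cderiv_cst.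
under [X in cderiv X]eq_fun do rewrite big_cons.
rewrite big_cons; apply: cderivD; first by apply: h; rewrite mem_head.
by apply: IH => k kr; apply: h; rewrite in_cons kr orbT.
Qed.

(* Contracting the contour towards [x] along segments, which stay in the slit
   plane, leaves the integral unchanged. *)
Lemma cauchy_slit : oint Z (fun z => f z / (z - x%:C)) = f x%:C.
Proof.
pose tot s := \sum_(g <- Z) cint (Phi g s).
have e : tot 1 = tot 0.
  apply: cderiv0_cst => s sI.
    apply: (@cderiv_eq _ _ _ (\sum_(g <- Z) cint (Psi g s))).
      by apply: (@cderiv_sum Z (fun g s => cint (Phi g s)) (fun g s => cint (Psi g s))) => g gZ;
        exact: cderiv_Phi.
    have sI' : s \in I01.
      by move: (sI); rewrite in_itv /= => /andP[? ?]; rewrite inE /= in_itv /= !ltW.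
    have sn : s%:C != 0.
      have s0 : 0 < s by move: (sI); rewrite in_itv /= => /andP[].
      by rewrite gt_eqF ?ltcR.
    (* For [s] nonzero, [f'] composed with [seg s] has the primitive [s^-1 f (seg s z)], so the
       derivative of [tot] integrates to 0 around the closed contour. *)
    apply: (@sum_primitive _ _ cZ (fun z => f' (seg s z)) (fun z => (s%:C)^-1 * f (seg s z))).
      move=> z tz; apply: hol_eq.
        apply: holM; first exact: hol_cst.
        apply: hol_comp; first exact: hol_seg.
        by apply: f_hol; apply: slit_seg => //; exact: Z_slit.
      by rewrite mul0r add0r [_ * s%:C]mulrC mulKf.
    move=> z tz; apply: (@tends_comp _ C^o _ _ _ f' (seg s z) (seg s)).
      by apply: f'_cont; apply: slit_seg => //; exact: Z_slit.
    apply: tendsD; first exact: tends_cst.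
    apply: tendsM; first exact: tends_cst.
    by apply: tendsB; [exact: tends_id|exact: tends_cst].
  by apply: tends_sum_seq => g gZ; exact: tends_Phi.
transitivity (((2 * pi)*i)^-1 * tot 1).
  rewrite /oint /tot; congr (_ * _); apply: eq_bigr => g _.
  by apply: eq_cint => t _; rewrite /Phi seg1.
(* At [s = 0] the integrand is the constant [f x] times the kernel of the winding number, which is
   1. *)
rewrite e -[RHS]mulr1 -Zx.2 /winding_number.
rewrite -(ointZ cZ); last exact: trace_cont_inv Zx.1.
rewrite /oint /tot; congr (_ * _); apply: eq_bigr => g _.
by apply: eq_cint => t _; rewrite /Phi seg0.
Qed.

End CauchySlit.

Lemma powC_cont (a z : C) : slit z ->
  tends (nbhs (z : C^o)) (fun z => powC z a) (powC z a).
Proof.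
move=> sz; apply: tends_expC; apply: tendsM; first exact: tends_cst.
by apply: tends_LogC => //; exact: tends_id.
Qed.

Lemma oint_powC_pole (Z : seq (R -> C)) (x : R) (a : C) : closed_contour Z ->
  (forall z, trace Z z -> slit z) -> 0 < x -> encloses Z x%:C ->
  oint Z (fun z => powC z a / (z - x%:C)) = powC x%:C a.
Proof.
move=> cZ sZ x0 Zx.
apply: (@cauchy_slit Z x (fun z => powC z a) (fun z => a * powC z a / z)) => // z sz.
- exact: hol_powC.
- exact: powC_cont.
apply: tendsM; last by apply: tendsV; [exact: slit_neq0|exact: tends_id].
by apply: tendsM; [exact: tends_cst|exact: powC_cont].
Qed.

End Residues.

(** * Lagrange interpolation and Vandermonde determinants *)

Section LagrangeInterpolation.
Variables (K : fieldType) (N : nat) (x : 'I_N -> K).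

Definition rootpoly : {poly K} := \prod_(i < N) ('X - (x i)%:P).

Definition lagpoly (j : 'I_N) : {poly K} := \prod_(i < N | i != j) ('X - (x i)%:P).

Lemma rootpolyE j : rootpoly = ('X - (x j)%:P) * lagpoly j.
Proof. by rewrite /rootpoly (bigD1 j). Qed.

Lemma size_rootpoly : size rootpoly = N.+1.
Proof. by rewrite size_prod_XsubC /index_enum -enumT size_enum_ord. Qed.

Lemma size_lagpoly j : size (lagpoly j) = N.
Proof.
have := size_rootpoly; rewrite (rootpolyE j) size_Mmonic ?size_XsubC.
- by rewrite addnC addn2 => -[].
- by rewrite polyXsubC_eq0.
- by apply: monic_prod => i _; exact: monicXsubC.
Qed.

Lemma horner_lagpoly j z : (lagpoly j).[z] = \prod_(i < N | i != j) (z - x i).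
Proof. by rewrite horner_prod; apply: eq_bigr => i _; rewrite hornerXsubC. Qed.

Lemma horner_rootpoly z : rootpoly.[z] = \prod_(i < N) (z - x i).
Proof. by rewrite horner_prod; apply: eq_bigr => i _; rewrite hornerXsubC. Qed.

Lemma lagpoly_neq j k : k != j -> (lagpoly j).[x k] = 0.
Proof. by move=> kj; rewrite horner_lagpoly (bigD1 k) //= subrr mul0r. Qed.

(* Synthetic division by [X - c]. *)
Lemma divided_coef (S P : {poly K}) (c : K) b : (size S <= N)%N -> (b < N)%N ->
  P = ('X - c%:P) * S -> \sum_(m < N - b) P`_(m + b.+1) * c ^+ m = S`_b.
Proof.
move=> sS bN ->.
(* The coefficients of [(X - c) S] make the sum telescope from [S_b] down to [S_N], which is 0 by
   the size of [S]. *)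
have h m : (('X - c%:P) * S)`_(m + b.+1) * c ^+ m =
   S`_(m + b) * c ^+ m - S`_(m.+1 + b) * c ^+ m.+1.
  by rewrite mulrBl coefB coefXM addnS /= coefCM exprS addSn; ring.
rewrite -(big_mkord xpredT (fun m => (('X - c%:P) * S)`_(m + b.+1) * c ^+ m)).
rewrite (eq_bigr (fun m => - (S`_(m.+1 + b) * c ^+ m.+1 - S`_(m + b) * c ^+ m))); last first.
  by move=> m _; rewrite h; ring.
rewrite sumrN telescope_sumr // subnK ?(ltnW bN) // add0n expr0 mulr1.
by rewrite (nth_default 0 sS) mul0r sub0r opprK.
Qed.

Hypothesis x_inj : injective x.

Lemma lagpoly_neq0 j : (lagpoly j).[x j] != 0.
Proof.
rewrite horner_lagpoly; apply/prodf_neq0 => i ij.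
by rewrite subr_eq0 (inj_eq x_inj) eq_sym.
Qed.

Lemma lagrange_interp (q : {poly K}) z : (size q <= N)%N ->
  q.[z] = \sum_j q.[x j] / (lagpoly j).[x j] * (lagpoly j).[z].
Proof.
(* [D] has size at most [N] and vanishes at the [N] distinct nodes, hence is zero. *)
move=> sq; pose D := q - \sum_j (q.[x j] / (lagpoly j).[x j]) *: lagpoly j.
have sD : (size D <= N)%N.
  apply: (leq_trans (size_polyD _ _)); rewrite geq_max sq size_polyN.
  apply: (leq_trans (size_sum _ _ _)); apply/bigmax_leqP => j _.
  by apply: (leq_trans (size_scale_leq _ _)); rewrite size_lagpoly.
have D0 : D = 0.
  apply: (@roots_geq_poly_eq0 _ D [seq x i | i <- enum 'I_N]).
  - apply/allP => _ /mapP[k _ ->]; rewrite rootE /D hornerD hornerN horner_sum.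
    rewrite (bigD1 k) //= big1 ?addr0.
      by rewrite hornerZ divfK ?subrr // lagpoly_neq0.
    by move=> j jk; rewrite hornerZ (@lagpoly_neq j k) ?mulr0 1?eq_sym.
  - by rewrite map_inj_uniq ?enum_uniq.
  - by rewrite size_map size_enum_ord.
have := congr1 (fun p : {poly K} => p.[z]) D0.
rewrite /D hornerD hornerN horner_sum horner0 => /eqP; rewrite subr_eq0 => /eqP ->.
by apply: eq_bigr => j _; rewrite hornerZ.
Qed.

End LagrangeInterpolation.

Section Determinants.
Variable K : fieldType.

(** Cramer's rule as a factorization [M = C V], with [C] the identity matrix whose row [p] is
    replaced by [c]; expansion along column [p] gives [c p] as its determinant. *)
Lemma det_replace_row N (V M : 'M[K]_N) (p : 'I_N) (c : 'I_N -> K) :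
  (forall i j, i != p -> M i j = V i j) ->
  (forall j, M p j = \sum_i c i * V i j) -> \det M = c p * \det V.
Proof.
case: N V M p c => [|n] V M p c; first by case: p.
move=> h1 h2; pose C := \matrix_(i < n.+1, j < n.+1) (if i == p then c j else (i == j)%:R) : 'M[K]_n.+1.
have -> : M = C *m V.
  apply/matrixP => i j; rewrite !mxE.
  under eq_bigr do rewrite !mxE.
  have [->|ip] := eqVneq i p; first by rewrite h2.
  rewrite (bigD1 i) //= eqxx mul1r big1 ?addr0 ?h1 // => k ki.
  by rewrite eq_sym (negbTE ki) mul0r.
rewrite det_mulmx; congr (_ * _); rewrite (expand_det_col C p) (bigD1 p) //= big1 ?addr0.
  rewrite mxE eqxx /cofactor addnn -signr_odd odd_double expr0 mul1r.
  rewrite (_ : row' p (col' p C) = 1%:M) ?det1 ?mulr1 //.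
  apply/matrixP => i j; rewrite !mxE eq_sym (negbTE (neq_lift _ _)).
  by rewrite (inj_eq lift_inj).
by move=> i ip; rewrite mxE (negbTE ip) mul0r.
Qed.

(** Laplace expansions along the moved row have the same minors, and their cofactor signs differ by
    [(-1)^p]. *)
Lemma det_cycle_row n (M0 M : 'M[K]_n.+1) (p : 'I_n.+1) :
  (forall j, M0 ord0 j = M p j) ->
  (forall k j, M0 (lift ord0 k) j = M (lift p k) j) ->
  \det M0 = (-1) ^+ p * \det M.
Proof.
move=> h1 h2; rewrite (expand_det_row M0 ord0) (expand_det_row M p) big_distrr /=.
apply: eq_bigr => j _; rewrite h1 /cofactor.
have -> : row' ord0 (col' j M0) = row' p (col' j M).
  by apply/matrixP => k l; rewrite !mxE h2.
rewrite add0n exprD [RHS]mulrCA; congr (_ * _).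
by rewrite !mulrA -expr2 sqrr_sign mul1r.
Qed.

(** The interpolating polynomial of the values [y] at the nodes [x] writes the new row as a
    combination of the monomial rows; only the weight of the replaced row survives. *)
Lemma det_interp N (x : 'I_N -> K) (y : 'I_N -> K) (M : 'M[K]_N) (p : 'I_N) :
  injective x -> (forall i j, i != p -> M i j = x j ^+ (N - i.+1)) ->
  (forall j, M p j = y j) ->
  \det M = (\sum_j y j / (lagpoly x j).[x j] * (lagpoly x j)`_(N - p.+1)) *
           \det (\matrix_(i, j) x j ^+ (N - i.+1)).
Proof.
move=> xi h1 h2.
apply: (@det_replace_row _ _ _ _ (fun i : 'I_N =>
   \sum_j y j / (lagpoly x j).[x j] * (lagpoly x j)`_(N - i.+1))).
  by move=> i j ip; rewrite mxE h1.
move=> k; rewrite h2.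
under eq_bigr do rewrite mxE big_distrl /=.
rewrite exchange_big /=.
transitivity (\sum_j y j / (lagpoly x j).[x j] * (lagpoly x j).[x k]).
  rewrite (bigD1 k) //= big1 ?addr0 ?divfK ?lagpoly_neq0 // => j jk.
  by rewrite (@lagpoly_neq _ _ x j k) ?mulr0 1?eq_sym.
apply: eq_bigr => j _.
rewrite (@horner_coef_wide _ N (lagpoly x j) (x k)) ?size_lagpoly // big_distrr /=.
(* Row [i] carries the exponent [N - i - 1], so rows run against degrees. *)
rewrite (reindex_inj rev_ord_inj) /=.
by apply: eq_bigr => i _; rewrite mulrA.
Qed.

(** The transposed use of interpolation: rows are now nodes, and interpolating each [X^j] at the
    nodes [r] writes the row of [a] as a combination of theirs. *)
Lemma det_powers_replace N (r : 'I_N -> K) (a : K) (M : 'M[K]_N) (p : 'I_N) :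
  injective r -> (forall i j, i != p -> M i j = r i ^+ j) ->
  (forall j : 'I_N, M p j = a ^+ j) ->
  \det M = (lagpoly r p).[a] / (lagpoly r p).[r p] * \det (\matrix_(i, j) r i ^+ j).
Proof.
move=> ri h1 h2.
apply: (@det_replace_row _ _ _ _ (fun i => (lagpoly r i).[a] / (lagpoly r i).[r i])).
  by move=> i j ip; rewrite mxE h1.
move=> j; rewrite h2.
have := @lagrange_interp _ _ _ ri 'X^j a; rewrite size_polyXn hornerXn => ->; last exact: ltn_ord.
by apply: eq_bigr => i _; rewrite hornerXn mxE; ring.
Qed.

End Determinants.

(** * The Gamma function *)

Section GaussProduct.
Variable R : realType.
Local Notation C := R[i].
Local Notation Re := (@complex.Re R).
Local Notation Im := (@complex.Im R).

(** The mean value theorem is applied to the real and imaginary parts in turn, hence [M + M]. *)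
Lemma mean_value_ineq (u u' : R -> C) (M : R) :
  (forall t, 0 <= t <= 1 -> cderiv u t (u' t)) ->
  (forall t, 0 <= t <= 1 -> cmod (u' t) <= M) -> cmod (u 1 - u 0) <= M + M.
Proof.
move=> du bu.
have main (f f' : R -> R) : (forall t, 0 <= t <= 1 -> rderiv f t (f' t)) ->
    (forall t, 0 <= t <= 1 -> `|f' t| <= M) -> `|f 1 - f 0| <= M.
  move=> df bf; have [] := @MVT_segment R f f' 0 1 ler01.
  - by move=> t; rewrite in_itv /= => /andP[h1 h2]; apply: df; rewrite !ltW.
  - apply: continuous_in_subspaceT => t; rewrite inE /= in_itv /= => /df.
    exact: rderiv_continuous.
  by move=> t; rewrite in_itv /= => ht ->; rewrite subr0 mulr1; exact: bf.
apply: (le_trans (cmod_le_ReIm _)); rewrite Re_add Im_add Re_opp Im_opp.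
apply: lerD.
  apply: (main (fun t => Re (u t)) (fun t => Re (u' t))) => t ht; first by case: (du t ht).
  exact: le_trans (Re_le_cmod _) (bu t ht).
apply: (main (fun t => Im (u t)) (fun t => Im (u' t))) => t ht; first by case: (du t ht).
exact: le_trans (Im_le_cmod _) (bu t ht).
Qed.

Lemma cderiv_expC_scale (w : C) t : cderiv (fun t => expC (t%:C * w)) t (w * expC (t%:C * w)).
Proof.
apply: cderiv_eq.
  apply: cderiv_expC; apply: cderivM; [exact: cderiv_real|exact: cderiv_cst].
by rewrite /=; ring.
Qed.

Lemma expC_bound (w : C) t : 0 <= t <= 1 -> cmod (expC (t%:C * w)) <= expR (cmod w).
Proof.
move=> /andP[t0 t1]; rewrite cmod_expC ler_expR Re_scale.
apply: (@le_trans _ _ (t * cmod w)).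
  by apply: ler_wpM2l => //; apply: le_trans (Re_le_cmod _); exact: ler_norm.
by rewrite -[leRHS]mul1r; apply: ler_wpM2r => //; exact: cmod_ge0.
Qed.

Lemma expC_order1 (w : C) : cmod (expC w - 1) <= 2 * (cmod w * expR (cmod w)).
Proof.
have := @mean_value_ineq (fun t => expC (t%:C * w)) (fun t => w * expC (t%:C * w))
  (cmod w * expR (cmod w)).
rewrite mul1r mul0r expC0 mulr_natl mulr2n; apply => t ht.
  exact: cderiv_expC_scale.
by rewrite cmodM; apply: ler_wpM2l; [exact: cmod_ge0|exact: expC_bound].
Qed.

(** The first-order bound is fed into the derivative [w (e^(tw) - 1)] of [e^(tw) - tw]; each use of
    [mean_value_ineq] doubles, whence 2 there and 4 here. *)
Lemma expC_order2 (w : C) : cmod (expC w - 1 - w) <= 4 * (cmod w ^+ 2 * expR (cmod w)).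
Proof.
have := @mean_value_ineq (fun t => expC (t%:C * w) - t%:C * w)
  (fun t => w * (expC (t%:C * w) - 1)) (2 * (cmod w ^+ 2 * expR (cmod w))).
rewrite mul1r mul0r expC0 subr0 (_ : expC w - 1 - w = expC w - w - 1); last by ring.
rewrite (_ : 4 * _ = 2 * (cmod w ^+ 2 * expR (cmod w)) + 2 * (cmod w ^+ 2 * expR (cmod w)));
  last by ring.
apply => t ht.
  apply: cderiv_eq.
    apply: cderivB; first exact: cderiv_expC_scale.
    by apply: cderivM; [exact: cderiv_real|exact: cderiv_cst].
  by rewrite /=; ring.
have /andP[t0 t1] := ht.
rewrite cmodM expr2 -mulrA mulrCA; apply: ler_wpM2l; first exact: cmod_ge0.
apply: le_trans (expC_order1 _) _; rewrite ler_wpM2l //.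
have h : cmod (t%:C * w) <= cmod w.
  by rewrite cmodM cmodR ger0_norm // ler_piMl ?cmod_ge0.
by apply: ler_pM; rewrite ?cmod_ge0 ?expR_ge0 ?ler_expR.
Qed.

(** With [s] the partial sums of [c], both [s] and [x + s] are nondecreasing and bounded, and [x] is
    their difference. *)
Lemma bounded_variation_cvg (x : nat -> R) (c : nat -> R) (S : R) :
  (forall n, `|x n.+1 - x n| <= c n) -> (forall n, \sum_(k < n) c k <= S) ->
  cvgn x.
Proof.
move=> xc cS; pose s n := \sum_(k < n) c k.
have c0 n : 0 <= c n := le_trans (normr_ge0 _) (xc n).
have cs : cvgn s.
  apply: nondecreasing_is_cvgn.
    by apply/nondecreasing_seqP => n; rewrite /s big_ord_recr /= lerDl.
  by exists S => _ [n _ <-]; exact: cS.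
have xs n : x n - x 0%N <= s n.
  elim: n => [|n IH]; first by rewrite subrr /s big_ord0.
  rewrite /s big_ord_recr /=; have := xc n; rewrite ler_norml => /andP[_ h].
  by move: IH; rewrite /s; lra.
have cxs : cvgn (x + s).
  apply: nondecreasing_is_cvgn.
    apply/nondecreasing_seqP => n; rewrite !fctE /s big_ord_recr /=.
    by have := xc n; rewrite ler_norml => /andP[h _]; lra.
  exists (x 0%N + S + S) => _ [n _ <-]; rewrite fctE.
  by have := xs n; have := cS n; rewrite -/(s n); lra.
have -> : x = (x + s) - s by apply/funext => n; rewrite !fctE addrK.
exact: is_cvgB.
Qed.

Lemma bounded_variation_tends (x : nat -> C) (c : nat -> R) (S : R) :
  (forall n, cmod (x n.+1 - x n) <= c n) -> (forall n, \sum_(k < n) c k <= S) ->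
  exists l, tends \oo x l.
Proof.
move=> xc cS.
have h1 : cvgn (fun n => Re (x n)).
  apply: (bounded_variation_cvg _ cS) => n.
  by rewrite -Re_opp -Re_add; exact: le_trans (Re_le_cmod _) (xc n).
have h2 : cvgn (fun n => Im (x n)).
  apply: (bounded_variation_cvg _ cS) => n.
  by rewrite -Im_opp -Im_add; exact: le_trans (Im_le_cmod _) (xc n).
exists (limn (fun n => Re (x n)) +i* limn (fun n => Im (x n))).
by apply/tends_ReIm; split.
Qed.

(** From [1 + c <= e^c], the products stay below [|P 0| e^S]; their increments are then summable. *)
Lemma infinite_product_tends (P u : nat -> C) (c : nat -> R) (S : R) :
  (forall n, P n.+1 = P n * (1 + u n)) -> (forall n, cmod (u n) <= c n) ->
  (forall n, \sum_(k < n) c k <= S) -> exists l, tends \oo P l.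
Proof.
move=> hP uc cS.
have c0 n : 0 <= c n := le_trans (cmod_ge0 _) (uc n).
have bP n : cmod (P n) <= cmod (P 0%N) * expR (\sum_(k < n) c k).
  elim: n => [|n IH]; first by rewrite big_ord0 expR0 mulr1.
  rewrite hP cmodM big_ord_recr /= expRD mulrA; apply: ler_pM => //; try exact: cmod_ge0.
  apply: (le_trans (cmodD _ _)); rewrite cmod1; apply: le_trans (expR_ge1Dx _).
  by rewrite lerD2l.
have bP' n : cmod (P n) <= cmod (P 0%N) * expR S.
  by apply: le_trans (bP n) _; rewrite ler_wpM2l ?cmod_ge0 // ler_expR.
apply: (@bounded_variation_tends _ (fun n => cmod (P 0%N) * expR S * c n)
  (cmod (P 0%N) * expR S * S)).
  move=> n; rewrite hP mulrDr mulr1 addrAC subrr add0r cmodM.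
  by apply: ler_pM; rewrite ?cmod_ge0.
move=> n; rewrite -big_distrr /=; apply: ler_wpM2l; last exact: cS.
by rewrite mulr_ge0 ?cmod_ge0 ?expR_ge0.
Qed.

(** The inverses satisfy a recurrence of the same type, with [- u / (1 + u)] bounded by [2 c]
    because [c <= 1/2]. So [P] and its inverse both converge, and the product of the limits is 1. *)
Lemma infinite_product_neq0 (P u : nat -> C) (c : nat -> R) (S : R) :
  (forall n, P n.+1 = P n * (1 + u n)) -> (forall n, cmod (u n) <= c n) ->
  (forall n, c n <= 2^-1) ->
  (forall n, \sum_(k < n) c k <= S) -> P 0%N != 0 -> exists2 l, l != 0 & tends \oo P l.
Proof.
move=> hP uc c2 cS P0; have [l hl] := infinite_product_tends hP uc cS.
have u1 n : 2^-1 <= cmod (1 + u n).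
  have := cmodD (1 + u n) (- u n); rewrite addrK cmod1 cmodN.
  by have := uc n; have := c2 n; lra.
have u0 n : 1 + u n != 0 by rewrite -cmod_gt0 (lt_le_trans _ (u1 n)) // invr_gt0.
have Pn0 n : P n != 0 by elim: n => // n IH; rewrite hP mulf_neq0.
have [l' hl'] : exists l', tends \oo (fun n => (P n)^-1) l'.
  apply: (@infinite_product_tends _ (fun n => - u n / (1 + u n)) (fun n => 2 * c n) (2 * S)).
  - move=> n; rewrite hP; have := Pn0 n; have := u0 n => h1 h2; field.
    by rewrite h1 h2.
  - move=> n; rewrite cmodM cmodN cmodV mulrC.
    apply: ler_pM; rewrite ?cmod_ge0 ?invr_ge0 ?cmod_ge0 //.
    by rewrite invf_ple ?posrE ?cmod_gt0 ?ltr0n.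
  - by move=> n; rewrite -big_distrr /=; apply: ler_wpM2l; [exact: ler0n|exact: cS].
exists l => //; apply/eqP => l0.
have h : tends \oo (fun n => P n * (P n)^-1) (l * l') by exact: tendsM.
rewrite l0 mul0r in h.
have h1 : tends \oo (fun n => P n * (P n)^-1) 1.
  by under [X in tends _ X]eq_fun do rewrite divff //; exact: tends_cst.
have e : 0 = 1 :> C by exact: tends_unique h h1.
by move/eqP: e; rewrite eq_sym oner_eq0.
Qed.

(** Comparison with the telescoping sum of [1/m - 1/(m+1)], starting at [n0 > 0]. *)
Lemma sum_inv_sqr_le (n0 n : nat) (K : R) : 0 <= K -> (0 < n0)%N ->
  \sum_(k < n) K / (n0 + k).+1%:R ^+ 2 <= K.
Proof.
move=> K0 n00.
have pos m : 0 < (n0 + m)%:R :> R by rewrite ltr0n addn_gt0 n00.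
have pos1 m : 0 < (n0 + m).+1%:R :> R by rewrite ltr0n.
have step k : K / (n0 + k).+1%:R ^+ 2 <= K * ((n0 + k)%:R^-1 - (n0 + k.+1)%:R^-1).
  rewrite addnS; apply: ler_wpM2l => //.
  have -> : (n0 + k)%:R^-1 - (n0 + k).+1%:R^-1 = ((n0 + k)%:R * (n0 + k).+1%:R)^-1 :> R.
    have h1 := pos k; have h2 := pos1 k; rewrite -natr1 in h2 *.
    move: (_ %:R) h1 h2 => m h1 h2; field.
    by rewrite !gt_eqF.
  rewrite expr2 lef_pV2 ?posrE ?mulr_gt0 //.
  by apply: ler_wpM2r; [exact: ltW|rewrite ler_nat].
apply: (@le_trans _ _ (\sum_(k < n) K * ((n0 + k)%:R^-1 - (n0 + k.+1)%:R^-1))).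
  by apply: ler_sum => k _; exact: step.
rewrite -big_distrr /= -[leRHS]mulr1 ler_wpM2l //.
rewrite -(big_mkord xpredT (fun k => (n0 + k)%:R^-1 - (n0 + k.+1)%:R^-1 : R)).
rewrite (eq_bigr (fun k => - (n0 + k.+1)%:R^-1 - (- (n0 + k)%:R^-1))); last first.
  by move=> k _; rewrite opprK addrC.
rewrite telescope_sumr // opprK addn0 addrC.
have h : (n0%:R : R)^-1 <= 1 by rewrite invf_le1 ?ltr0n // ler1n.
have h2 : 0 <= ((n0 + n)%:R : R)^-1 by rewrite invr_ge0 ler0n.
by lra.
Qed.

End GaussProduct.

(** * Convergence and nonvanishing of Gauss's product, and the functional equation *)

Section Gamma.
Variable R : realType.
Local Notation C := R[i].
Implicit Types (z s : C).

Definition gauss (n : nat) z : C :=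
  (n`!)%:R * powC n%:R z / \prod_(k < n.+1) (z + k%:R).

Lemma natC (n : nat) : (n%:R : C) = (n%:R : R)%:C.
Proof. by rewrite rmorph_nat. Qed.

Lemma powC_nat n z : (0 < n)%N -> powC n%:R z = expC ((ln n%:R)%:C * z).
Proof. by move=> n0; rewrite /powC natC LogC_real ?ltr0n // mulrC. Qed.

Definition not_pole z : Prop := forall k : nat, z + k%:R != 0.

Lemma gauss_neq0 n z : not_pole z -> gauss n z != 0.
Proof.
move=> hz; apply: mulf_neq0; first apply: mulf_neq0.
- by rewrite pnatr_eq0 -lt0n fact_gt0.
- exact: expC_neq0.
- by rewrite invr_neq0 //; apply/prodf_neq0 => k _; exact: hz.
Qed.

Lemma gauss_step n z : (0 < n)%N -> not_pole z ->
  gauss n.+1 z = gauss n z *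
    (n.+1%:R * expC ((ln n.+1%:R - ln n%:R)%:C * z) / (z + n.+1%:R)).
Proof.
move=> n0 hz; rewrite /gauss !powC_nat // [in LHS]big_ord_recr /= factS natrM.
have -> : expC ((ln n.+1%:R)%:C * z) =
    expC ((ln n.+1%:R - ln n%:R)%:C * z) * expC ((ln n%:R)%:C * z) :> C.
  by rewrite -expCD -mulrDl -rmorphD subrK.
rewrite invfM; ring.
Qed.

Lemma gauss_shift n z : (0 < n)%N -> not_pole z ->
  gauss n (z + 1) = gauss n z * (z * (n%:R / (z + n.+1%:R))).
Proof.
move=> n0 hz; rewrite /gauss !powC_nat // mulrDr mulr1 expCD expCR lnK ?posrE ?ltr0n //.
rewrite -natC.
have z0 : z != 0 by have := hz 0%N; rewrite addr0.
have e : \prod_(k < n.+1) (z + k%:R) * (z + n.+1%:R) =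
    z * \prod_(k < n.+1) (z + 1 + k%:R).
  transitivity (\prod_(k < n.+2) (z + k%:R)); first by rewrite [RHS]big_ord_recr.
  rewrite big_ord_recl /= addr0.
  by congr (_ * _); apply: eq_bigr => k _; rewrite /bump /= add1n -natr1; ring.
have p0 m : \prod_(k < m) (z + k%:R) != 0 by apply/prodf_neq0 => k _; exact: hz.
have p1 : \prod_(k < n.+1) (z + 1 + k%:R) != 0.
  apply/prodf_neq0 => k _; have := hz k.+1; rewrite -natr1; congr (_ != 0); ring.
have -> : (\prod_(k < n.+1) (z + 1 + k%:R))^-1 =
   z / (\prod_(k < n.+1) (z + k%:R) * (z + n.+1%:R)).
  by rewrite e invfM mulrA divff // mul1r.
rewrite invfM; ring.
Qed.

(** Both bounds are [ln (1 + x) <= x], at [x = -1/(n+1)] and at [x = 1/n]. *)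
Lemma ln_succ_bounds n : (0 < n)%N ->
  (n.+1%:R : R)^-1 <= ln (n.+1%:R : R) - ln n%:R <= n%:R^-1.
Proof.
move=> n0; have p : 0 < n%:R :> R by rewrite ltr0n.
have p1 : 0 < n.+1%:R :> R by rewrite ltr0n.
have e1 : n.+1%:R = n%:R * (1 + n%:R^-1) :> R.
  by rewrite mulrDr mulr1 divff ?gt_eqF // natr1.
have e2 : n%:R = n.+1%:R * (1 + (- n.+1%:R^-1)) :> R.
  by rewrite mulrDr mulr1 mulrN divff ?gt_eqF // -natr1 addrK.
have q : 0 < n%:R^-1 :> R by rewrite invr_gt0.
have q1 : 0 < 1 + (- n.+1%:R^-1) :> R.
  by rewrite subr_gt0 invf_lt1 // ltr1n ltnS.
apply/andP; split.
  have : ln (n%:R : R) <= ln n.+1%:R - n.+1%:R^-1.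
    rewrite {1}e2 lnM ?posrE // lerD2l.
    by apply: le_ln1Dx; rewrite ltrN2 invf_lt1 // ltr1n ltnS.
  by rewrite !lerBrDr addrC.
rewrite {1}e1 lnM ?posrE ?addr_gt0 // addrAC subrr add0r.
by apply: le_ln1Dx; lra.
Qed.

(** With [h = 1/(n+1)] and [d = ln (n+1) - ln n] the factor is [e^(dz) / (1 + hz)], and subtracting
    1 leaves the numerator [(e^(dz) - 1 - dz) + (d - h) z]. The first summand costs
    [4 (2h |z|)^2 e^|z|] as [d <= 2h], hence 16; the second costs [2 h^2 |z|]; the outer 2 is due to
    [|1 + hz| >= 1/2]. *)
Lemma gauss_ratio z n : (0 < n)%N -> 2 * cmod z <= n.+1%:R ->
  cmod (n.+1%:R * expC ((ln n.+1%:R - ln n%:R)%:C * z) / (z + n.+1%:R) - 1) <=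
  2 * (16 * (cmod z ^+ 2 * expR (cmod z)) + 2 * cmod z) / n.+1%:R ^+ 2.
Proof.
move=> n0 zn; have /andP[d1 d2] := ln_succ_bounds n0.
set d := ln n.+1%:R - ln n%:R in d1 d2 *.
have p : 0 < n%:R :> R by rewrite ltr0n.
have n1 : 1 <= n%:R :> R by rewrite ler1n.
have eM : n.+1%:R = n%:R + 1 :> R by rewrite natr1.
set M : R := n.+1%:R in zn d1 eM *.
have M0 : 0 < M by rewrite ltr0n.
rewrite natC -/M.
set h := M^-1 in d1 *.
have h0 : 0 < h by rewrite invr_gt0.
have Mh : M * h = 1 by rewrite divff ?gt_eqF.
have d3 : d <= 2 * h.
  apply: (le_trans d2); rewrite -(ler_pM2l p) divff ?gt_eqF //; nra.
have d4 : d - h <= 2 * h ^+ 2.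
  suff : n%:R^-1 - h <= 2 * h ^+ 2 by lra.
  have -> : n%:R^-1 - h = h * n%:R^-1.
    by rewrite /h eM; field; rewrite !gt_eqF // -?eM.
  rewrite expr2 mulrCA; apply: ler_wpM2l; first exact: ltW.
  by rewrite -(ler_pM2l p) divff ?gt_eqF //; nra.
have h12 : h <= 2^-1 by nra.
have den0 : 2^-1 <= cmod (1 + h%:C * z).
  have := cmodD (1 + h%:C * z) (- (h%:C * z)); rewrite addrK cmod1 cmodN cmodM cmodR gtr0_norm //.
  suff : h * cmod z <= 2^-1 by lra.
  by nra.
have den1 : 1 + h%:C * z != 0 by rewrite -cmod_gt0; lra.
have MC0 : M%:C != 0 by rewrite gt_eqF ?ltcR.
have hM : h%:C = (M%:C)^-1 by rewrite /h fmorphV.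
have zM : z + M%:C = M%:C * (1 + h%:C * z).
  by rewrite hM mulrDr mulr1 mulrA divff // mul1r addrC.
have -> : M%:C * expC (d%:C * z) / (z + M%:C) - 1 =
    ((expC (d%:C * z) - 1 - d%:C * z) + (d - h)%:C * z) / (1 + h%:C * z).
  have key (E hc dc Mc : C) : 1 + hc * z != 0 -> Mc != 0 ->
      Mc * E / (Mc * (1 + hc * z)) - 1 = (E - 1 - dc * z + (dc - hc) * z) / (1 + hc * z).
    by move=> a1 a2; field; rewrite a1 a2.
  have dh : (d - h)%:C = d%:C - h%:C :> C by exact: rmorphB.
  by rewrite zM dh; exact: key.
have z0 := cmod_ge0 z; have e0 := expR_gt0 (cmod z).
have dz : cmod (d%:C * z) <= 2 * h * cmod z.
  by rewrite cmodM cmodR ger0_norm ?ler_wpM2r //; lra.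
have num : cmod ((expC (d%:C * z) - 1 - d%:C * z) + (d - h)%:C * z) <=
    (16 * (cmod z ^+ 2 * expR (cmod z)) + 2 * cmod z) * h ^+ 2.
  apply: (le_trans (cmodD _ _)); rewrite mulrDl; apply: lerD.
    apply: (le_trans (expC_order2 _)).
    have -> : 16 * (cmod z ^+ 2 * expR (cmod z)) * h ^+ 2 =
      4 * ((2 * h * cmod z) ^+ 2 * expR (cmod z)) by ring.
    rewrite ler_wpM2l //; apply: ler_pM; rewrite ?sqr_ge0 ?expR_ge0 //.
      by rewrite lerXn2r // ?nnegrE ?cmod_ge0 // !mulr_ge0 // ltW.
    rewrite ler_expR; apply: (le_trans dz); nra.
  rewrite cmodM cmodR ger0_norm; last by lra.
  by rewrite mulrAC; apply: ler_wpM2r.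
rewrite cmodM cmodV -mulrA mulrC -exprVn -/h.
have i2 : (cmod (1 + h%:C * z))^-1 <= 2.
  by rewrite invf_ple ?posrE ?cmod_gt0 ?ltr0n.
by apply: ler_pM; rewrite ?cmod_ge0 ?invr_ge0 ?cmod_ge0.
Qed.

Lemma gauss_tends z : not_pole z -> exists2 l, l != 0 & tends \oo (fun n => gauss n z) l.
Proof.
move=> hz; pose K : R := 2 * (16 * (cmod z ^+ 2 * expR (cmod z)) + 2 * cmod z).
have K0 : 0 <= K.
  by rewrite !(mulr_ge0, addr_ge0) ?cmod_ge0 ?expR_ge0 ?sqr_ge0.
(* Beyond [2 * cmod z] the bound of [gauss_ratio] applies, and beyond [2 * K] the deviations are at
   most [1/2], as [infinite_product_neq0] requires. *)
pose n0 := (Num.truncn (2 * K + 2 * cmod z)).+1.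
have hn : 2 * K + 2 * cmod z < n0%:R by apply: truncnS_gt.
have z0 := cmod_ge0 z.
have big n : 2 * K + 2 * cmod z <= (n0 + n).+1%:R.
  by apply: (le_trans (ltW hn)); rewrite ler_nat -addnS leq_addr.
have [l l0 hl] : exists2 l, l != 0 & tends \oo (fun n => gauss (n0 + n) z) l.
  apply: (@infinite_product_neq0 R _ (fun n => (n0 + n).+1%:R *
      expC ((ln (n0 + n).+1%:R - ln (n0 + n)%:R)%:C * z) / (z + (n0 + n).+1%:R) - 1)
      (fun n => K / (n0 + n).+1%:R ^+ 2) K).
  - by move=> n; rewrite addnS gauss_step // [1 + _]addrC subrK.
  - move=> n; apply: gauss_ratio => //; have := big n; lra.
  - move=> n; have b := big n.
    have M1 : 1 <= (n0 + n).+1%:R :> R by rewrite ler1n.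
    rewrite ler_pdivrMr ?exprn_gt0 ?ltr0n // expr2; nra.
  - by move=> n; apply: sum_inv_sqr_le.
  - exact: gauss_neq0.
exists l => //; move: hl; rewrite /tends.
under eq_fun do rewrite addnC.
by rewrite (cvg_shiftn n0 (fun n => gauss n z : C^o)).
Qed.

Lemma GammaC_lim z l : tends \oo (fun n => gauss n z) l -> GammaC z = l.
Proof. by move=> h; apply: tends_lim h. Qed.

Lemma GammaC_tends z : not_pole z -> tends \oo (fun n => gauss n z) (GammaC z).
Proof. by move=> /gauss_tends[l _ h]; rewrite (GammaC_lim h). Qed.

Lemma GammaC_neq0 z : not_pole z -> GammaC z != 0.
Proof. by move=> /gauss_tends[l l0 h]; rewrite (GammaC_lim h). Qed.

Lemma tends_inv_nat z : tends \oo (fun n : nat => n%:R / (z + n.+1%:R)) (1 : C).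
Proof.
have hv : tends \oo (fun n : nat => ((n.+1%:R)^-1 : C)) 0.
  under [X in tends _ X]eq_fun do rewrite natC -fmorphV /=.
  by apply: (@tends_real R _ _ _ _ (0 : R)); exact: cvg_harmonic.
have h : tends \oo (fun n : nat => (1 - n.+1%:R^-1) / (z * n.+1%:R^-1 + 1)) ((1 - 0) / (z * 0 + 1) : C).
  apply: tendsM; first by apply: tendsB; [exact: tends_cst|exact: hv].
  apply: tendsV; first by rewrite mulr0 add0r oner_neq0.
  apply: tendsD; last exact: tends_cst.
  by apply: tendsM; [exact: tends_cst|exact: hv].
rewrite subr0 mulr0 add0r divr1 in h.
apply: tends_eq h; apply: nearW => n.
have n1 : n.+1%:R != 0 :> C by rewrite pnatr_eq0.
have -> : n%:R = n.+1%:R - 1 :> C by rewrite -natr1 addrK.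
move: (n.+1%:R) n1 => m m0.
rewrite (_ : 1 - m^-1 = m^-1 * (m - 1)); last by field.
rewrite (_ : z * m^-1 + 1 = m^-1 * (z + m)); last by field.
by rewrite invfM invrK mulrACA mulVf ?mul1r.
Qed.

Lemma GammaCS_tends z : not_pole z ->
  tends \oo (fun n => gauss n (z + 1)) (z * GammaC z).
Proof.
move=> hz; have h : tends \oo (fun n => gauss n z * (z * (n%:R / (z + n.+1%:R)))) (GammaC z * (z * 1)).
  apply: tendsM; first exact: GammaC_tends.
  by apply: tendsM; [exact: tends_cst|exact: tends_inv_nat].
rewrite mulr1 mulrC in h; apply: tends_eq h.
by exists 1%N => // n /= n0; rewrite gauss_shift.
Qed.

Lemma GammaCS z : not_pole z -> GammaC (z + 1) = z * GammaC z.
Proof. by move=> hz; apply: GammaC_lim; exact: GammaCS_tends. Qed.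

Lemma not_poleS z : not_pole z -> not_pole (z + 1).
Proof. by move=> hz k; have := hz k.+1; rewrite -natr1 -addrA [1 + _]addrC. Qed.

Lemma not_pole_nat n : not_pole n.+1%:R.
Proof. by move=> k; rewrite -natrD addSn pnatr_eq0. Qed.

Lemma GammaC1 : GammaC 1 = 1 :> C.
Proof.
apply: GammaC_lim; apply: tends_eq (tends_inv_nat 0).
exists 1%N => // n /= n0; rewrite add0r /gauss powC_nat // mulr1 expCR lnK ?posrE ?ltr0n //.
have -> : \prod_(k < n.+1) (1 + k%:R) = (n.+1)`!%:R :> C.
  elim: n {n0} => [|n IH]; first by rewrite big_ord1 addr0.
  by rewrite big_ord_recr /= IH nat1r -natrM mulnC -factS.
rewrite factS natrM -natC.
have f0 : (n`!)%:R != 0 :> C by rewrite pnatr_eq0 -lt0n fact_gt0.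
have n1 : n.+1%:R != 0 :> C by rewrite pnatr_eq0.
move: (n.+1%:R) (n`!%:R) n1 f0 => m f m0 f0; field.
by rewrite m0 f0.
Qed.

Lemma GammaC_nat n : GammaC n.+1%:R = n`!%:R :> C.
Proof.
elim: n => [|n IH]; first by rewrite GammaC1.
by rewrite -natr1 GammaCS ?IH; [rewrite factS natrM|exact: not_pole_nat].
Qed.

Lemma GammaC_shift z N : not_pole z ->
  not_pole (z + N%:R) /\ GammaC (z + N%:R) = \prod_(k < N) (z + k%:R) * GammaC z.
Proof.
move=> hz; elim: N => [|N [h IH]]; first by rewrite addr0 big_ord0 mul1r.
rewrite -natr1 addrA; split; first exact: not_poleS.
by rewrite GammaCS // IH big_ord_recr /=; ring.
Qed.

Lemma nat_gap (m k : nat) : `|(m%:R : R) - k%:R| < 1 -> m = k.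
Proof.
wlog mk : m k / (m <= k)%N.
  by move=> h; case/orP: (leq_total m k) => [/h//|/h e]; rewrite distrC => /e.
rewrite distrC -natrB // normr_nat ltrn1 ltnS leqn0 subn_eq0 => km.
by apply/eqP; rewrite eqn_leq mk.
Qed.

(** Put [a = a0 + w]. If some [-k] other than [a] lies within [1/2] of [a], its distance to [a] is a
    valid radius, since these points are at least 1 apart; otherwise [1/2] is. *)
Lemma near_not_pole (a0 w : C) : \forall s \near (a0 : C^o)^', not_pole (s + w).
Proof.
set a := a0 + w.
have : exists2 e : R, 0 < e & forall s, s != a -> cmod (a - s) < e -> not_pole s.
  have [[k [k0 k1]]|no] := pselect (exists k : nat, a + k%:R != 0 /\ cmod (a + k%:R) < 2^-1).
    exists (cmod (a + k%:R)); first by rewrite cmod_gt0.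
    move=> s sa ds m; apply/negP => /eqP sm.
    have c : cmod (m%:R - k%:R : C) < 1.
      have -> : m%:R - k%:R = (a - s) - (a + k%:R) + (s + m%:R) by ring.
      by rewrite sm addr0; apply: (le_lt_trans (cmodD _ _)); rewrite cmodN; lra.
    have mk : m = k by apply: nat_gap; rewrite -cmodR rmorphB /= -!natC.
    move: ds; move/eqP: sm; rewrite addr_eq0 => /eqP ->.
    by rewrite opprK mk ltxx.
  exists 2^-1; first by rewrite invr_gt0.
  move=> s sa ds m; apply/negP => /eqP sm; apply: no; exists m.
  have e : a + m%:R = a - s.
    by move/eqP: sm; rewrite addr_eq0 => /eqP ->; rewrite opprK.
  by rewrite e subr_eq0 eq_sym.
move=> [e e0 h].
have /tendsP/(_ _ e0) n1 : tends (nbhs (a0 : C^o)) (fun x => x) a0 by exact: cvg_id.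
rewrite /dnbhs near_withinE; apply: filterS n1 => s ds sa.
apply: h; first by apply: contra_neq sa => /addIr.
by rewrite (_ : a - (s + w) = a0 - s) // /a; ring.
Qed.

(** At nearby [s] both Gamma values are off the poles, and [N] uses of the functional equation
    reduce the quotient to a rational function, after cancelling a nonzero Gamma value. That
    function is continuous at [a], even if [a] is a negative integer. *)
Lemma Gamma_quotE N (a : C) : (forall k : 'I_N, a <> (k : nat)%:R) ->
  Gamma_quot N a = (\prod_(k < N) (a - k%:R))^-1.
Proof.
move=> ha; apply: (@tends_lim R C^o (a : C^o)^' _ _ _).
have h : tends (a : C^o)^' (fun s : C^o => (\prod_(k < N) (s - k%:R))^-1)
    (\prod_(k < N) (a - k%:R))^-1.
  apply: tendsV.
    by apply/prodf_neq0 => k _; rewrite subr_eq0; apply/eqP; exact: ha.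
  apply: tends_prod => k _; apply: tendsB; last exact: tends_cst.
  exact: (cvg_within (F := nbhs (a : C^o))).
apply: tends_eq h.
have n1 : \forall s \near (a : C^o)^', not_pole (s - N%:R + 1).
  have := near_not_pole a (1 - N%:R); apply: filterS => s.
  by rewrite (_ : s - N%:R + 1 = s + (1 - N%:R)); last by ring.
apply: filterS n1 => s hs.
have [_ e] := GammaC_shift N hs.
have -> : s + 1 = s - N%:R + 1 + N%:R by ring.
rewrite e invfM mulrCA divff ?GammaC_neq0 // mulr1; congr (_^-1).
(* The shift produces the factors [s - N + 1 + k], which are the [s - k] in reverse order. *)
rewrite (reindex_inj rev_ord_inj) /=; apply: eq_bigr => k _.
rewrite (natrB _ (ltn_ord k)) -(natr1 k); ring.
Qed.

End Gamma.

(** * Existence of the multivariate Bessel function *)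

Section ComplexSeries.
Variable R : realType.
Local Notation C := R[i].
Implicit Types (u w : nat -> C) (c : nat -> R).

Definition csum u : C := lim ((fun n => \sum_(k < n) u k : C^o) @ \oo).

(** The bound on the majorant's partial sums is kept as a number, because it becomes the constant of
    the summed jet in [jet_series]. *)
Definition dominated u (S : R) : Prop := exists2 c,
  forall n, cmod (u n) <= c n & forall n, \sum_(k < n) c k <= S.

Lemma csumP u S : dominated u S -> tends \oo (fun n => \sum_(k < n) u k) (csum u).
Proof.
move=> [c uc cS]; have [l hl] : exists l, tends \oo (fun n => \sum_(k < n) u k) l.
  apply: (bounded_variation_tends (c := c)) cS => n.
  by rewrite big_ord_recr /= addrAC subrr add0r.
by rewrite /csum (tends_lim hl).
Qed.

Lemma csum_unique u l : tends \oo (fun n => \sum_(k < n) u k) l -> csum u = l.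
Proof. by move=> h; exact: tends_lim h. Qed.

Lemma csum_le u S : dominated u S -> cmod (csum u) <= S.
Proof.
move=> du.
have h : cmod (\sum_(k < n) u k) @[n --> \oo] --> cmod (csum u).
  exact: tends_cmod (csumP du).
have e : limn (fun n => cmod (\sum_(k < n) u k)) = cmod (csum u).
  by apply: cvg_lim h; exact: norm_hausdorff.
rewrite -e; apply: limr_le; first by apply/cvg_ex; exists (cmod (csum u)).
apply: nearW => n; have [c uc cS] := du; apply: le_trans (cS n).
elim: n => [|n IH]; first by rewrite !big_ord0 cmod0.
by rewrite !big_ord_recr /=; apply: (le_trans (cmodD _ _)); apply: lerD.
Qed.

Lemma csumD u w S T : dominated u S -> dominated w T ->
  csum (fun n => u n + w n) = csum u + csum w.
Proof.
move=> du dw; apply: csum_unique.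
under [X in tends _ X]eq_fun do rewrite big_split.
by apply: tendsD; [exact: csumP du|exact: csumP dw].
Qed.

Lemma csumZ u S (a : C) : dominated u S -> csum (fun n => a * u n) = a * csum u.
Proof.
move=> du; apply: csum_unique.
under [X in tends _ X]eq_fun do rewrite -big_distrr.
by apply: tendsM; [exact: tends_cst|exact: csumP du].
Qed.

Lemma dominatedD u w S T : dominated u S -> dominated w T ->
  dominated (fun n => u n + w n) (S + T).
Proof.
move=> [c uc cS] [d wd dT]; exists (fun n => c n + d n) => n.
  by apply: (le_trans (cmodD _ _)); apply: lerD.
by rewrite big_split; apply: lerD.
Qed.

Lemma dominatedZ u S (a : C) : dominated u S ->
  dominated (fun n => a * u n) (cmod a * S).
Proof.
move=> [c uc cS]; exists (fun n => cmod a * c n) => n.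
  by rewrite cmodM; apply: ler_wpM2l; [exact: cmod_ge0|exact: uc].
by rewrite -big_distrr /=; apply: ler_wpM2l; [exact: cmod_ge0|exact: cS].
Qed.

Lemma sum_expR_le (q : R) n : 0 <= q -> \sum_(k < n) q ^+ k / k`!%:R <= expR q.
Proof.
move=> q0; rewrite -(big_mkord xpredT (fun k => q ^+ k / k`!%:R)).
apply: (@nondecreasing_cvgn_le _ (series (exp_coeff q))); last exact: is_cvg_series_exp_coeff.
apply/nondecreasing_seqP => m; rewrite /series /= big_nat_recr //= lerDl.
exact: exp_coeff_ge0.
Qed.

Lemma dominated_exp u (K q : R) : 0 <= K -> 0 <= q ->
  (forall n, cmod (u n) <= K * q ^+ n / n`!%:R) -> dominated u (K * expR q).
Proof.
move=> K0 q0 h; exists (fun n => K * q ^+ n / n`!%:R) => // n.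
under eq_bigr do rewrite -mulrA.
by rewrite -big_distrr /=; apply: ler_wpM2l => //; exact: sum_expR_le.
Qed.

Lemma csum_sum (I : Type) (r : seq I) (u : I -> nat -> C) (S : I -> R) :
  (forall i, dominated (u i) (S i)) ->
  csum (fun n => \sum_(i <- r) u i n) = \sum_(i <- r) csum (u i).
Proof.
move=> h; apply: csum_unique.
under [X in tends _ X]eq_fun do rewrite exchange_big /=.
by apply: tends_sum => i _; exact: csumP (h i).
Qed.

End ComplexSeries.

(** * Second-order expansions with explicit constants *)

Section Jets.
Variables (R : realType).
Local Notation C := R[i].
Variable V : normedModType C.
Implicit Types (f g : V -> C) (L M : V -> C) (x h : V) (c d : R).

Definition rnorm (h : V) : R := complex.Re `|h|.

Lemma rnormE h : `|h| = (rnorm h)%:C.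
Proof. by rewrite /rnorm RRe_real // normr_real. Qed.

Lemma rnorm_ge0 h : 0 <= rnorm h.
Proof. by rewrite -ler0c -rnormE normr_ge0. Qed.

(* A second-order Taylor expansion of [f] at [x], with differential [L]: all
   three bounds by the single constant [c] make it submultiplicative up to a
   factor 6. *)
Definition jet f L x c : Prop :=
  [/\ forall (a : C) h k, L (a *: h + k) = a * L h + L k,
      cmod (f x) <= c,
      forall h, cmod (L h) <= c * rnorm h &
      forall h, rnorm h <= 1 -> cmod (f (x + h) - f x - L h) <= c * rnorm h ^+ 2].

Lemma jet_ge0 f L x c : jet f L x c -> 0 <= c.
Proof. by case=> _ h _ _; exact: le_trans (cmod_ge0 _) h. Qed.

Lemma jet_le f L x c d : c <= d -> jet f L x c -> jet f L x d.
Proof.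
move=> cd [h1 h2 h3 h4]; split => //.
- exact: le_trans cd.
- by move=> h; apply: (le_trans (h3 h)); apply: ler_wpM2r => //; exact: rnorm_ge0.
- by move=> h /h4 H; apply: (le_trans H); apply: ler_wpM2r => //; exact: sqr_ge0.
Qed.

Lemma jet_cst (k : C) x : jet (fun=> k) (fun=> 0) x (cmod k).
Proof.
split=> //.
- by move=> *; rewrite mulr0 addr0.
- by move=> h; rewrite cmod0 mulr_ge0 ?cmod_ge0 ?rnorm_ge0.
- by move=> h _; rewrite subrr subr0 cmod0 mulr_ge0 ?cmod_ge0 ?sqr_ge0.
Qed.

Lemma jet_lin L x : (forall (a : C) h k, L (a *: h + k) = a * L h + L k) ->
  (forall h, cmod (L h) <= rnorm h) -> jet L L x (cmod (L x) + 1).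
Proof.
move=> lL bL; have l0 := cmod_ge0 (L x); split=> //.
- by rewrite lerDl.
- by move=> h; apply: (le_trans (bL h)); rewrite ler_peMl ?rnorm_ge0 // lerDr.
- move=> h _; have -> : L (x + h) = L x + L h.
    by rewrite -[X in L (X + _)]scale1r lL mul1r.
  rewrite (_ : _ - _ - _ = 0); last by ring.
  by rewrite cmod0 mulr_ge0 ?sqr_ge0 // addr_ge0.
Qed.

Lemma jetD f g L M x c d : jet f L x c -> jet g M x d ->
  jet (fun y => f y + g y) (fun h => L h + M h) x (c + d).
Proof.
move=> [f1 f2 f3 f4] [g1 g2 g3 g4]; split.
- by move=> a h k; rewrite f1 g1; ring.
- by apply: (le_trans (cmodD _ _)); apply: lerD.
- by move=> h; apply: (le_trans (cmodD _ _)); rewrite mulrDl; apply: lerD.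
- move=> h h1; rewrite (_ : _ - _ - _ = (f (x + h) - f x - L h) + (g (x + h) - g x - M h)).
    by apply: (le_trans (cmodD _ _)); rewrite mulrDl; apply: lerD; [exact: f4|exact: g4].
  by ring.
Qed.

Lemma jetM f g L M x c d : jet f L x c -> jet g M x d ->
  jet (fun y => f y * g y) (fun h => L h * g x + f x * M h) x (6 * (c * d)).
Proof.
move=> jf jg; have c0 := jet_ge0 jf; have d0 := jet_ge0 jg.
move: jf jg => [f1 f2 f3 f4] [g1 g2 g3 g4].
have cd0 : 0 <= c * d by exact: mulr_ge0.
split.
- by move=> a h k; rewrite f1 g1; ring.
- rewrite cmodM; apply: (@le_trans _ _ (c * d)); last by lra.
  by apply: ler_pM; rewrite ?cmod_ge0.
- move=> h; have t0 := rnorm_ge0 h; apply: (le_trans (cmodD _ _)); rewrite !cmodM.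
  have a1 : cmod (L h) * cmod (g x) <= (c * rnorm h) * d.
    by apply: ler_pM; rewrite ?cmod_ge0.
  have a2 : cmod (f x) * cmod (M h) <= c * (d * rnorm h).
    by apply: ler_pM; rewrite ?cmod_ge0.
  have a3 : 0 <= c * d * rnorm h by exact: mulr_ge0.
  by lra.
- move=> h h1; have t0 := rnorm_ge0 h.
  set t := rnorm h in h1 t0 *.
  set r := f (x + h) - f x - L h; set s := g (x + h) - g x - M h.
  have br : cmod r <= c * t ^+ 2 by exact: f4.
  have bs : cmod s <= d * t ^+ 2 by exact: g4.
  (* Each of these six terms is at most [c d t^2] for [t <= 1]: this is the factor 6. *)
  have -> : f (x + h) * g (x + h) - f x * g x - (L h * g x + f x * M h) =
     L h * M h + f x * s + r * g x + L h * s + r * M h + r * s.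
    by rewrite /r /s; ring.
  have t2 : t ^+ 2 <= t by rewrite expr2 ler_piMr.
  have T0 : 0 <= t ^+ 2 by exact: sqr_ge0.
  have t21 : t ^+ 2 <= 1 by exact: le_trans h1.
  have P (a b : C) (A B : R) : cmod a <= A -> cmod b <= B -> cmod (a * b) <= A * B.
    by move=> ha hb; rewrite cmodM; apply: ler_pM; rewrite ?cmod_ge0.
  have b1 := P _ _ _ _ (f3 h) (g3 h).
  have b2 := P _ _ _ _ f2 bs.
  have b3 := P _ _ _ _ br g2.
  have b4 := P _ _ _ _ (f3 h) bs.
  have b5 := P _ _ _ _ br (g3 h).
  have b6 := P _ _ _ _ br bs.
  rewrite -/t in b1 b4 b5.
  have k1 : c * t * (d * t ^+ 2) <= c * d * t ^+ 2.
    rewrite (_ : _ * _ = c * d * t ^+ 2 * t); last by ring.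
    by rewrite ler_piMr // mulr_ge0.
  have k2 : c * t ^+ 2 * (d * t) <= c * d * t ^+ 2.
    rewrite (_ : _ * _ = c * d * t ^+ 2 * t); last by ring.
    by rewrite ler_piMr // mulr_ge0.
  have k3 : c * t ^+ 2 * (d * t ^+ 2) <= c * d * t ^+ 2.
    rewrite (_ : _ * _ = c * d * t ^+ 2 * t ^+ 2); last by ring.
    by rewrite ler_piMr // mulr_ge0.
  have k4 : c * t * (d * t) = c * d * t ^+ 2 by ring.
  have k5 : c * (d * t ^+ 2) = c * d * t ^+ 2 by ring.
  have k6 : c * t ^+ 2 * d = c * d * t ^+ 2 by ring.
  have e : 6 * (c * d) * t ^+ 2 = 6 * (c * d * t ^+ 2) by ring.
  rewrite e.
  do 5 (apply: (le_trans (cmodD _ _)); rewrite -lerBrDr).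
  by lra.
Qed.

Lemma near_rnorm (x : V) (e : R) : 0 < e -> \forall y \near x, rnorm (x - y) < e.
Proof.
move=> e0; have e0' : 0 < e%:C by rewrite ltcR.
have /cvgrPdist_lt/(_ _ e0') : (fun y : V => y) @ x --> x by exact: cvg_id.
by apply: filterS => y; rewrite rnormE ltcR.
Qed.

Lemma cvg_rnorm (T : Type) (F : set_system T) {FF : Filter F} (f : T -> V) (x : V) :
  (forall e : R, 0 < e -> \forall t \near F, rnorm (x - f t) < e) -> f @ F --> x.
Proof.
move=> h; apply/cvgrPdist_lt => d; rewrite ltcE /= => /andP[/eqP Id d0].
have -> : d = (complex.Re d)%:C by case: d Id d0 => p q /= ->.
by apply: filterS (h _ d0) => t; rewrite rnormE ltcR.
Qed.

(** The remainder [c |h|^2] is at most [e |h|] as soon as [|h| < e / (c + 1)], the [+ 1] covering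
    [c = 0]; the bound on [L] makes the differential continuous. *)
Lemma jet_differentiable f L x c : jet f L x c -> differentiable (f : V -> C^o) x.
Proof.
move=> jf; have c0 := jet_ge0 jf; case: jf => f1 f2 f3 f4.
pose LM := GRing.isLinear.Build C V C^o _ (L : V -> C^o) f1.
pose df : {linear V -> C^o} := HB.pack (L : V -> C^o) LM.
have Lsub y z : L y - L z = L (y - z).
  have e := f1 (-1) z y; rewrite scaleN1r mulN1r in e.
  by rewrite [y - z]addrC e addrC.
have c1 : 0 < c + 1 by rewrite ltr_wpDl.
have cdf : continuous df.
  move=> y; suff : tends (nbhs y) L (L y) by [].
  apply/tendsP => e e0.
  have e1 : 0 < e / (c + 1) by exact: divr_gt0.
  apply: filterS (near_rnorm y e1) => z; rewrite ltr_pdivlMr // => hz.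
  rewrite /= Lsub; apply: (le_lt_trans (f3 _)); apply: le_lt_trans hz.
  by rewrite mulrC; apply: ler_wpM2l; [exact: rnorm_ge0|rewrite lerDl].
have eqo : (f : V -> C^o) \o shift x = cst (f x : C^o) + df +o_ 0 id.
  apply/eqaddoP => e; rewrite ltcE /= => /andP[/eqP Ie e0].
  have ee : e = (complex.Re e)%:C by case: e Ie e0 => a b /= ->.
  have e1 : 0 < Num.min 1 (complex.Re e / (c + 1)) by rewrite lt_min ltr01 divr_gt0.
  apply: filterS (near_rnorm 0 e1) => h; rewrite sub0r.
  have -> : rnorm (- h) = rnorm h by rewrite /rnorm normrN.
  rewrite lt_min ltr_pdivlMr // => /andP[h1 h2].
  rewrite !fctE /= normE ee rnormE -rmorphM /= lecR.
  have := f4 h (ltW h1); rewrite [h + x]addrC opprD addrA => H.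
  apply: (le_trans H); rewrite expr2 mulrA; apply: ler_wpM2r; first exact: rnorm_ge0.
  by have := rnorm_ge0 h; nra.
apply/diff_locallyP; rewrite (diff_unique cdf eqo); split => //.
Qed.

(** The jet conditions are linear in [f], [L] and the constant, so they can be summed term by term.
    Convergence away from [x] is a separate hypothesis because the constants [c n] belong to [x]
    only. *)
Lemma jet_series (f L : nat -> V -> C) (c : nat -> R) x (S : R) :
  (forall y, exists T, dominated (f ^~ y) T) ->
  (forall n, jet (f n) (L n) x (c n)) -> (forall n, \sum_(k < n) c k <= S) ->
  jet (fun y => csum (f ^~ y)) (fun h => csum (L ^~ h)) x S.
Proof.
move=> df jf cS.
have dL h : dominated (L ^~ h) (S * rnorm h).
  exists (fun n => c n * rnorm h) => n; first by case: (jf n).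
  by rewrite -big_distrl /=; apply: ler_wpM2r; [exact: rnorm_ge0|exact: cS].
have dfx : dominated (f ^~ x) S by exists c => // n; case: (jf n).
split.
- move=> a h k; rewrite -(csumZ a (dL h)) -(csumD (dominatedZ a (dL h)) (dL k)).
  by congr csum; apply/funext => n; case: (jf n).
- exact: csum_le.
- by move=> h; exact: csum_le.
move=> h h1; have [T dT] := df (x + h).
have dN (u : nat -> C) (U : R) : dominated u U -> dominated (fun n => - u n) (cmod (-1) * U).
  by move=> du; under [X in dominated X]eq_fun do rewrite -mulN1r; exact: dominatedZ.
have eN (u : nat -> C) (U : R) : dominated u U -> - csum u = csum (fun n => - u n).
  move=> du; rewrite -mulN1r -(csumZ (-1) du); congr csum.
  by apply/funext => n; rewrite mulN1r.
rewrite (eN _ _ dfx) (eN _ _ (dL h)) -(csumD dT (dN _ _ dfx)).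
rewrite -(csumD (dominatedD dT (dN _ _ dfx)) (dN _ _ (dL h))).
apply: csum_le; exists (fun n => c n * rnorm h ^+ 2) => n; first by case: (jf n) => _ _ _; apply.
by rewrite -big_distrl /=; apply: ler_wpM2r; [exact: sqr_ge0|exact: cS].
Qed.

End Jets.

(** * The power series of the exponential *)

Section ExponentialSeries.
Variable R : realType.
Local Notation C := R[i].

Lemma rnormC (h : C^o) : rnorm h = cmod h. Proof. by []. Qed.

Lemma jet_id (w : C) : jet (V := C^o) (fun y : C => y) (fun h : C => h) w (cmod w + 1).
Proof. by apply: jet_lin => // a h k. Qed.

(** Each further factor multiplies the constant by [6 (|w| + 1)]: geometric growth, which [1 / n!]
    absorbs. At [n = 0] the differential is 0 whatever [n.-1] means. *)
Lemma jetX (w : C) n : jet (V := C^o) (fun y : C => y ^+ n) (fun h : C => n%:R * w ^+ n.-1 * h) w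
  ((6 * (cmod w + 1)) ^+ n).
Proof.
elim: n => [|n IH].
  have := jet_cst (V := C^o) (1 : C) w; rewrite cmod1 expr0.
  by congr (jet _ _ _ _); apply/funext => h; rewrite ?mulr0n !mul0r.
have := jetM (jet_id w) IH; rewrite mulrA -exprS.
congr (jet _ _ _ _); first by apply/funext => y; rewrite exprS.
apply/funext => h /=; case: n {IH} => [|n]; first by rewrite expr0; ring.
by rewrite /= exprS -[n.+2%:R]natr1; ring.
Qed.

Definition expS (w : C) : C := csum (fun n => w ^+ n / n`!%:R).

Lemma cmod_fact n : cmod (n`!%:R^-1 : C) = n`!%:R^-1.
Proof. by rewrite cmodV -(rmorph_nat (real_complex R)) cmodR normr_nat. Qed.

Lemma dominated_expS (w : C) : dominated (fun n => w ^+ n / n`!%:R) (1 * expR (cmod w)).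
Proof.
apply: dominated_exp; rewrite ?ler01 ?cmod_ge0 // => n.
by rewrite mul1r cmodM cmodX cmod_fact.
Qed.

Lemma jet_expS (w : C) :
  exists c, jet (V := C^o) expS (fun h : C => expS w * h) w c.
Proof.
set q := 6 * (cmod w + 1).
have q0 : 0 <= q by rewrite mulr_ge0 // addr_ge0 ?cmod_ge0.
have jn n : jet (V := C^o) (fun y : C => y ^+ n / n`!%:R)
    (fun h : C => (n%:R * w ^+ n.-1 / n`!%:R) * h) w (6 * (q ^+ n / n`!%:R)).
  have := jetM (jetX w n) (jet_cst (V := C^o) (n`!%:R^-1 : C) w).
  rewrite cmod_fact; congr (jet _ _ _ _).
  by apply/funext => h; ring.
have cS n : \sum_(k < n) 6 * (q ^+ k / k`!%:R) <= 6 * expR q.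
  by rewrite -big_distrr /=; apply: ler_wpM2l => //; exact: sum_expR_le.
have df y : exists T, dominated (fun n => y ^+ n / n`!%:R : C) T.
  by exists (1 * expR (cmod y)); exact: dominated_expS.
exists (6 * expR q); have := @jet_series R C^o (fun n (y : C) => y ^+ n / n`!%:R)
  (fun n (h : C) => (n%:R * w ^+ n.-1 / n`!%:R) * h) _ w _ df jn cS.
congr (jet _ _ _ _); apply/funext => h /=.
have dL : tends \oo (fun n => \sum_(k < n) (w ^+ k / k`!%:R) * h) (expS w * h).
  under [X in tends _ X]eq_fun do rewrite -big_distrl /=.
  by apply: tendsM; [exact: csumP (dominated_expS w)|exact: tends_cst].
apply: csum_unique; rewrite /tends.
(* The differentiated series has a zero term at [k = 0]; shifted by one, it is the exponential
   series times [h]. *)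
rewrite -(cvg_shiftS (fun n => \sum_(k < n) (k%:R * w ^+ k.-1 / k`!%:R) * h : C^o)).
apply: (tends_eq _ dL); apply: nearW => n.
rewrite big_ord_recl /= !mul0r add0r; apply: eq_bigr => k _.
rewrite /bump /= add1n factS natrM; congr (_ * _).
have f0 : (k`!)%:R != 0 :> C by rewrite pnatr_eq0 -lt0n fact_gt0.
have k0 : k.+1%:R != 0 :> C by rewrite pnatr_eq0.
by move: (k.+1%:R : C) (k`!%:R : C) k0 f0 => a b a0 b0; field; rewrite a0 b0.
Qed.

Lemma cderiv_expS (z : C) (t : R) :
  cderiv (fun t => expS (t%:C * z)) t (expS (t%:C * z) * z).
Proof.
apply: cderivP; have [c jc] := jet_expS (t%:C * z).
have c0 := jet_ge0 jc; have [_ _ _ j] := jc.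
have z0 := cmod_ge0 z.
apply/tendsP => e e0.
(* The second bound keeps [|h z| <= 1], the range of the jet; the first makes the quotient's error
   [c |h| |z|^2] smaller than [e]. *)
pose d := Num.min (e / (c * cmod z ^+ 2 + 1)) (cmod z + 1)^-1.
have p1 : 0 < c * cmod z ^+ 2 + 1 by rewrite ltr_wpDl // mulr_ge0 // sqr_ge0.
have d0 : 0 < d by rewrite lt_min divr_gt0 //= invr_gt0 ltr_wpDl.
near=> h.
have h0 : h != 0 by near: h; exact: nbhs_dnbhs_neq.
have hd : `|h| < d by near: h; exact: dnbhs0_lt.
move: hd; rewrite lt_min => /andP[hd1 hd2].
have hn : cmod (h%:C * z) <= 1.
  rewrite cmodM cmodR; have : `|h| * (cmod z + 1) <= 1.
    by rewrite -ler_pdivlMr ?ltr_wpDl // div1r ltW.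
  by have := normr_ge0 h; lra.
have := j (h%:C * z : C^o); rewrite rnormC => /(_ hn).
rewrite -mulrDl -rmorphD /= => H.
have hC : h%:C != 0 :> C by rewrite -(inj_eq (@complexI R)) in h0.
have -> : expS (t%:C * z) * z - (h^-1)%:C * (expS ((t + h)%:C * z) - expS (t%:C * z)) =
  - (h%:C)^-1 * (expS ((t + h)%:C * z) - expS (t%:C * z) - expS (t%:C * z) * (h%:C * z)).
  have key (A B k : C) : k != 0 ->
      A * z - k^-1 * (B - A) = - k^-1 * (B - A - A * (k * z)).
    by move=> k0; field.
  have -> : (h^-1)%:C = (h%:C)^-1 :> C by exact: fmorphV.
  exact: key.
rewrite cmodM cmodN cmodV cmodR mulrC ltr_pdivrMr ?normr_gt0 //.
apply: (le_lt_trans H); rewrite cmodM cmodR exprMn.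
have h1 : 0 < `|h| by rewrite normr_gt0.
move: hd1; rewrite ltr_pdivlMr // => hd1.
by nra.
Unshelve. all: by end_near. Qed.

Lemma expS0 : expS 0 = 1.
Proof.
have h : tends \oo (fun=> 1) (1 : C) by exact: tends_cst.
apply: csum_unique; apply: tends_eq h.
exists 1%N => // n /= n0; case: n n0 => // n _.
rewrite big_ord_recl /= expr0 fact0 divr1 big1 ?addr0 // => k _.
by rewrite /bump /= add1n exprS !mul0r.
Qed.

(** The product [expS (tz) e^(-tz)] has zero derivative in [t] and equals 1 at [t = 0]. *)
Lemma expSE (z : C) : expS z = expC z.
Proof.
pose u t : C := expS (t%:C * z) * expC (t%:C * - z).
have du t : cderiv u t 0.
  apply: cderiv_eq.
    by apply: cderivM; [exact: cderiv_expS|exact: cderiv_expC_scale].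
  by rewrite /=; ring.
have : u 1 = u 0.
  apply: cderiv0_cst => s _ //.
  by apply: cvg_trans (cderiv_tends (du s)); apply: cvg_app; exact: cvg_within.
rewrite /u !mul1r !mul0r expS0 expC0 mulr1 expCN => e.
by rewrite -[LHS]mulr1 -(mulVf (expC_neq0 z)) mulrA e mul1r.
Qed.

End ExponentialSeries.

(** * Newton factorization of the exponential matrix *)

Section BesselEntire.
Variable R : realType.
Local Notation C := R[i].

(* Entry (0, i) of the n-th power of the bidiagonal matrix with diagonal alpha
   and superdiagonal 1, i.e. the divided difference of x^n at alpha_0 .. alpha_i. *)
Fixpoint divdiff (alpha : nat -> C) (n i : nat) : C :=
  if n is n'.+1 then
    alpha i * divdiff alpha n' i + (if i is i'.+1 then divdiff alpha n' i' else 0)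
  else (i == 0%N)%:R.

(** With [N_k] the Newton polynomials, [X N_k = alpha_k N_k + N_(k+1)] mirrors the recurrence of
    [divdiff]. Truncation at [M] leaves one term in [N_M], which disappears when [X] is among the
    nodes. *)
Lemma newton_step (alpha : nat -> C) (X : C) n M :
  \sum_(k < M) divdiff alpha n.+1 k * \prod_(m < k) (X - alpha m) =
  X * (\sum_(k < M) divdiff alpha n k * \prod_(m < k) (X - alpha m)) -
  (if M is M'.+1 then divdiff alpha n M' else 0) * \prod_(m < M) (X - alpha m).
Proof.
elim: M => [|M IH]; first by rewrite !big_ord0 mulr0 mul0r subr0.
rewrite !big_ord_recr IH /=; move: (\sum_(_ < _) _) (\prod_(_ < _) _) => S P.
ring.
Qed.

Lemma newton_expansion (alpha : nat -> C) (X : C) n N :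
  \prod_(m < N) (X - alpha m) = 0 ->
  \sum_(k < N) divdiff alpha n k * \prod_(m < k) (X - alpha m) = X ^+ n.
Proof.
move=> v0; elim: n => [|n IH].
  case: N v0 => [|N _]; first by rewrite big_ord0 => /eqP; rewrite oner_eq0.
  rewrite big_ord_recl /= big_ord0 mulr1 big1 ?addr0 // => k _.
  by rewrite /bump /= mul0r.
by rewrite newton_step v0 mulr0 subr0 IH exprS.
Qed.

Section HasJet.
Variable V : normedModType C.
Implicit Types (f g : V -> C) (x : V).

Definition has_jet f x : Prop := exists L c, jet f L x c.

Lemma has_jet_cst (k : C) x : has_jet (fun=> k) x.
Proof. by exists (fun=> 0), (cmod k); exact: jet_cst. Qed.

Lemma has_jetD f g x : has_jet f x -> has_jet g x -> has_jet (fun y => f y + g y) x.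
Proof. by move=> [L [c h]] [M [d k]]; eexists; eexists; exact: jetD h k. Qed.

Lemma has_jetM f g x : has_jet f x -> has_jet g x -> has_jet (fun y => f y * g y) x.
Proof. by move=> [L [c h]] [M [d k]]; eexists; eexists; exact: jetM h k. Qed.

Lemma has_jet_sum (I : Type) (r : seq I) (F : I -> V -> C) x :
  (forall i, has_jet (F i) x) -> has_jet (fun y => \sum_(i <- r) F i y) x.
Proof.
move=> h; elim: r => [|i r IH].
  by under [X in has_jet X]eq_fun do rewrite big_nil; exact: has_jet_cst.
by under [X in has_jet X]eq_fun do rewrite big_cons; exact: has_jetD.
Qed.

Lemma has_jet_prod (I : Type) (r : seq I) (F : I -> V -> C) x :
  (forall i, has_jet (F i) x) -> has_jet (fun y => \prod_(i <- r) F i y) x.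
Proof.
move=> h; elim: r => [|i r IH].
  by under [X in has_jet X]eq_fun do rewrite big_nil; exact: has_jet_cst.
by under [X in has_jet X]eq_fun do rewrite big_cons; exact: has_jetM.
Qed.

Lemma has_jet_det n (F : 'I_n -> 'I_n -> V -> C) x :
  (forall i j, has_jet (F i j) x) ->
  has_jet (fun y => \det (\matrix_(i, j) F i j y)) x.
Proof.
move=> h; rewrite /determinant.
apply: has_jet_sum => s; apply: has_jetM; first exact: has_jet_cst.
under [X in has_jet X]eq_fun do under eq_bigr do rewrite mxE.
by apply: has_jet_prod => i.
Qed.

(** Both terms of the recurrence contribute, turning a constant [K] into [6 c K + K]. The bound does
    not depend on [i], which lets the induction use it at [i] and at its predecessor. *)
Lemma jet_divdiff (alpha : nat -> V -> C) x (c : R) : 0 <= c ->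
  (forall i, exists L, jet (alpha i) L x c) ->
  forall n i, exists L, jet (fun y => divdiff (alpha ^~ y) n i) L x ((6 * c + 1) ^+ n).
Proof.
move=> c0 ja n; elim: n => [|n IH] i.
  exists (fun=> 0); apply: (jet_le (c := cmod ((i == 0%N)%:R : C))); last exact: jet_cst.
  by case: eqP => _; rewrite ?cmod1 ?cmod0 expr0.
have [L hL] := ja i; have [M hM] := IH i.
have e : (6 * c + 1) ^+ n.+1 = 6 * (c * (6 * c + 1) ^+ n) + (6 * c + 1) ^+ n.
  by rewrite exprS; ring.
case: i L hL M hM => [|i] L hL M hM.
  have h0 : jet (fun=> 0) (fun=> 0) x ((6 * c + 1) ^+ n).
    apply: (jet_le (c := cmod (0 : C))); last exact: jet_cst.
    by rewrite cmod0 exprn_ge0 // addr_ge0 // mulr_ge0.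
  by eexists; rewrite e; exact: jetD (jetM hL hM) h0.
have [K hK] := IH i.
by eexists; rewrite e; exact: jetD (jetM hL hM) hK.
Qed.

End HasJet.

Section Kernel.
Variable N : nat.
Local Notation V := ('rV[C]_N * 'rV[C]_N)%type.

(** Extended by 0 to all of [nat], the index type of the nodes in [divdiff]. *)
Definition coord (a : 'rV[C]_N) (i : nat) : C :=
  if insub i is Some j then a 0 j else 0.

Lemma coordE (a : 'rV[C]_N) (i : 'I_N) : coord a i = a 0 i.
Proof. by rewrite /coord valK. Qed.

Lemma coord_lin i (k : C) (u v : 'rV[C]_N) : coord (k *: u + v) i = k * coord u i + coord v i.
Proof. by rewrite /coord; case: insub => [j|]; rewrite ?mxE // mulr0 addr0. Qed.

Lemma coord_le (a : 'rV[C]_N) i : `|coord a i| <= `|a|.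
Proof.
rewrite /coord; case: insubP => [j _ _|_]; last by rewrite normr0.
rewrite -[`|a|]/(mx_norm a) mx_normE -[leLHS]nngE num_le.
exact: (le_bigmax _ (fun i : 'I_1 * 'I_N => `|a i.1 i.2|%:nng) (0, j)).
Qed.

Lemma norm_pair_le (y : V) : `|y.1| <= `|y| /\ `|y.2| <= `|y|.
Proof.
rewrite [X in _ <= X /\ _]prod_normE [X in _ /\ _ <= X]prod_normE.
have c : (`|y.1| : C) >=< `|y.2| by apply: real_comparable; exact: normr_real.
by rewrite !comparable_le_max // !lexx orbT.
Qed.

(** The degree [n] part of the divided difference of [e^(xy)] in both variables, at the first
    [k + 1] entries of [y.1] and the first [l + 1] of [y.2]. It is polynomial in the nodes, which
    may coincide. *)
Definition kernel_term (k l n : nat) (y : V) : C :=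
  divdiff (coord y.1) n k * divdiff (coord y.2) n l * n`!%:R^-1.

Definition kernel (k l : nat) (y : V) : C := csum (fun n => kernel_term k l n y).

Lemma jet_coord1 (x : V) i : exists L,
  jet (fun y : V => coord y.1 i) L x (rnorm x + 1).
Proof.
exists (fun y : V => coord y.1 i).
have b (y : V) : cmod (coord y.1 i) <= rnorm y.
  rewrite -lecR -normE -rnormE; apply: le_trans (coord_le _ _) _.
  by have [] := norm_pair_le y.
apply: jet_le (jet_lin _ _ _) => //; first by rewrite lerD2r.
by move=> a h k; exact: coord_lin.
Qed.

Lemma jet_coord2 (x : V) i : exists L,
  jet (fun y : V => coord y.2 i) L x (rnorm x + 1).
Proof.
exists (fun y : V => coord y.2 i).
have b (y : V) : cmod (coord y.2 i) <= rnorm y.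
  rewrite -lecR -normE -rnormE; apply: le_trans (coord_le _ _) _.
  by have [] := norm_pair_le y.
apply: jet_le (jet_lin _ _ _) => //; first by rewrite lerD2r.
by move=> a h k; exact: coord_lin.
Qed.

Lemma jet_kernel_term (x : V) k l n : let r := 6 * (rnorm x + 1) + 1 in
  exists L, jet (kernel_term k l n) L x (36 * ((r ^+ 2) ^+ n / n`!%:R)).
Proof.
move=> r; have c0 : 0 <= rnorm x + 1 by rewrite addr_ge0 ?rnorm_ge0.
have [L hL] := @jet_divdiff V (fun i y => coord y.1 i) x _ c0 (jet_coord1 x) n k.
have [M hM] := @jet_divdiff V (fun i y => coord y.2 i) x _ c0 (jet_coord2 x) n l.
(* Two products give [6 * 6], and the two divided differences [r^n] each. *)
eexists; rewrite (_ : 36 * _ = 6 * (6 * (r ^+ n * r ^+ n) * cmod (n`!%:R^-1 : C))).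
  exact: jetM (jetM hL hM) (jet_cst _ _).
by rewrite cmod_fact -exprM mulnC exprM expr2; ring.
Qed.

Lemma sum_kernel_bound (r : R) n :
  \sum_(k < n) 36 * ((r ^+ 2) ^+ k / k`!%:R) <= 36 * expR (r ^+ 2).
Proof.
rewrite -big_distrr /=; apply: ler_wpM2l => //.
by apply: sum_expR_le; exact: sqr_ge0.
Qed.

Lemma dominated_kernel k l (x : V) : exists S, dominated (fun n => kernel_term k l n x) S.
Proof.
exists (36 * expR ((6 * (rnorm x + 1) + 1) ^+ 2)).
exists (fun n => 36 * (((6 * (rnorm x + 1) + 1) ^+ 2) ^+ n / n`!%:R)) => n.
  by have [L []] := jet_kernel_term x k l n.
exact: sum_kernel_bound.
Qed.

Lemma has_jet_kernel k l (x : V) : has_jet (kernel k l) x.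
Proof.
have /choice [L hL] := jet_kernel_term x k l.
exists (fun h => csum (L ^~ h)), (36 * expR ((6 * (rnorm x + 1) + 1) ^+ 2)).
apply: jet_series hL _ => [y|n]; first exact: dominated_kernel.
exact: sum_kernel_bound.
Qed.

Definition newton_mx (a : 'rV[C]_N) : 'M[C]_N :=
  \matrix_(i, k) \prod_(m < k) (a 0 i - coord a m).

Lemma prod_coord0 (a : 'rV[C]_N) (i : 'I_N) : \prod_(m < N) (a 0 i - coord a m) = 0.
Proof. by rewrite (bigD1 i) //= coordE subrr mul0r. Qed.

(** The powers of [a_i] and [b_j] are expanded exactly in Newton polynomials at their own nodes,
    since the full node product vanishes there; the finite sums then leave the series. *)
Lemma exp_kernel (a b : 'rV[C]_N) :
  \matrix_(i, j) expC (a 0 i * b 0 j) =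
  newton_mx a *m (\matrix_(k, l) kernel k l (a, b)) *m (newton_mx b)^T.
Proof.
apply/matrixP => i j; rewrite !mxE -expSE /expS.
have e n : (a 0 i * b 0 j) ^+ n / n`!%:R = \sum_(l < N) \sum_(k < N)
    (newton_mx a i k * newton_mx b j l) * kernel_term k l n (a, b).
  rewrite exprMn -(newton_expansion n (prod_coord0 a i)).
  rewrite -(newton_expansion n (prod_coord0 b j)) mulrAC big_distrr /=.
  apply: eq_bigr => l _; rewrite !big_distrl /=; apply: eq_bigr => k _.
  by rewrite !mxE /kernel_term /=; ring.
under [X in csum X]eq_fun do rewrite e.
have /choice [S hS] : forall kl : 'I_N * 'I_N, exists S,
    dominated (fun n => kernel_term kl.1 kl.2 n (a, b)) S.
  by move=> kl; exact: dominated_kernel.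
under [X in csum X]eq_fun do rewrite pair_big /=.
rewrite (@csum_sum _ _ _ (fun p n => (newton_mx a i p.2 * newton_mx b j p.1) *
     kernel_term p.2 p.1 n (a, b))
  (fun p => cmod (newton_mx a i p.2 * newton_mx b j p.1) * S (p.2, p.1))); last first.
  by move=> [l k]; exact: dominatedZ (hS (k, l)).
rewrite -(pair_big xpredT xpredT (fun l k => csum (fun n => newton_mx a i k * newton_mx b j l *
     kernel_term k l n (a, b)))) /=.
apply: eq_bigr => l _; rewrite [(newton_mx a *m _) i l]mxE big_distrl /=; apply: eq_bigr => k _.
rewrite (csumZ _ (hS (k, l))) !mxE.
by rewrite mulrAC.
Qed.

(** Entry [(i, k)] with [i < k] contains the factor [a_i - a_i], so the matrix is triangular. The
    sign stays an unevaluated product because it only occurs squared in [entire_Bessel_formula]. *)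
Lemma det_newton_mx (a : 'rV[C]_N) : \det (newton_mx a) =
  (\prod_(i < N) \prod_(j < N | (i < j)%N) (-1)) * Vandermonde_prod a.
Proof.
rewrite det_trig; last first.
  apply/is_trig_mxP => i j ij; rewrite mxE (bigD1 (Ordinal ij)) //=.
  by rewrite coordE subrr mul0r.
rewrite /Vandermonde_prod -big_split /=.
transitivity (\prod_(i < N) \prod_(m < N | (m < i)%N) (a 0 i - a 0 m)).
  apply: eq_bigr => i _; rewrite mxE.
  rewrite (big_ord_widen N (fun m => a 0 i - coord a m)) ?(ltnW (ltn_ord i)) //.
  by apply: eq_bigr => m _; rewrite coordE.
rewrite (exchange_big_dep xpredT) //=; apply: eq_bigr => m _.
by rewrite -big_split /=; apply: eq_bigr => i _; rewrite mulN1r opprB.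
Qed.

Lemma Vandermonde_neq0 (a : 'rV[C]_N) : injective (a 0) -> Vandermonde_prod a != 0.
Proof.
move=> ai; apply/prodf_neq0 => i _; apply/prodf_neq0 => j ij.
by rewrite subr_eq0 (inj_eq ai) -val_eqE /= neq_ltn ij.
Qed.

Definition entire_Bessel (y : V) : C :=
  Vandermonde_prod (rho R N) * \det (\matrix_(k < N, l < N) kernel k l y).

Lemma entire_Bessel_formula (a b : 'rV[C]_N) : injective (a 0) -> injective (b 0) ->
  entire_Bessel (a, b) = Bessel_formula a b.
Proof.
move=> /Vandermonde_neq0 a0 /Vandermonde_neq0 b0.
rewrite /Bessel_formula exp_kernel !det_mulmx det_tr !det_newton_mx /entire_Bessel.
set s := \prod_(i < N) _; have ss : s * s = 1.
  rewrite /s -big_split /= big1 // => i _; rewrite -big_split /= big1 // => j _.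
  by rewrite mulrNN mulr1.
move: (Vandermonde_prod a) (Vandermonde_prod b) (Vandermonde_prod (rho R N)) (\det _) a0 b0.
move=> va vb vr d a0 b0.
transitivity (s * s * (vr * d)); first by rewrite ss mul1r.
by field; rewrite a0 b0.
Qed.

Lemma is_Bessel_entire : is_Bessel (entire_Bessel : V -> C^o).
Proof.
split; last exact: entire_Bessel_formula.
move=> x; have [L [c h]] : has_jet entire_Bessel x.
  apply: has_jetM; first exact: has_jet_cst.
  by apply: has_jet_det => k l; exact: has_jet_kernel.
exact: jet_differentiable h.
Qed.

(** Exhibiting [entire_Bessel] guarantees that the choice in [Bessel] returns a member of the set
    and not the default zero function. *)
Lemma Bessel_is_Bessel : is_Bessel (fun y : V => Bessel y.1 y.2 : C^o).
Proof.
have -> : (fun y : V => Bessel y.1 y.2 : C^o) =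
    xget (fun=> 0) [set B | @is_Bessel R N B].
  by apply/funext => -[a b].
by apply: (xgetPex (fun=> 0)); exists entire_Bessel; exact: is_Bessel_entire.
Qed.

End Kernel.

End BesselEntire.

(** * The quotient of Bessel functions for distinct nodes *)

Section DistinctFormula.
Variable R : realType.
Local Notation C := R[i].

Lemma mu_first n (a : C) (b : 'I_n.+1) : mu a b 0 ord0 = a.
Proof. by rewrite mxE. Qed.

Lemma rev_iota0_filter N b : (b < N)%N ->
  [seq c <- rev (iota 0 N) | c != b] = rev (iota b.+1 (N - b.+1)) ++ rev (iota 0 b).
Proof.
move=> bN; rewrite {1}(_ : N = b + (1 + (N - b.+1)))%N; last by lia.
rewrite !iotaD add0n addn1 /= !rev_cat rev_cons filter_cat /= filter_rcons eqxx /=.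
congr (_ ++ _); apply/all_filterP/allP => k; rewrite mem_rev mem_iota; lia.
Qed.

(** In [rho] the value [b] stands at position [rev_ord b], which is the one skipped by [lift]. *)
Lemma mu_rest n (a : C) (b : 'I_n.+1) (k : 'I_n) :
  mu a b 0 (lift ord0 k) = rho R n.+1 0 (lift (rev_ord b) k).
Proof.
rewrite !mxE rev_iota0_filter // [nth _ _ _]/=; have kn := ltn_ord k; have bn := ltn_ord b.
rewrite (nth_map 0%N) ?size_cat ?size_rev ?size_iota /bump; last by lia.
congr (_%:R); rewrite nth_cat size_rev size_iota /=.
case: ltnP => h.
  by rewrite nth_rev ?size_iota // nth_iota /bump; lia.
by rewrite nth_rev ?size_iota ?nth_iota /bump; lia.
Qed.

Lemma rho_inj N : injective (rho R N 0).
Proof.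
move=> i j; rewrite !mxE => /eqP; rewrite eqr_nat => /eqP h; apply: val_inj => /=.
by have := ltn_ord i; have := ltn_ord j; lia.
Qed.

Lemma rho_rev N (k : 'I_N) : rho R N 0 (rev_ord k) = k%:R.
Proof. by rewrite mxE /=; congr (_%:R); have := ltn_ord k; lia. Qed.

Lemma mu_inj n (a : C) (b : 'I_n.+1) : (forall k : 'I_n.+1, a <> (k : nat)%:R) ->
  injective (mu a b 0).
Proof.
move=> ha i j.
have ne k : mu a b 0 (lift ord0 k) <> a.
  by rewrite mu_rest -[lift _ k]rev_ordK rho_rev => e; apply: (ha (rev_ord (lift (rev_ord b) k))).
case: (unliftP ord0 i) => [k ->|->]; case: (unliftP ord0 j) => [l ->|->]; rewrite ?mu_first //.
- by rewrite !mu_rest => /rho_inj /lift_inj ->.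
- by move/ne.
- by move=> /esym /ne.
Qed.

Lemma det_powers N (a : 'rV[C]_N) : \det (\matrix_(i, j) a 0 i ^+ j) =
  (\prod_(i < N) \prod_(j < N | (i < j)%N) (-1)) * Vandermonde_prod a.
Proof.
have -> : \matrix_(i < N, j < N) a 0 i ^+ j = (Vandermonde N a)^T.
  by apply/matrixP => i j; rewrite !mxE.
rewrite det_tr det_Vandermonde /Vandermonde_prod -big_split /=.
apply: eq_bigr => i _; rewrite -big_split /=; apply: eq_bigr => j _.
by rewrite mulN1r opprB.
Qed.

Lemma prodN1_neq0 N : \prod_(i < N) \prod_(j < N | (i < j)%N) (-1) != 0 :> C.
Proof.
by apply/prodf_neq0 => i _; apply/prodf_neq0 => j _; rewrite oppr_eq0 oner_eq0.
Qed.

Definition lagrange_basis N (a : C) (b : 'I_N) : C :=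
  (lagpoly (rho R N 0) (rev_ord b)).[a] / (lagpoly (rho R N 0) (rev_ord b)).[b%:R].

(** Bringing the row of [a] from position [rev_ord b] to the front costs the sign. The same sign
    appears in [det_exp_mu], so it drops out of [Bessel_mu]. *)
Lemma Vandermonde_mu n (a : C) (b : 'I_n.+1) :
  Vandermonde_prod (mu a b) =
  (-1) ^+ rev_ord b * lagrange_basis a b * Vandermonde_prod (rho R n.+1).
Proof.
apply: (mulfI (prodN1_neq0 n.+1)); rewrite -det_powers mulrCA -det_powers.
pose M := \matrix_(i < n.+1, j < n.+1)
  (if i == rev_ord b then a else rho R n.+1 0 i) ^+ j.
rewrite (@det_cycle_row _ _ _ M (rev_ord b)).
- rewrite -mulrA; congr (_ * _).
  rewrite (@det_powers_replace _ _ (rho R n.+1 0) a M (rev_ord b) (@rho_inj _)).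
  + by rewrite rho_rev.
  + by move=> i j ip; rewrite mxE (negbTE ip).
  + by move=> j; rewrite mxE eqxx.
- by move=> j; rewrite !mxE eqxx.
- move=> k j; rewrite [LHS]mxE [RHS]mxE mu_rest.
  by rewrite eq_sym (negbTE (neq_lift _ _)).
Qed.

Definition vandermonde_mx N (x : 'I_N -> C) : 'M[C]_N :=
  \matrix_(i, j) x j ^+ (N - i.+1).

Lemma exp_rho N (l : 'rV[C]_N) :
  \matrix_(i, j) expC (rho R N 0 i * l 0 j) = vandermonde_mx (fun j => expC (l 0 j)).
Proof. by apply/matrixP => i j; rewrite !mxE expCMn. Qed.

(** For distinct nodes, the coefficient of [X^b] in the polynomial of degree below [N] with value
    [y j] at [x j]. *)
Definition lagrange_coef N (x y : 'I_N -> C) (b : nat) : C :=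
  \sum_j y j / (lagpoly x j).[x j] * (lagpoly x j)`_b.

Lemma det_exp_mu n (a : C) (b : 'I_n.+1) (l : 'rV[C]_n.+1) :
  injective (fun j => expC (l 0 j)) ->
  \det (\matrix_(i, j) expC (mu a b 0 i * l 0 j)) =
  (-1) ^+ rev_ord b * (lagrange_coef (fun j => expC (l 0 j)) (fun j => expC (a * l 0 j)) b *
    \det (vandermonde_mx (fun j => expC (l 0 j)))).
Proof.
move=> xi; pose M := \matrix_(i < n.+1, j < n.+1)
  (if i == rev_ord b then expC (a * l 0 j) else expC (l 0 j) ^+ (n.+1 - i.+1)).
rewrite (@det_cycle_row _ _ _ M (rev_ord b)).
- congr (_ * _).
  rewrite (@det_interp _ _ (fun j => expC (l 0 j)) (fun j => expC (a * l 0 j)) M (rev_ord b) xi).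
  + congr (_ * _); apply: eq_bigr => j _; congr (_ * _`_ _).
    (* Row [rev_ord b] carries the exponent [n.+1 - (rev_ord b).+1], that is [b]. *)
    by rewrite /=; have := ltn_ord b; lia.
  + by move=> i j ip; rewrite mxE (negbTE ip).
  + by move=> j; rewrite mxE eqxx.
- by move=> j; rewrite !mxE eqxx.
- move=> k j; rewrite [LHS]mxE [RHS]mxE mu_rest eq_sym (negbTE (neq_lift _ _)).
  by rewrite mxE expCMn.
Qed.

Lemma Bessel_distinct N (u v : 'rV[C]_N) : injective (u 0) -> injective (v 0) ->
  Bessel u v = Bessel_formula u v.
Proof. by move=> ui vi; have [_ /(_ u v ui vi)] := Bessel_is_Bessel R N. Qed.

Lemma Bessel_rho N (l : 'rV[C]_N) : injective (l 0) ->
  Bessel (rho R N) l = \det (vandermonde_mx (fun j => expC (l 0 j))) / Vandermonde_prod l.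
Proof.
move=> li; rewrite (Bessel_distinct (@rho_inj _) li) /Bessel_formula exp_rho.
have r0 := Vandermonde_neq0 (@rho_inj N).
by rewrite invfM mulrACA divff // mul1r.
Qed.

Lemma lagrange_basis_neq0 N (a : C) (b : 'I_N) : (forall k : 'I_N, a <> (k : nat)%:R) ->
  lagrange_basis a b != 0.
Proof.
move=> ha; rewrite /lagrange_basis -(rho_rev b) mulf_neq0 ?invr_neq0 ?lagpoly_neq0 //;
  try exact: rho_inj.
rewrite horner_lagpoly; apply/prodf_neq0 => i _.
by rewrite subr_eq0 -(rev_ordK i) rho_rev; apply/eqP; exact: ha.
Qed.

Lemma Bessel_mu N (a : C) (b : 'I_N) (l : 'rV[C]_N) :
  (forall k : 'I_N, a <> (k : nat)%:R) ->
  injective (l 0) -> injective (fun j => expC (l 0 j)) ->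
  Bessel (mu a b) l =
  lagrange_coef (fun j => expC (l 0 j)) (fun j => expC (a * l 0 j)) b / lagrange_basis a b *
  Bessel (rho R N) l.
Proof.
case: N b l => [|n] b l ha li xi; first by case: b.
rewrite (Bessel_rho li) (Bessel_distinct (mu_inj ha) li) /Bessel_formula det_exp_mu //.
rewrite Vandermonde_mu.
have r0 := Vandermonde_neq0 (@rho_inj n.+1).
have l0 := Vandermonde_neq0 li.
have b0 := lagrange_basis_neq0 b ha.
have s0 : (-1) ^+ rev_ord b != 0 :> C by rewrite signr_eq0.
move: (lagrange_coef _ _ _) (\det _) (Vandermonde_prod l) (Vandermonde_prod (rho R n.+1))
  (lagrange_basis a b) ((-1) ^+ _) r0 l0 b0 s0 => c d vl vr lb s r0 l0 b0 s0.
by field; rewrite r0 l0 b0 s0.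
Qed.

Lemma prod_range N b (f : nat -> C) : (b < N)%N ->
  \prod_(k < N | k != b :> nat) f k =
  \prod_(k < b) f k * \prod_(k < N - b.+1) f (k + b.+1)%N.
Proof.
move=> bN; rewrite -(big_mkord (fun k => k != b) f).
rewrite (@big_cat_nat _ _ _ b) //=; last exact: ltnW.
rewrite [X in _ * X]big_ltn_cond // eqxx /= big_mkord; congr (_ * _).
  by apply: eq_bigl => k; rewrite neq_ltn ltn_ord.
rewrite -{1}[b.+1]add0n big_addn big_mkord; apply: eq_bigl => k.
by rewrite gtn_eqF // ltn_addl.
Qed.

Lemma lagpoly_rho N (a : C) (b : 'I_N) :
  (lagpoly (rho R N 0) (rev_ord b)).[a] = \prod_(k < N | k != b :> nat) (a - k%:R).
Proof.
rewrite horner_lagpoly (reindex_inj rev_ord_inj) /=.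
apply: eq_big => k; first by rewrite (inj_eq rev_ord_inj).
by rewrite rho_rev.
Qed.

(** The nodes below [b] contribute [b!], those above it the sign and the other factorial. *)
Lemma lagpoly_rho_node N (b : 'I_N) : (lagpoly (rho R N 0) (rev_ord b)).[b%:R] =
  (-1) ^+ (N - b.+1) * (b`! * (N - b.+1)`!)%:R :> C.
Proof.
rewrite lagpoly_rho (prod_range (fun k => b%:R - k%:R)) // natrM.
have f1 n : \prod_(k < n) (n%:R - k%:R) = n`!%:R :> C.
  elim: n => [|n IH]; first by rewrite big_ord0.
  rewrite big_ord_recl subr0 factS natrM; congr (_ * _).
  by rewrite -IH; apply: eq_bigr => k _; rewrite lift0 -!natr1; ring.
have f2 n m : \prod_(k < n) (m%:R - (k + m.+1)%:R) = (-1) ^+ n * n`!%:R :> C.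
  elim: n => [|n IH]; first by rewrite big_ord0 expr0 mul1r.
  rewrite big_ord_recr /= IH factS natrM exprS addnS -addSn natrD; ring.
rewrite f1 (eq_bigr (fun k : 'I_(N - b.+1) => b%:R - (k + b.+1)%:R)) // f2; ring.
Qed.

(** The two factorials are Gamma values; the product over [k] different from [b] is completed to the
    one in [Gamma_quotE], and [a - b] compensates. *)
Lemma inv_lagrange_basis N (a : C) (b : 'I_N) : (forall k : 'I_N, a <> (k : nat)%:R) ->
  (lagrange_basis a b)^-1 =
  (-1) ^+ (N - b.+1) * (GammaC (N - b)%:R * GammaC b.+1%:R * Gamma_quot N a * (a - b%:R)).
Proof.
move=> ha; rewrite (Gamma_quotE ha) GammaC_nat -[(N - b)%N]prednK ?subn_gt0 // GammaC_nat -subnS.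
rewrite /lagrange_basis lagpoly_rho lagpoly_rho_node natrM.
rewrite [in RHS](bigD1 b) //=.
have -> : \prod_(k < N | k != b :> nat) (a - k%:R) = \prod_(k < N | k != b) (a - k%:R).
  by apply: eq_bigl.
have ab : a - b%:R != 0 by rewrite subr_eq0; apply/eqP; exact: ha.
have p0 : \prod_(k < N | k != b) (a - k%:R) != 0.
  by apply/prodf_neq0 => k _; rewrite subr_eq0; apply/eqP; exact: ha.
have s0 : (-1) ^+ (N - b.+1) != 0 :> C by rewrite signr_eq0.
have f1 : (b`!)%:R != 0 :> C by rewrite pnatr_eq0 -lt0n fact_gt0.
have f2 : ((N - b.+1)`!)%:R != 0 :> C by rewrite pnatr_eq0 -lt0n fact_gt0.
have key (P A s f g : C) : P != 0 -> A != 0 -> s != 0 -> f != 0 -> g != 0 ->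
    (P / (s * (f * g)))^-1 = s * (g * f * (A * P)^-1 * A).
  move=> p1 a1 s1 f0 g0; field.
  by rewrite p1 a1 s1 f0 g0.
exact: key.
Qed.

End DistinctFormula.

(** * Degeneration to coinciding nodes *)

Section Degeneration.
Variables (R : realType) (N : nat) (lambda : 'rV[R]_N).
Local Notation C := R[i].

(** Equal entries are separated at first order by their distinct indices, while different entries
    stay apart for small [e]. *)
Definition perturb (e : R) (i : 'I_N) : R := lambda 0 i + e * (i : nat)%:R.

Definition perturbC (e : R) : 'rV[C]_N := \row_i (perturb e i)%:C.

Definition node (e : R) (i : 'I_N) : C := (expR (perturb e i))%:C.

Lemma perturb0 i : perturb 0 i = lambda 0 i.
Proof. by rewrite /perturb mul0r addr0. Qed.

Lemma perturbC0 : perturbC 0 = map_mx (fun x : R => x%:C) lambda.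
Proof. by apply/rowP => i; rewrite !mxE perturb0. Qed.

Lemma expC_perturbC e : (fun j => expC (perturbC e 0 j)) = node e.
Proof. by apply/funext => j; rewrite mxE expCR. Qed.

Lemma cvg_perturb (F : set_system R) {FF : Filter F} i : F --> (0 : R) ->
  perturb e i @[e --> F] --> perturb 0 i.
Proof.
move=> F0; apply: cvgD; first exact: cvg_cst.
by apply: cvgM; [exact: F0|exact: cvg_cst].
Qed.

Lemma tends_node (F : set_system R) {FF : Filter F} i : F --> (0 : R) ->
  tends F (fun e => node e i) (node 0 i).
Proof.
move=> F0; apply: tends_real; apply: continuous_cvg; first exact: continuous_expR.
exact: cvg_perturb.
Qed.

Lemma dnbhs_cvg : (0 : R)^' --> (0 : R).
Proof. exact: cvg_within. Qed.

Lemma near_perturb_inj : \forall e \near (0 : R)^', injective (perturb e).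
Proof.
have pair (ij : 'I_N * 'I_N) : \forall e \near (0 : R)^',
    perturb e ij.1 = perturb e ij.2 -> ij.1 = ij.2.
  case: ij => i j /=.
  have [->|ij] := eqVneq i j; first exact: nearW.
  have [lij|lij] := eqVneq (lambda 0 i) (lambda 0 j).
    near=> e; rewrite /perturb lij => /addrI.
    have e0 : e != 0 by near: e; exact: nbhs_dnbhs_neq.
    by move=> /(mulfI e0) /eqP; rewrite eqr_nat => /eqP /val_inj.
  have h : (perturb e i - perturb e j) @[e --> (0 : R)^'] --> perturb 0 i - perturb 0 j.
    by apply: cvgB; apply: cvg_perturb; exact: dnbhs_cvg.
  have n0 : perturb 0 i - perturb 0 j != 0 by rewrite !perturb0 subr_eq0.
  have e0 : 0 < `|perturb 0 i - perturb 0 j| by rewrite normr_gt0.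
  move/cvgrPdist_lt: h => /(_ _ e0); apply: filterS => e.
  by move=> + E; rewrite E subrr subr0 ltxx.
by apply: filterS (filter_forall _ pair) => e h i j; exact: (h (i, j)).
Unshelve. all: by end_near. Qed.

Lemma perturbC_inj e : injective (perturb e) -> injective (perturbC e 0).
Proof. by move=> h i j; rewrite !mxE => /complexI /h. Qed.

Lemma node_inj e : injective (perturb e) -> injective (node e).
Proof. by move=> h i j /complexI /expR_inj /h. Qed.

Lemma Bessel_tends (u : 'rV[C]_N) :
  tends (0 : R)^' (fun e => Bessel u (perturbC e)) (Bessel u (perturbC 0)).
Proof.
have [dB _] := Bessel_is_Bessel R N.
have cB := differentiable_continuous (dB (u, perturbC 0)).
apply: (@cvg_comp _ _ _ (fun e => (u, perturbC e))
  (fun y : 'rV[C]_N * 'rV[C]_N => Bessel y.1 y.2 : C^o) _ _ _ _ cB).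
(* The displacement is exactly a multiple of this fixed vector, so its norm is [|e|] times a
   constant. *)
pose v : 'rV[C]_N * 'rV[C]_N := (0, \row_i (i : nat)%:R).
have dist e : rnorm ((u, perturbC 0) - (u, perturbC e) : 'rV[C]_N * 'rV[C]_N) = `|e| * rnorm v.
  have -> : (u, perturbC 0) - (u, perturbC e) = - (e%:C *: v) :> 'rV[C]_N * 'rV[C]_N.
    congr pair; first by rewrite /= subrr scaler0 oppr0.
    apply/rowP => i; rewrite !mxE /perturb mul0r addr0 rmorphD rmorphM /= rmorph_nat.
    by ring.
  apply: complexI; rewrite -rnormE normrN normrZ rnormE rmorphM /=.
  by rewrite normE cmodR.
have v0 : 0 <= rnorm v by exact: rnorm_ge0.
apply: cvg_rnorm => d d0.
have d1 : 0 < d / (rnorm v + 1) by rewrite divr_gt0 // ltr_wpDl.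
near=> e.
have h : `|e| < d / (rnorm v + 1) by near: e; exact: dnbhs0_lt.
rewrite dist; move: h; rewrite ltr_pdivlMr ?ltr_wpDl // => h.
by have := normr_ge0 e; nra.
Unshelve. all: by end_near. Qed.

(** For [y < x], [e^x - e^y = e^y (e^(x-y) - 1) >= e^y (x - y)]: the bound survives as [x] and [y]
    merge. *)
Lemma expR_secant_ge (x y m : R) : m <= x -> m <= y -> x != y ->
  expR m <= `|expR x - expR y| / `|x - y|.
Proof.
wlog xy : x y / y < x.
  move=> h mx my xy; have [l|l|e] := ltgtP x y.
  - by rewrite distrC [`|x - y|]distrC; apply: h => //; rewrite eq_sym.
  - exact: h.
  - by rewrite e eqxx in xy.
move=> mx my _; have d0 : 0 < x - y by rewrite subr_gt0.
rewrite (gtr0_norm d0) ler_pdivlMr // ger0_norm; last by rewrite subr_ge0 ler_expR ltW.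
have -> : expR x = expR y * expR (x - y) by rewrite -expRD addrC subrK.
have h := expR_ge1Dx (x - y).
have e1 : expR m <= expR y by rewrite ler_expR.
have e2 := expR_gt0 m; have e3 := expR_gt0 y.
have : expR y * (1 + (x - y)) <= expR y * expR (x - y) by rewrite ler_wpM2l // ltW.
by nra.
Qed.

Lemma cmod_prod (I : Type) (r : seq I) (P : pred I) (F : I -> C) :
  cmod (\prod_(i <- r | P i) F i) = \prod_(i <- r | P i) cmod (F i).
Proof. by elim/big_rec2: _ => [|i x y _ <-]; rewrite ?cmod1 ?cmodM. Qed.

(** Reversing the rows gives the standard Vandermonde matrix, and the modulus removes the sign of
    the permutation. *)
Lemma cmod_det_vandermonde_mx (x : 'I_N -> C) : cmod (\det (vandermonde_mx x)) =
  \prod_(i < N) \prod_(j < N | (i < j)%N) cmod (x j - x i).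
Proof.
pose s : {perm 'I_N} := perm (@rev_ord_inj N).
have -> : vandermonde_mx x = row_perm s (Vandermonde N (\row_j x j)).
  by apply/matrixP => i j; rewrite !mxE permE.
rewrite row_permE det_mulmx det_perm cmodM cmodX cmodN cmod1 expr1n mul1r.
rewrite det_Vandermonde cmod_prod; apply: eq_bigr => i _.
by rewrite cmod_prod; apply: eq_bigr => j _; rewrite !mxE.
Qed.

(** At distinct perturbed entries the modulus is a product of secant slopes of the exponential, each
    at least [e^m]; this bound is independent of [e] and passes to the limit. *)
Lemma Bessel_rho_neq0 : Bessel (rho R N) (perturbC 0) != 0.
Proof.
(* A lower bound for every [lambda_i + e i] with [|e| < 1], since the index [i] is below [N]. *)
pose m : R := - (\sum_i `|lambda 0 i| + N%:R).
pose c : R := \prod_(i < N) \prod_(j < N | (i < j)%N) expR m.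
have c0 : 0 < c by apply: prodr_gt0 => i _; apply: prodr_gt0 => j _; exact: expR_gt0.
have low : \forall e \near (0 : R)^', c <= cmod (Bessel (rho R N) (perturbC e)).
  have n1 : \forall e \near (0 : R)^', `|e| < 1 by exact: dnbhs0_lt.
  apply: filterS2 near_perturb_inj n1 => e inj e1.
  have mp i : m <= perturb e i.
    rewrite /m /perturb (bigD1 i) //=.
    have s0 : 0 <= \sum_(j < N | j != i) `|lambda 0 j| by apply: sumr_ge0.
    have l1 := ler_norm (- lambda 0 i); rewrite normrN in l1.
    have iN : (i : nat)%:R <= N%:R :> R by rewrite ler_nat ltnW.
    have l2 : - N%:R <= e * (i : nat)%:R.
      move: e1; rewrite ltr_norml => /andP[a1 a2].
      have i0 : 0 <= (i : nat)%:R :> R by [].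
      by nra.
    by lra.
  rewrite Bessel_rho; last exact: perturbC_inj.
  rewrite expC_perturbC cmodM cmodV cmod_det_vandermonde_mx /Vandermonde_prod cmod_prod.
  rewrite -prodf_div; apply: ler_prod => i _; apply/andP; split.
    by apply: prodr_ge0 => j _; exact: expR_ge0.
  rewrite cmod_prod -prodf_div; apply: ler_prod => j ij; rewrite expR_ge0 /=.
  have -> : cmod (node e j - node e i) = `|expR (perturb e i) - expR (perturb e j)|.
    by rewrite -cmodR rmorphB /= -[in RHS]cmodN opprB.
  have -> : cmod (perturbC e 0 i - perturbC e 0 j) = `|perturb e i - perturb e j|.
    by rewrite !mxE -cmodR rmorphB.
  apply: expR_secant_ge => //; apply/eqP => /inj E.
  by move: ij; rewrite E ltnn.
apply/eqP => B0; have := @Bessel_tends (rho R N); rewrite B0 => /tendsP/(_ _ c0).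
move=> n2; have [e [h1 h2]] : exists e, c <= cmod (Bessel (rho R N) (perturbC e)) /\
    cmod (0 - Bessel (rho R N) (perturbC e)) < c.
  by apply: (@filter_ex _ (0 : R)^' _); apply: filterI low n2.
by move: h2; rewrite sub0r cmodN ltNge h1.
Qed.

End Degeneration.

(** * The outer integral and its limit at coinciding nodes *)

Section OuterIntegral.
Variables (R : realType) (N : nat) (lambda : 'rV[R]_N).
Local Notation C := R[i].
Local Notation I01 := (`[0%R, 1%R]%classic : set R).
Local Notation node := (node lambda).
Variables (a : C) (b : 'I_N) (Z : seq (R -> C)).
Hypotheses (cZ : closed_contour Z) (Z_slit : forall z, trace Z z -> slit z).
Hypothesis Z_poles : forall i, encloses Z (node 0 i).

Definition quotient_part (e : R) (z : C) : C :=
  \sum_(m < N - b) (rootpoly (node e))`_(m + b.+1) * z ^+ m.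

(** Minus the inner integral in closed form, for the perturbed nodes. *)
Definition outer_integrand (e : R) (z : C) : C :=
  powC z a / (rootpoly (node e)).[z] * quotient_part e z.

Lemma tends_coef (I : Type) (r : seq I) (T : Type) (F : set_system T) {FF : Filter F}
    (u : T -> I -> C) (l : I -> C) k :
  (forall i, tends F (u ^~ i) (l i)) ->
  tends F (fun s => (\prod_(i <- r) ('X - (u s i)%:P))`_k) (\prod_(i <- r) ('X - (l i)%:P))`_k.
Proof.
move=> h; elim: r k => [|i r IH] k.
  by under [X in tends _ X]eq_fun do rewrite big_nil; rewrite big_nil; exact: tends_cst.
under [X in tends _ X]eq_fun do rewrite big_cons mulrBl coefB coefXM coefCM.
rewrite big_cons mulrBl coefB coefXM coefCM.
apply: tendsB; last by apply: tendsM.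
by case: eqP => _; [exact: tends_cst|exact: IH].
Qed.

Lemma tends_rootpoly (T : Type) (F : set_system T) {FF : Filter F} (x : T -> 'I_N -> C)
    (l : 'I_N -> C) (u : T -> C) (v : C) :
  (forall i, tends F (x ^~ i) (l i)) -> tends F u v ->
  tends F (fun s => (rootpoly (x s)).[u s]) (rootpoly l).[v].
Proof.
move=> hx hu; rewrite horner_rootpoly.
have -> : (fun s => (rootpoly (x s)).[u s]) = fun s => \prod_i (u s - x s i).
  by apply/funext => s; rewrite horner_rootpoly.
by apply: tends_prod => i _; apply: tendsB; [exact: hu|exact: hx].
Qed.

Lemma rootpoly_neq0 e z : (forall i, ~ trace Z (node e i)) -> trace Z z ->
  (rootpoly (node e)).[z] != 0.
Proof.
move=> h tz; rewrite horner_rootpoly; apply/prodf_neq0 => i _.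
exact: trace_neq (h i) tz.
Qed.

Lemma outer_integrand_cont e : (forall i, ~ trace Z (node e i)) ->
  trace_cont Z (outer_integrand e).
Proof.
move=> h z tz; apply: tendsM.
  apply: tendsM; first by apply: powC_cont; exact: Z_slit.
  apply: tendsV; first exact: rootpoly_neq0.
  apply: (@tends_rootpoly C^o _ _ (fun=> node e)); last exact: tends_id.
  by move=> i; exact: tends_cst.
apply: tends_sum => m _; apply: tendsM; first exact: tends_cst.
by apply: tendsX; exact: tends_id.
Qed.

(** The winding number is locally constant off the trace, so one contour serves all small
    perturbations. *)
Lemma near_encloses : \forall e \near (0 : R)^', forall i, encloses Z (node e i).
Proof.
apply: filter_forall => i; have [tr wd] := Z_poles i.
have := winding_near cZ tr; rewrite wd => h.
exact: (@tends_node R N lambda _ _ i (@dnbhs_cvg R)) h.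
Qed.

(** Dividing the Lagrange expansion of the quotient part by the root polynomial yields partial
    fractions with simple poles at the nodes; Cauchy's formula is then applied to each. *)
Lemma oint_outer_distinct e : injective (perturb lambda e) ->
  (forall i, encloses Z (node e i)) ->
  oint Z (outer_integrand e) =
  lagrange_coef (node e) (fun j => powC (node e j) a) b.
Proof.
move=> inj enc; have ni := node_inj inj.
pose x := node e; pose q : {poly C} := \poly_(m < N - b) (rootpoly x)`_(m + b.+1).
have hq z : quotient_part e z = q.[z] by rewrite horner_poly.
have sq : (size q <= N)%N by apply: (leq_trans (size_poly _ _)); exact: leq_subr.
have qx j : q.[x j] = (lagpoly x j)`_b.
  rewrite -hq; apply: (@divided_coef _ N (lagpoly x j) (rootpoly x) (x j)).
  - by rewrite size_lagpoly.
  - exact: ltn_ord.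
  - exact: rootpolyE.
pose f j z := (lagpoly x j)`_b / (lagpoly x j).[x j] * (powC z a / (z - x j)).
have cf j : trace_cont Z (fun z => powC z a / (z - x j)).
  move=> z tz; apply: tendsM; first by apply: powC_cont; exact: Z_slit.
  exact: (trace_cont_inv (enc j).1).
have cF j : trace_cont Z (f j).
  by move=> z tz; apply: tendsM; [exact: tends_cst|exact: cf].
transitivity (oint Z (fun z => \sum_j f j z)).
  apply: eq_oint => z tz; rewrite /outer_integrand hq (lagrange_interp ni z sq) big_distrr /=.
  apply: eq_bigr => j _; rewrite qx /f (rootpolyE x j) hornerM hornerXsubC.
  have l0 : (lagpoly x j).[z] != 0.
    rewrite horner_lagpoly; apply/prodf_neq0 => i _; exact: trace_neq (enc i).1 tz.
  have l1 : (lagpoly x j).[x j] != 0 by exact: lagpoly_neq0.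
  have l2 : z - x j != 0 by exact: trace_neq (enc j).1 tz.
  move: (_`_ _) (_.[z]) (_.[x j]) (powC z a) (z - _) l0 l1 l2 => c L L' p d l0 l1 l2; field.
  by rewrite l0 l1 l2.
rewrite oint_sum //; apply: eq_bigr => j _.
rewrite ointZ // (oint_powC_pole a cZ Z_slit (expR_gt0 _) (enc j)).
by ring.
Qed.

(** The fixed contour avoids the unperturbed nodes, so the integrand converges jointly in the curve
    parameter and [e]; [cint_tends] then applies arc by arc. *)
Lemma oint_outer_tends :
  tends (0 : R)^' (fun e => oint Z (outer_integrand e)) (oint Z (outer_integrand 0)).
Proof.
suff h : tends (0 : R)^' (fun e => \sum_(g <- Z) arc_integral (outer_integrand e) g)
    (\sum_(g <- Z) arc_integral (outer_integrand 0) g).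
  by apply: tendsM h; exact: tends_cst.
have tr0 i : ~ trace Z (node 0 i) by case: (Z_poles i).
apply: tends_sum_seq => g gZ; apply: cint_tends.
- move=> t tI; have tz : trace Z (g t) by exact: in_trace.
  pose F := filter_prod (within I01 (nbhs t)) (0 : R)^'.
  have tg : tends F (fun p : R * R => g p.1) (g t).
    by apply: (tends_fst_within (h := g)); exact: tends_arc (cZ.1 _ gZ).
  have tn i : tends F (fun p : R * R => node p.2 i) (node 0 i).
    apply: (@tends_comp _ R _ _ _ (fun e => node e i) 0 (fun p : R * R => p.2)).
      by apply: tends_node; exact: cvg_id.
    apply: cvg_trans (@dnbhs_cvg R).
    exact: cvg_snd.
  have cp := @powC_cont R a _ (Z_slit tz).
  have tp : tends F (fun p : R * R => powC (g p.1) a) (powC (g t) a).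
    exact: (@tends_comp R C^o _ F _ (fun z => powC z a) (g t) (fun p : R * R => g p.1) cp tg).
  have tv : tends F (fun p : R * R => velocity g p.1) (velocity g t).
    by apply: (tends_fst_within (h := velocity g)); exact: tends_velocity (cZ.1 _ gZ).
  have tr : tends F (fun p : R * R => (rootpoly (node p.2)).[g p.1]) (rootpoly (node 0)).[g t].
    exact: (@tends_rootpoly (R * R) F _ (fun p : R * R => node p.2) (node 0)
      (fun p : R * R => g p.1) (g t) tn tg).
  have tq : tends F (fun p : R * R => quotient_part p.2 (g p.1)) (quotient_part 0 (g t)).
    apply: tends_sum => m _; apply: tendsM; last exact: (@tendsX _ _ F _ _ _ m tg).
    exact: (@tends_coef _ _ _ F _ (fun p : R * R => node p.2) (node 0) (m + b.+1)%N tn).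
  have nz := rootpoly_neq0 tr0 tz.
  exact: tendsM (tendsM (tendsM tp (tendsV nz tr)) tq) tv.
- exact: (ccont_arc cZ (outer_integrand_cont tr0) gZ).
- apply: filterS near_encloses => e enc; 
  exact: (ccont_arc cZ (outer_integrand_cont (fun i => (enc i).1)) gZ).
Qed.

Lemma powC_node e j : powC (node e j) a = expC (a * perturbC lambda e 0 j).
Proof. by rewrite /powC LogC_real ?expR_gt0 // expRK mxE. Qed.

(** The relation is kept free of division by a Bessel value, so both sides have limits as [e] tends
    to 0 and agree by uniqueness. *)
Lemma Bessel_quotient : (forall k : 'I_N, a <> (k : nat)%:R) ->
  Bessel (mu a b) (perturbC lambda 0) =
  oint Z (outer_integrand 0) / lagrange_basis a b * Bessel (rho R N) (perturbC lambda 0).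
Proof.
move=> ha.
have t1 := @Bessel_tends R N lambda (mu a b).
have t2 : tends (0 : R)^' (fun e => oint Z (outer_integrand e) / lagrange_basis a b *
     Bessel (rho R N) (perturbC lambda e))
   (oint Z (outer_integrand 0) / lagrange_basis a b * Bessel (rho R N) (perturbC lambda 0)).
  apply: tendsM; last exact: Bessel_tends.
  by apply: tendsM; [exact: oint_outer_tends|exact: tends_cst].
suff t3 : tends (0 : R)^' (fun e => Bessel (mu a b) (perturbC lambda e))
   (oint Z (outer_integrand 0) / lagrange_basis a b * Bessel (rho R N) (perturbC lambda 0)).
  exact: tends_unique t1 t3.
apply: tends_eq t2; apply: filterS2 (near_perturb_inj lambda) near_encloses => e inj enc.
have ni := node_inj inj.
rewrite (Bessel_mu b ha (perturbC_inj inj)); last by rewrite expC_perturbC.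
rewrite (oint_outer_distinct inj enc) expC_perturbC; congr (lagrange_coef _ _ _ / _ * _).
by apply/funext => j; rewrite powC_node.
Qed.

End OuterIntegral.

(* The source prints the sign (-1)^(N-b+1), for which the two sides are opposite:
   for N = 1, b = 0 the left side is e^(a lambda), the prefactor is 1 and the
   double integral is - e^(a lambda). The sign below is the correct one. *)
Theorem theorem3p2 (R : realType) (N : nat) (lambda : 'rV[R]_N)
    (a : R[i]) (b : 'I_N) (Z W : seq (R -> R[i]))
    (N_ge1 : (1 <= N)%N)
    (a_notin : forall k : 'I_N, a <> (k : nat)%:R)
    (Z_contour : closed_contour Z)
    (W_contour : closed_contour W)
    (Z_poles : forall i, encloses Z (expR (lambda 0 i))%:C)
    (Z_slit : forall z, trace Z z ->
       ~ (complex.Re z <= 0 /\ complex.Im z = 0))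
    (W_zero : encloses W 0)
    (W_Z : forall z, trace Z z -> encloses W z) :
  let lambdaC := map_mx (fun x : R => x%:C) lambda in
  Bessel (mu a b) lambdaC / Bessel (rho R N) lambdaC =
  (-1) ^+ (N - b) *
  (GammaC (N - b)%:R * GammaC (b.+1)%:R * Gamma_quot N a * (a - (b : nat)%:R)) *
  oint Z (fun z =>
    oint W (fun w =>
      powC z a * w ^- b.+1 / (z - w) *
      \prod_(i < N) ((w - (expR (lambda 0 i))%:C)
                     / (z - (expR (lambda 0 i))%:C)))).
Proof.
move=> lambdaC.
have e0 : node lambda 0 = fun i => (expR (lambda 0 i))%:C.
  by apply/funext => i; rewrite /node perturb0.
have poles i : encloses Z (node lambda 0 i) by rewrite e0.
have inner : oint Z (fun z => oint W (fun w => powC z a * w ^- b.+1 / (z - w) *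
      \prod_(i < N) ((w - (expR (lambda 0 i))%:C) / (z - (expR (lambda 0 i))%:C)))) =
    oint Z (fun z => -1 * outer_integrand lambda a b 0 z).
  apply: eq_oint => z tz; have z0 := slit_neq0 (Z_slit z tz).
  (* Here [K] is [z^a] over the root polynomial at [z]; [z] is nonzero since it is off the cut. *)
  rewrite mulN1r /outer_integrand -(oint_horner_div W_contour W_zero (W_Z z tz) z0);
    [|by rewrite size_rootpoly|exact: ltn_ord].
  apply: eq_oint => w tw; rewrite prodf_div !horner_rootpoly e0.
  by ring.
rewrite inner ointZ //; last first.
  by apply: outer_integrand_cont => // i; case: (poles i).
rewrite /lambdaC -perturbC0 (Bessel_quotient b Z_contour Z_slit poles a_notin).
rewrite mulfK ?Bessel_rho_neq0 // (inv_lagrange_basis b a_notin).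
(* [inv_lagrange_basis] brings the sign with exponent [N - b - 1]; the [-1] of the inner integral
   supplies the missing factor. *)
have -> : (N - b = (N - b.+1).+1)%N by rewrite subnSK.
by rewrite exprS; ring.
Qed.
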